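(* There is an absolute constant $c>0$ such that the following holds. Let $A\in\mathbb{R}^{d\times n}$ be a matrix with singular values $1\ge\sigma_1\ge\cdots\ge\sigma_d\ge0$ and corresponding left singular vectors $u_1,\dots,u_d\in\mathbb{R}^d$. Let $\mathsf{gap}=\frac{\sigma_k-\sigma_{k+1}}{\sigma_k}$ be the relative gap. For fixed $\varepsilon,p>0$, consider the output $$V_k\leftarrow\mathrm{LazySVD}\Big(\mathcal A,\;AA^\top,\;k,\;\mathsf{gap},\;c\cdot\frac{\varepsilon^4\cdot\mathsf{gap}^2}{k^4(\sigma_1/\sigma_k)^4},\;p\Big).$$ Then, defining $W=(u_{k+1},\dots,u_d)$, with probability at least $1-p$, $V_k$ is a rank-$k$ column-orthonormal matrix with $\|V_k^\top W\|_2\le\varepsilon$. The running time is $\widetilde O\Big(\frac{k\,\mathsf{nnz}(A)+k^2d}{\sqrt{\mathsf{gap}}}\Big)$ (with $\mathcal A$ being accelerated gradient descent), or $\widetilde O\Big(knd+\frac{kn^{3/4}d}{\sigma_k^{1/2}\sqrt{\mathsf{gap}}}\Big)$ in the stochastic setting (with $\mathcal A$ being accelerated SVRG). Both running times depend only poly-logarithmically on $1/\varepsilon$.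
   Context: The parameters passed to LazySVD are assumed to be in its admissible ranges. If $A$ has fewer than $d$ singular values, zeros are appended, and $u_1,\dots,u_d$ is an orthonormal basis of $\mathbb{R}^d$. $\mathsf{nnz}(A)$ is the number of nonzero entries of $A$; $\|\cdot\|_2$ is the spectral norm. $\widetilde O$ hides logarithmic factors in $1/\mathsf{gap},1/\varepsilon,1/p,n,d,k,1/\sigma_1,\sigma_1/\sigma_k,\sigma_1/\sigma_{k+1}$. Stochastic setting: $A$ is given in the form $AA^\top=\frac1n\sum_{i=1}^na_ia_i^\top$ with each $a_i\in\mathbb{R}^d$ of Euclidean norm at most $1$. $\mathcal A$ is an approximate matrix inversion method: given $\lambda I-M\succ0$, a vector $b$ and an accuracy $\eta>0$, it returns $x$ with $\|x-(\lambda I-M)^{-1}b\|\le\eta$. Its cost, when $M\succeq0$ and $\lambda I-M\succeq\delta I$ with $\lambda,\delta>0$: accelerated gradient descent (AGD) uses $O\big(\frac{\lambda^{1/2}}{\delta^{1/2}}\log\frac{\lambda}{\eta\delta}\big)$ iterations, each costing $O(d)$ plus the time to multiply $M$ with a vector; accelerated SVRG (for $M=\frac1n\sum_i a_ia_i^\top$, $\|a_i\|_2\le1$) takes time $O\big(\max\{nd,\frac{n^{3/4}d\lambda^{1/4}}{\delta^{1/2}}\}\log\frac{\lambda}{\eta\delta}\big)$. Algorithm $\mathrm{AppxPCA}(\mathcal A,M,\delta_\times,\varepsilon,p)$, for symmetric $M\in\mathbb{R}^{d\times d}$ with $0\preceq M\preceq I$, $\delta_\times\in(0,0.5]$, $\varepsilon,p\in(0,1)$: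 1. $m_1\leftarrow\lceil4\log(288d/p^2)\rceil$, $m_2\leftarrow\lceil\log(36d/(p^2\varepsilon))\rceil$; $\widetilde\varepsilon_1\leftarrow\frac{1}{64m_1}(\delta_\times/6)^{m_1}$, $\widetilde\varepsilon_2\leftarrow\frac{\varepsilon}{8m_2}(\delta_\times/6)^{m_2}$. 2. $\widehat w_0\leftarrow$ a uniformly random unit vector; $s\leftarrow0$; $\lambda^{(0)}\leftarrow1+\delta_\times$. 3. Repeat: $s\leftarrow s+1$; for $t=1,\dots,m_1$ apply $\mathcal A$ to find $\widehat w_t$ with $\|\widehat w_t-(\lambda^{(s-1)}I-M)^{-1}\widehat w_{t-1}\|\le\widetilde\varepsilon_1$; set $w\leftarrow\widehat w_{m_1}/\|\widehat w_{m_1}\|$; apply $\mathcal A$ to find $v$ with $\|v-(\lambda^{(s-1)}I-M)^{-1}w\|\le\widetilde\varepsilon_1$; set $\Delta^{(s)}\leftarrow\frac12\cdot\frac{1}{w^\top v-\widetilde\varepsilon_1}$ and $\lambda^{(s)}\leftarrow\lambda^{(s-1)}-\Delta^{(s)}/2$; until $\Delta^{(s)}\le\delta_\times\lambda^{(s)}/3$. 4. $f\leftarrow s$; for $t=1,\dots,m_2$ apply $\mathcal A$ to find $\widehat w_t$ with $\|\widehat w_t-(\lambda^{(f)}I-M)^{-1}\widehat w_{t-1}\|\le\widetilde\varepsilon_2$ (starting again from $\widehat w_0$). Return $w=\widehat w_{m_2}/\|\widehat w_{m_2}\|$. Algorithm $\mathrm{LazySVD}(\mathcal A,M,k,\delta_\times,\varepsilon_{\mathsf{pca}},p)$,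 for $0\preceq M\preceq I$, $k\in\{1,\dots,d\}$, $\delta_\times,\varepsilon_{\mathsf{pca}},p\in(0,1)$: set $M_0=M$ and $V_0=[\,]$ (empty). For $s=1,\dots,k$: $v_s'\leftarrow\mathrm{AppxPCA}(\mathcal A,M_{s-1},\delta_\times/2,\varepsilon_{\mathsf{pca}},p/k)$; $v_s\leftarrow(I-V_{s-1}V_{s-1}^\top)v_s'/\|(I-V_{s-1}V_{s-1}^\top)v_s'\|$; $V_s\leftarrow[V_{s-1},v_s]$; $M_s\leftarrow(I-v_sv_s^\top)M_{s-1}(I-v_sv_s^\top)$. Return $V_k$. *)

(* Defs.v *)
From HB Require Import structures.
From mathcomp Require Import all_boot all_order all_algebra.
From mathcomp Require Import all_classical all_reals all_analysis.

Set Implicit Arguments.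
Unset Strict Implicit.
Unset Printing Implicit Defensive.

Import Order.TTheory GRing.Theory Num.Theory.
Import numFieldNormedType.Exports.

Local Open Scope classical_set_scope.
Local Open Scope ring_scope.

(** * Linear algebra over R *)

(* The norm of 'M[R]_(m, n) in the library is the sup norm of the entries,
   hence the Euclidean norm below. *)
Definition enorm (R : realType) (m : nat) (x : 'cV[R]_m) : R :=
  Num.sqrt (\sum_(i < m) x i 0 ^+ 2).

Definition normalize (R : realType) (m : nat) (x : 'cV[R]_m) : 'cV[R]_m :=
  (enorm x)^-1 *: x.

Definition spectral_norm (R : realType) (m n : nat) (B : 'M[R]_(m, n)) : R :=
  sup [set enorm (B *m x) | x in [set x : 'cV[R]_n | enorm x <= 1]].

Definition posdef (R : realType) (m : nat) (B : 'M[R]_m) : Prop :=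
  B^T = B /\ forall x : 'cV[R]_m, x != 0 -> 0 < (x^T *m B *m x) 0 0.

Definition possemidef (R : realType) (m : nat) (B : 'M[R]_m) : Prop :=
  B^T = B /\ forall x : 'cV[R]_m, 0 <= (x^T *m B *m x) 0 0.

Definition nnz (R : realType) (m n : nat) (A : 'M[R]_(m, n)) : nat :=
  #|[pred ij : 'I_m * 'I_n | A ij.1 ij.2 != 0]|.

(* Families of vectors and of singular values are indexed from 1: the value
   at 0 is never used. *)
Definition orthonormal_family (R : realType) (m r : nat)
    (u : nat -> 'cV[R]_m) : Prop :=
  forall i j, (1 <= i <= r)%N -> (1 <= j <= r)%N ->
    ((u i)^T *m u j) 0 0 = (i == j)%:R.

(* The matrix (u_{k+1}, ..., u_{k+r}). *)
Definition columns (R : realType) (m : nat) (u : nat -> 'cV[R]_m) (k r : nat) :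
    'M[R]_(m, r) :=
  \matrix_(i < m, j < r) u (k + j).+1 i 0.

(* Singular values of A, padded with zeros beyond min(d, n) (so that in
   particular sigma_{d+1} = 0), with left singular vectors u_1, ..., u_d
   completed into an orthonormal basis of R^d. *)
Definition left_singular_system (R : realType) (d n : nat) (A : 'M[R]_(d, n))
    (sigma : nat -> R) (u : nat -> 'cV[R]_d) : Prop :=
  [/\ forall i, (1 <= i)%N -> 0 <= sigma i.+1 <= sigma i,
      forall i, (minn d n < i)%N -> sigma i = 0,
      orthonormal_family d u
    & exists v : nat -> 'cV[R]_n, orthonormal_family (minn d n) v /\
        A = \sum_(1 <= i < (minn d n).+1) sigma i *: (u i *m (v i)^T)].

(** * Approximate inversion and AppxPCA *)

(* A label (s, r, t) names a call of the inversion method: s is the round of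
   LazySVD, r the pass through the repeat loop of AppxPCA (r = 0 for the final
   inverse power method) and t the step in that pass.  The method may use its
   label, so that a randomized method can use fresh randomness in each call. *)
Definition label : Type := (nat * nat * nat)%type.

(* [A l lam M b eta] approximates (lam I - M)^{-1} b. *)
Definition inversion_method (R : realType) (d : nat) : Type :=
  label -> R -> 'M[R]_d -> 'cV[R]_d -> R -> 'cV[R]_d.

Definition inversion_correct (R : realType) (d : nat)
    (A : inversion_method R d) : Prop :=
  forall l lam M b eta, 0 < eta -> posdef (lam%:M - M) ->
    enorm (A l lam M b eta - invmx (lam%:M - M) *m b) <= eta.

Record call (R : realType) (d : nat) : Type := Call {
  call_label : label;
  call_lambda : R;
  call_mx : 'M[R]_d;
  call_rhs : 'cV[R]_d;
  call_tol : R }.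

Definition call_round (R : realType) (d : nat) (c : call R d) : nat :=
  (call_label c).1.1.

Definition pca_m1 (R : realType) (d : nat) (p : R) : nat :=
  `|Num.ceil (4 * ln (288 * d%:R / p ^+ 2))|%N.

Definition pca_m2 (R : realType) (d : nat) (eps p : R) : nat :=
  `|Num.ceil (ln (36 * d%:R / (p ^+ 2 * eps)))|%N.

Definition pca_tol1 (R : realType) (d : nat) (delta p : R) : R :=
  (64 * (pca_m1 d p)%:R)^-1 * (delta / 6) ^+ pca_m1 d p.

Definition pca_tol2 (R : realType) (d : nat) (delta eps p : R) : R :=
  eps / (8 * (pca_m2 d eps p)%:R) * (delta / 6) ^+ pca_m2 d eps p.

(* The vector \hat w_t of pass r in round s. *)
Fixpoint inverse_power (R : realType) (d : nat) (A : inversion_method R d)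
    (s r : nat) (lam : R) (M : 'M[R]_d) (eta : R) (w0 : 'cV[R]_d) (t : nat) :
    'cV[R]_d :=
  if t is t'.+1 then
    A (s, r, t) lam M (inverse_power A s r lam M eta w0 t') eta
  else w0.

Definition inverse_power_calls (R : realType) (d : nat)
    (A : inversion_method R d) (s r : nat) (lam : R) (M : 'M[R]_d) (eta : R)
    (w0 : 'cV[R]_d) (m : nat) : seq (call R d) :=
  [seq Call (s, r, t.+1) lam M (inverse_power A s r lam M eta w0 t) eta
     | t <- iota 0 m].

Section AppxPCA.
Context (R : realType) (d : nat).
Context (A : inversion_method R d) (s : nat) (M : 'M[R]_d).
Context (delta eps p : R) (w0 : 'cV[R]_d).

Let m1 := pca_m1 d p.
Let m2 := pca_m2 d eps p.
Let tol1 := pca_tol1 d delta p.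
Let tol2 := pca_tol2 d delta eps p.

Definition pass_vector (r : nat) (lam : R) : 'cV[R]_d :=
  normalize (inverse_power A s r lam M tol1 w0 m1).

Definition pass_Delta (r : nat) (lam : R) : R :=
  let w := pass_vector r lam in
  let v := A (s, r, m1.+1) lam M w tol1 in
  2^-1 * (((w^T *m v) 0 0) - tol1)^-1.

Definition pass_lambda (r : nat) (lam : R) : R := lam - pass_Delta r lam / 2.

Definition pass_calls (r : nat) (lam : R) : seq (call R d) :=
  rcons (inverse_power_calls A s r lam M tol1 w0 m1)
        (Call (s, r, m1.+1) lam M (pass_vector r lam) tol1).

(* [pca_loop r lam lamf tr]: the repeat loop, entered for its r-th pass with
   lambda^{(r-1)} = lam, terminates with lambda^{(f)} = lamf and has then
   performed the calls tr. *)
Inductive pca_loop : nat -> R -> R -> seq (call R d) -> Prop :=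
| pca_loop_stop r lam :
    pass_Delta r lam <= delta * pass_lambda r lam / 3 ->
    pca_loop r lam (pass_lambda r lam) (pass_calls r lam)
| pca_loop_continue r lam lamf tr :
    delta * pass_lambda r lam / 3 < pass_Delta r lam ->
    pca_loop r.+1 (pass_lambda r lam) lamf tr ->
    pca_loop r lam lamf (pass_calls r lam ++ tr).

(* AppxPCA, started from the unit vector w0, terminates with output w and
   performs the calls tr. *)
Definition appxpca (w : 'cV[R]_d) (tr : seq (call R d)) : Prop :=
  exists (lamf : R) (tr' : seq (call R d)),
    [/\ pca_loop 1 (1 + delta) lamf tr',
        w = normalize (inverse_power A s 0 lamf M tol2 w0 m2)
      & tr = tr' ++ inverse_power_calls A s 0 lamf M tol2 w0 m2].

End AppxPCA.

(** * LazySVD *)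

(* State (V_s, M_s) after s rounds, with the calls made so far; round s starts
   from the unit vector [w0 s].  Given A and w0 the execution is deterministic,
   and it has no result exactly when some repeat loop does not terminate. *)
Inductive lazysvd_state (R : realType) (d : nat) (A : inversion_method R d)
    (M : 'M[R]_d) (k : nat) (delta eps p : R) (w0 : nat -> 'cV[R]_d) :
    forall s : nat, 'M[R]_(d, s) -> 'M[R]_d -> seq (call R d) -> Prop :=
| lazysvd_init : lazysvd_state A M k delta eps p w0 (0 : 'M[R]_(d, 0)) M [::]
| lazysvd_round s (V : 'M[R]_(d, s)) Ms tr v' tr' :
    lazysvd_state A M k delta eps p w0 V Ms tr ->
    appxpca A s.+1 Ms (delta / 2) eps (p / k%:R) (w0 s.+1) v' tr' ->
    let v := normalize ((1%:M - V *m V^T) *m v') in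
    lazysvd_state A M k delta eps p w0
      (castmx (erefl d, addn1 s) (row_mx V v))
      ((1%:M - v *m v^T) *m Ms *m (1%:M - v *m v^T))
      (tr ++ tr').

Definition lazysvd (R : realType) (d : nat) (A : inversion_method R d)
    (M : 'M[R]_d) (k : nat) (delta eps p : R) (w0 : nat -> 'cV[R]_d)
    (V : 'M[R]_(d, k)) (tr : seq (call R d)) : Prop :=
  exists Mk : 'M[R]_d, lazysvd_state A M k delta eps p w0 V Mk tr.
Arguments lazysvd {R d} A M k delta eps p w0 V tr.

(** * Randomness *)

Notation borel_mx R m n := (g_sigma_algebraType (@open 'M[R]_(m, n))).

(* The uniform law on the unit sphere is the rotation invariant one. *)
Definition uniform_unit_vector (R : realType) (dT : measure_display)
    (T : measurableType dT) (P : probability T R) (d : nat)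
    (w : T -> 'cV[R]_d) : Prop :=
  [/\ measurable_fun [set: T] (w : T -> borel_mx R d 1),
      {ae P, forall t, enorm (w t) = 1}
    & forall (Q : 'M[R]_d) (B : set (borel_mx R d 1)),
        Q^T *m Q = 1%:M -> measurable B ->
        P [set t | B (Q *m w t)] = P [set t | B (w t)]].

(* Mutual independence of xi, w_1, ..., w_k; as each of the sets may be the
   whole space, the product rule for all of them covers every subfamily. *)
Definition independent_starts (R : realType) (dT dX : measure_display)
    (T : measurableType dT) (X : measurableType dX) (P : probability T R)
    (d k : nat) (xi : T -> X) (w : nat -> T -> 'cV[R]_d) : Prop :=
  forall (S : set X) (B : nat -> set (borel_mx R d 1)),
    measurable S -> (forall s, measurable (B s)) ->
    P [set t | S (xi t) /\ forall s, (1 <= s <= k)%N -> B s (w s t)] =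
    (P [set t | S (xi t)] * \prod_(1 <= s < k.+1) P [set t | B s (w s t)])%E.

(* Joint measurability in the seed x of the method and in its inputs. *)
Definition inversion_measurable (R : realType) (dX : measure_display)
    (X : measurableType dX) (d : nat) (A : X -> inversion_method R d) : Prop :=
  forall l : label,
    measurable_fun
      [set: X * (measurableTypeR R * borel_mx R d d * borel_mx R d 1
                 * measurableTypeR R)]
      (fun z => A z.1 l z.2.1.1.1 z.2.1.1.2 z.2.1.2 z.2.2 : borel_mx R d 1).

(* Q itself need not be measurable. *)
Definition with_probability (R : realType) (dT : measure_display)
    (T : measurableType dT) (P : probability T R) (q : R) (Q : T -> Prop) :
    Prop :=
  exists2 E : set T, measurable E & (q%:E <= P E)%E /\ forall t, E t -> Q t.

(** * Running time *)

(* log (lam / (eta delta)) as it occurs inside a big-O, that is, read as at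
   least 1: the bounds stay meaningful for coarse accuracies. *)
Definition log_accuracy (R : realType) (lam delta eta : R) : R :=
  Num.max 1 (ln (lam / (eta * delta))).

(* K is a common bound for the hidden constants of the elementary operations
   and of the inversion method.  M_0 = A A^T is applied through A^T and then A,
   and M_s = (I - v_s v_s^T) M_{s-1} (I - v_s v_s^T) through M_{s-1} and two
   rank-one corrections. *)
Fixpoint apply_time (R : realType) (d n : nat) (K : R) (A : 'M[R]_(d, n))
    (s : nat) : R :=
  if s is s'.+1 then apply_time K A s' + K * d%:R else K * (nnz A)%:R.

(* The calls of round s concern the matrix M_{s-1}. *)
Definition agd_time (R : realType) (d n : nat) (K : R) (A : 'M[R]_(d, n))
    (tau : call R d -> R) : Prop :=
  forall (c : call R d) (delta : R),
    let lam := call_lambda c in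
    0 < lam -> 0 < delta -> 0 < call_tol c -> possemidef (call_mx c) ->
    possemidef (lam%:M - call_mx c - delta%:M) ->
    exists iterations : nat,
      iterations%:R <= K * (Num.sqrt lam / Num.sqrt delta)
                         * log_accuracy lam delta (call_tol c)
      /\ tau c <=
           iterations%:R * (K * d%:R + apply_time K A (call_round c).-1).

Definition average_outer (R : realType) (d n : nat) (a : 'I_n -> 'cV[R]_d) :
    'M[R]_d :=
  n%:R^-1 *: \sum_(i < n) a i *m (a i)^T.

Definition svrg_time (R : realType) (d n : nat) (K : R)
    (tau : call R d -> R) : Prop :=
  forall (c : call R d) (delta : R) (a : 'I_n -> 'cV[R]_d),
    let lam := call_lambda c in
    0 < lam -> 0 < delta -> 0 < call_tol c ->
    (forall i, enorm (a i) <= 1) -> call_mx c = average_outer a ->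
    possemidef (lam%:M - call_mx c - delta%:M) ->
    tau c <=
      K * Num.max (n%:R * d%:R)
            (n%:R `^ (3 / 4) * d%:R * lam `^ (1 / 4) / Num.sqrt delta)
        * log_accuracy lam delta (call_tol c).

(* Each call of the inversion method comes with O(d) elementary operations on
   vectors (normalization, inner products, sampling); round s needs O(s d) for
   projecting and normalizing v_s'. *)
Definition lazysvd_agd_time (R : realType) (d k : nat) (K : R)
    (tau : call R d -> R) (tr : seq (call R d)) : R :=
  \sum_(c <- tr) (tau c + K * d%:R)
  + \sum_(1 <= s < k.+1) K * (s%:R * d%:R).

(* In the stochastic setting each round also replaces every a_i by
   (I - v_s v_s^T) a_i, so that M_s is again an average of outer products. *)
Definition lazysvd_svrg_time (R : realType) (d n k : nat) (K : R)
    (tau : call R d -> R) (tr : seq (call R d)) : R :=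
  \sum_(c <- tr) (tau c + K * d%:R)
  + \sum_(1 <= s < k.+1) K * (s%:R * d%:R + n%:R * d%:R).

(* [T = soft-O(B)] means T <= C * B * polylog q xs for constants C and q, where
   xs lists the quantities whose logarithms are hidden. *)
Definition polylog (R : realType) (q : nat) (xs : seq R) : R :=
  \prod_(x <- xs) (1 + Num.max 0 (ln x)) ^+ q.

(* Main.v *)
Require Import Defs.
From HB Require Import structures.
From mathcomp Require Import all_boot all_order all_algebra.
From mathcomp Require Import all_classical all_reals all_analysis.
From mathcomp Require Import ring lra complex measurable_realfun.

Set Implicit Arguments.
Unset Strict Implicit.
Unset Printing Implicit Defensive.

Import Order.TTheory GRing.Theory Num.Theory.
Import numFieldNormedType.Exports.

Local Open Scope classical_set_scope.
Local Open Scope ring_scope.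

(* In an eigenbasis of N with top eigenvalue l1, a step of the inverse power
   method at lam > l1, rescaled by lam - l1, keeps the top components and
   contracts the others.  So a start with mass at least p^2/(9 d) on the top
   eigenspace gives a good Rayleigh quotient in each pass of AppxPCA: lam - l1
   shrinks by a factor of at most 3/4 until it is of order delta l1, and the
   final iteration leaves mass at most eps below (1 - delta) l1.
   In LazySVD a dimension count keeps the top eigenvalue of each M_s above
   sigma_k^2.  Deflating by an almost top vector perturbs the low eigenspaces by
   a rank-one term, hence by at most sqrt(eps) sigma_1^2 over the gap between two
   thresholds; k thresholds between (1 - gap) sigma_k^2 and (1 - gap/2) sigma_k^2
   carry u_{k+1}, ..., u_d through the k deflations.
   M_{s-1} depends only on the past of round s, so its start is independent of
   it; rotation invariance makes the component of the start along a fixed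
   direction anticoncentrated, the direction of a top eigenvector is approximated
   from countably many, and a union bound over the k rounds gives probability
   1 - p.  Every call is made with lam - l1 at least of order gap l1 and
   l1 >= sigma_k^2, which bounds its condition number by O(1/gap). *)

(** * Symmetric matrices *)

(** Two obstacles shape the proof. The repeat loop is a relation that may have no result, and an
    eigenbasis of a random matrix has no evident measurable choice. So the run is also computed by
    total functions with a bound on the number of passes, measurable on the whole sample space and
    shown to follow the relation when all starts are good; and statements about mass hold for all
    eigenbases at once. The uniform law is known only through rotation invariance, with no density.
    Differentiating a mean along a rotation gives a Stein identity, hence a recursion for the
    moments of [1 - <x, w>^2], and these bound the probability of a thin band around an equator.
    Errors of the [k] deflations add up instead of compounding because the tracked vector is
    projected, so its norm never grows. With steps of [gap sigma_k^2 / (2k)] between thresholds,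
    each deflation costs about [2k sqrt(eps_pca) sigma_1^2 / (gap sigma_k^2)]; asking that [k] times
    this be [eps^2 / 2] gives [eps_pca] with [c = 1/16]. *)

Section InnerProduct.
Context {R : realType}.
Implicit Types (m n : nat).

Definition dotv m (x y : 'cV[R]_m) : R := (x^T *m y) 0 0.

Lemma dotvE m (x y : 'cV[R]_m) : dotv x y = \sum_i x i 0 * y i 0.
Proof. by rewrite /dotv mxE; apply: eq_bigr => i _; rewrite mxE. Qed.

Lemma dotvC m (x y : 'cV[R]_m) : dotv x y = dotv y x.
Proof. by rewrite !dotvE; apply: eq_bigr => i _; rewrite mulrC. Qed.

Lemma dotvDr m (x y z : 'cV[R]_m) : dotv x (y + z) = dotv x y + dotv x z.
Proof. by rewrite /dotv mulmxDr mxE. Qed.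

Lemma dotvDl m (x y z : 'cV[R]_m) : dotv (x + y) z = dotv x z + dotv y z.
Proof. by rewrite dotvC dotvDr !(dotvC z). Qed.

Lemma dotvZr m a (x y : 'cV[R]_m) : dotv x (a *: y) = a * dotv x y.
Proof. by rewrite /dotv -scalemxAr mxE. Qed.

Lemma dotvZl m a (x y : 'cV[R]_m) : dotv (a *: x) y = a * dotv x y.
Proof. by rewrite dotvC dotvZr dotvC. Qed.

Lemma dotvNr m (x y : 'cV[R]_m) : dotv x (- y) = - dotv x y.
Proof. by rewrite -scaleN1r dotvZr mulN1r. Qed.

Lemma dotvNl m (x y : 'cV[R]_m) : dotv (- x) y = - dotv x y.
Proof. by rewrite dotvC dotvNr dotvC. Qed.

Lemma dotvBr m (x y z : 'cV[R]_m) : dotv x (y - z) = dotv x y - dotv x z.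
Proof. by rewrite dotvDr dotvNr. Qed.

Lemma dotvBl m (x y z : 'cV[R]_m) : dotv (x - y) z = dotv x z - dotv y z.
Proof. by rewrite dotvDl dotvNl. Qed.

Lemma dotv0r m (x : 'cV[R]_m) : dotv x 0 = 0.
Proof. by rewrite -(scale0r 0) dotvZr mul0r. Qed.

Lemma dotv0l m (x : 'cV[R]_m) : dotv 0 x = 0.
Proof. by rewrite dotvC dotv0r. Qed.

Lemma dotv_mulmxr m n (x : 'cV[R]_m) (B : 'M[R]_(m, n)) (y : 'cV[R]_n) :
  dotv x (B *m y) = dotv (B^T *m x) y.
Proof. by rewrite /dotv trmx_mul trmxK mulmxA. Qed.

Lemma quadratic_form m (B : 'M[R]_m) (x : 'cV[R]_m) :
  (x^T *m B *m x) 0 0 = dotv x (B *m x).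
Proof. by rewrite /dotv mulmxA. Qed.

Lemma outer_mulmx m n (x : 'cV[R]_m) (y z : 'cV[R]_n) :
  x *m y^T *m z = dotv y z *: x.
Proof.
rewrite -mulmxA; apply/colP => i; rewrite !mxE big_ord1.
by rewrite -[X in _ * X]/(dotv y z) mulrC.
Qed.

Lemma dotvv_sum m (x : 'cV[R]_m) : dotv x x = \sum_i x i 0 ^+ 2.
Proof. by rewrite dotvE; apply: eq_bigr => i _; rewrite expr2. Qed.

Lemma dotvv_ge0 m (x : 'cV[R]_m) : 0 <= dotv x x.
Proof. by rewrite dotvv_sum; apply: sumr_ge0 => i _; apply: sqr_ge0. Qed.

Lemma dotvv_eq0 m (x : 'cV[R]_m) : (dotv x x == 0) = (x == 0).
Proof.
apply/idP/eqP => [|->]; last by rewrite dotv0r.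
rewrite dotvv_sum psumr_eq0 => [/allP x0|i _]; last exact: sqr_ge0.
apply/colP => i; rewrite mxE; apply/eqP; rewrite -sqrf_eq0.
by apply: x0; rewrite mem_index_enum.
Qed.

Lemma enorm_sqr m (x : 'cV[R]_m) : enorm x ^+ 2 = dotv x x.
Proof. by rewrite /enorm -dotvv_sum sqr_sqrtr// dotvv_ge0. Qed.

Lemma enormE m (x : 'cV[R]_m) : enorm x = Num.sqrt (dotv x x).
Proof. by rewrite /enorm dotvv_sum. Qed.

Lemma enorm_ge0 m (x : 'cV[R]_m) : 0 <= enorm x.
Proof. by rewrite /enorm sqrtr_ge0. Qed.

Lemma enorm_le m (x : 'cV[R]_m) b : 0 <= b -> (enorm x <= b) = (dotv x x <= b ^+ 2).
Proof.
by move=> b0; rewrite -enorm_sqr ler_sqr// nnegrE ?enorm_ge0.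
Qed.

Lemma enorm_eq0 m (x : 'cV[R]_m) : (enorm x == 0) = (x == 0).
Proof. by rewrite -sqrf_eq0 enorm_sqr dotvv_eq0. Qed.

Lemma enorm_eq1 m (x : 'cV[R]_m) : enorm x = 1 -> dotv x x = 1.
Proof. by rewrite -enorm_sqr => ->; rewrite expr1n. Qed.

Lemma enormZ m a (x : 'cV[R]_m) : enorm (a *: x) = `|a| * enorm x.
Proof.
by rewrite !enormE dotvZl dotvZr mulrA -expr2 sqrtrM ?sqr_ge0// sqrtr_sqr.
Qed.

Lemma enorm_normalize m (x : 'cV[R]_m) : x != 0 -> enorm (normalize x) = 1.
Proof.
move=> x0; rewrite /normalize enormZ ger0_norm ?invr_ge0 ?enorm_ge0//.
by rewrite mulVf// enorm_eq0.
Qed.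

Lemma cauchy_schwarz m (x y : 'cV[R]_m) :
  dotv x y ^+ 2 <= dotv x x * dotv y y.
Proof.
have [->|y0] := eqVneq y 0; first by rewrite !dotv0r expr0n mulr0.
have yy : 0 < dotv y y by rewrite lt_neqAle dotvv_ge0 eq_sym dotvv_eq0 y0.
have := dotvv_ge0 (dotv y y *: x - dotv x y *: y).
rewrite !(dotvBl, dotvBr, dotvZl, dotvZr) (dotvC y x) => h.
rewrite -subr_ge0 -(pmulr_rge0 _ yy).
by apply: le_trans h _; rewrite le_eqVlt; apply/orP; left; apply/eqP; ring.
Qed.

Lemma ler_dotv m (x y : 'cV[R]_m) : `|dotv x y| <= enorm x * enorm y.
Proof.
rewrite -ler_sqr ?nnegrE ?mulr_ge0 ?enorm_ge0// exprMn !enorm_sqr.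
by rewrite real_normK ?num_real// cauchy_schwarz.
Qed.

Lemma enormD m (x y : 'cV[R]_m) : enorm (x + y) <= enorm x + enorm y.
Proof.
rewrite enorm_le ?addr_ge0 ?enorm_ge0// sqrrD !enorm_sqr dotvDl !dotvDr.
rewrite (dotvC y x) addrA -(addrA (dotv x x)) lerD2r lerD2l -mulr2n lerMn2r/=.
by apply: le_trans (ler_norm _) (ler_dotv _ _).
Qed.

Lemma dotv_orth m n (Q : 'M[R]_(m, n)) (x y : 'cV[R]_n) :
  Q^T *m Q = 1%:M -> dotv (Q *m x) (Q *m y) = dotv x y.
Proof. by move=> QQ; rewrite dotv_mulmxr mulmxA QQ mul1mx. Qed.

Lemma enorm_orth m n (Q : 'M[R]_(m, n)) (x : 'cV[R]_n) :
  Q^T *m Q = 1%:M -> enorm (Q *m x) = enorm x.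
Proof. by move=> QQ; rewrite !enormE dotv_orth. Qed.

Lemma orthC m (Q : 'M[R]_m) : Q^T *m Q = 1%:M -> Q *m Q^T = 1%:M.
Proof. exact: mulmx1C. Qed.

End InnerProduct.

(** * Spectral theorem for real symmetric matrices *)

Section RealSpectral.
Context {R : realType}.

Local Notation C := R[i].
Local Notation toC := (real_complex R).

(* A complex eigenvector x + iy of a real symmetric matrix for the eigenvalue
   b + ic satisfies c (|x|^2 + |y|^2) = 0, so that x and y are real
   eigenvectors. *)
Lemma symmetric_eigenvector n (M : 'M[R]_n.+1) : M^T = M ->
  exists (a : R) (x : 'cV[R]_n.+1), enorm x = 1 /\ M *m x = a *: x.
Proof.
move=> MT; pose MC := map_mx toC M.
have [a /eigenvalueP[v vM v0]] : exists a, eigenvalue MC a.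
  exact: eigenvalue_closed.
pose x := \col_i complex.Re (v 0 i); pose y := \col_i complex.Im (v 0 i).
have MxE i j : (M *m x) i 0 = complex.Re ((v *m MC) 0 i)
    /\ (M *m y) j 0 = complex.Im ((v *m MC) 0 j).
  split; rewrite !mxE raddf_sum/=; apply: eq_bigr => l _; rewrite !mxE.
    rewrite -{1}MT mxE; case: (v 0 l) => p q /=.
    by rewrite mulr0 subr0 mulrC.
  rewrite -{1}MT mxE; case: (v 0 l) => p q /=.
  by rewrite mulr0 add0r mulrC.
case: a vM => b c vM.
have Mx : M *m x = b *: x - c *: y.
  apply/colP => i; rewrite (MxE i i).1 vM !mxE; case: (v 0 i) => p q /=.
  by [].
have My : M *m y = c *: x + b *: y.
  apply/colP => i; rewrite (MxE i i).2 vM !mxE; case: (v 0 i) => p q /=.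
  by rewrite addrC.
have c0 : c = 0.
  have := dotv_mulmxr x M y; rewrite MT Mx My.
  rewrite !(dotvDr, dotvNl, dotvDl, dotvZl, dotvZr) => h.
  have {}h : c * (dotv x x + dotv y y) = 0 by lra.
  move/eqP: h; rewrite mulf_eq0 => /orP[/eqP//|].
  rewrite paddr_eq0 ?dotvv_ge0// !dotvv_eq0 => /andP[/eqP x0 /eqP y0].
  case/eqP: v0; apply/rowP => i.
  have := congr1 (fun z : 'cV[R]_n.+1 => z i 0) x0.
  have := congr1 (fun z : 'cV[R]_n.+1 => z i 0) y0.
  by rewrite !mxE; case: (v 0 i) => p q /= -> ->.
have [z z0 Mz] : exists2 z : 'cV[R]_n.+1, z != 0 & M *m z = b *: z.
  rewrite c0 !scale0r subr0 add0r in Mx My.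
  have [x0|x0] := eqVneq x 0; last by exists x.
  have [y0|y0] := eqVneq y 0; last by exists y.
  case/eqP: v0; apply/rowP => i.
  have := congr1 (fun z : 'cV[R]_n.+1 => z i 0) x0.
  have := congr1 (fun z : 'cV[R]_n.+1 => z i 0) y0.
  by rewrite !mxE; case: (v 0 i) => p q /= -> ->.
exists b, (normalize z); rewrite enorm_normalize//; split => //.
by rewrite /normalize -scalemxAr Mz !scalerA mulrC.
Qed.

(* A Householder reflection exchanges the first basis vector and x. *)
Lemma orth_first_column n (x : 'cV[R]_n.+1) : enorm x = 1 ->
  exists Q : 'M[R]_n.+1, Q^T *m Q = 1%:M /\ col 0 Q = x.
Proof.
move=> /enorm_eq1 x1; pose e : 'cV[R]_n.+1 := delta_mx 0 0.
have ee : dotv e e = 1.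
  by rewrite dotvE (bigD1 0)//= big1 => [|i /negPf i0];
    rewrite !mxE ?eqxx ?addr0 ?mulr1// i0 mul0r.
have [<-|ne] := eqVneq e x.
  exists 1%:M; rewrite trmx1 mul1mx; split => //.
  by apply/colP => i; rewrite !mxE eqxx andbT.
pose w := e - x.
have ww : dotv w w != 0 by rewrite dotvv_eq0 subr_eq0.
(* [e] and [x] have the same norm, so [|e - x|^2 = 2 <e - x, e>]; this makes the reflection along
   [w] send [e] exactly to [x]. *)
have wwE : dotv w w = 2 * dotv w e.
  by rewrite !(dotvBl, dotvBr) ee x1 (dotvC e x); lra.
pose r := 2 / dotv w w.
pose Q : 'M[R]_n.+1 := 1%:M - r *: (w *m w^T).
have QT : Q^T = Q.
  by rewrite /Q linearB/= trmx1 linearZ/= trmx_mul trmxK.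
exists Q; split.
  rewrite QT /Q mulmxBl mul1mx mulmxBr mulmx1 -scalemxAl -scalemxAr.
  have -> : w *m w^T *m (w *m w^T) = dotv w w *: (w *m w^T).
    by rewrite mulmxA outer_mulmx scalemxAl.
  rewrite !scalerA; apply/matrixP => i j; rewrite !mxE /r.
  by field.
have -> : col 0 Q = Q *m e by rewrite colE.
rewrite /Q mulmxBl mul1mx -scalemxAl outer_mulmx scalerA.
have -> : r * dotv w e = 1.
  by rewrite /r wwE; field; apply: contraNneq ww; rewrite wwE => ->; rewrite mulr0.
by rewrite scale1r opprB addrC subrK.
Qed.

(** Induction on the dimension: with a unit eigenvector as first column of an orthogonal [Q], the
    first column of [Q^T M Q] is a multiple of the first basis vector, symmetry clears the first
    row, and the hypothesis applies to the remaining block. *)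
Theorem spectral_theorem n (M : 'M[R]_n) : M^T = M ->
  exists (Q : 'M[R]_n) (l : 'rV[R]_n),
    Q^T *m Q = 1%:M /\ M = Q *m diag_mx l *m Q^T.
Proof.
elim: n M => [|n IH] M MT.
  by exists 1%:M, 0; split; apply/matrixP => -[].
have [a [x [x1 Mx]]] := symmetric_eigenvector MT.
have [Q [QQ Qx]] := orth_first_column x1.
have QQC := orthC QQ.
(* One matrix under two types: size [n.+1] for computing columns, size [1 + n] for block
   decompositions. *)
pose N0 := Q^T *m M *m Q; pose N : 'M[R]_(1 + n) := N0.
have NT : N^T = N by rewrite /N /N0 !trmx_mul trmxK MT mulmxA.
have Ncol i : N i 0 = a * (i == 0)%:R.
  have <- : (col 0 N0) i 0 = N i 0 by rewrite [LHS]mxE.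
  rewrite /N0 colE -mulmxA -colE Qx -mulmxA Mx -scalemxAr mxE; congr (_ * _).
  have := congr1 (fun B : 'M[R]_n.+1 => (col 0 B) i 0) QQ.
  by rewrite colE -mulmxA -colE Qx => ->; rewrite !mxE.
have NdE : N = N0 by [].
clearbody N.
have DT : (drsubmx N)^T = drsubmx N by rewrite trmx_drsub NT.
have [Q' [l [QQ' N'E]]] := IH (drsubmx N) DT.
have NE : N = block_mx (a%:M) 0 0 (drsubmx N).
  rewrite -[LHS]submxK; congr block_mx; apply/matrixP => i j; rewrite !ord1.
  - rewrite !mxE !lshift0 Ncol eqxx mulr1 mulr1n.
    by [].
  - by rewrite -NT !mxE !lshift0 Ncol -val_eqE/= mulr0.
  - by rewrite !mxE !lshift0 Ncol -val_eqE/= mulr0.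
pose P : 'M[R]_(1 + n) := block_mx 1%:M 0 0 Q'.
have PP : P^T *m P = 1%:M.
  rewrite /P tr_block_mx mulmx_block !trmx0 !trmx1 !(mulmx0, mul0mx).
  by rewrite !(addr0, add0r) QQ' mulmx1 -scalar_mx_block.
exists (Q *m P), (row_mx a%:M l : 'rV_(1 + n)); split.
  by rewrite trmx_mul mulmxA -(mulmxA P^T) QQ mulmx1 PP.
have -> : M = Q *m N *m Q^T.
 by rewrite NdE /N0 !mulmxA QQC mul1mx -mulmxA QQC mulmx1.
have PDP : P *m diag_mx (row_mx a%:M l) *m P^T = N.
  have -> := diag_mx_row (a%:M : 'rV_1) l.
  have -> : diag_mx (a%:M : 'rV[R]_1) = a%:M.
    by apply/matrixP => i j; rewrite !ord1 !mxE eqxx.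
  rewrite NE N'E /P tr_block_mx !mulmx_block !trmx0 !trmx1.
  by rewrite !(mulmx0, mul0mx, addr0, add0r, mulmx1, mul1mx).
rewrite trmx_mul !mulmxA; congr (_ *m _); rewrite -!mulmxA; congr (_ *m _).
by rewrite -PDP -mulmxA.
Qed.

End RealSpectral.

(** * Numerical estimates *)

Section Numerics.
Context {R : realType}.

(** From [e^(-1/8) >= 7/8] follows [e <= (8/7)^8 < 3]. It serves to compare powers of 1/3 with
    [e^(-m)]. *)
Lemma expR1_le : expR 1 <= 3 :> R.
Proof.
have h : expR (8%:R^-1) <= 8 / 7 :> R.
  have h1 : 7 / 8 <= expR (- 8%:R^-1) :> R.
    by apply: le_trans (expR_ge1Dx _); lra.
  have := expRxMexpNx_1 (8%:R^-1 : R) => h2.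
  by have := expR_gt0 (8%:R^-1 : R); nra.
have -> : 1 = 8%:R^-1 * 8%:R :> R by rewrite mulVf.
rewrite expRM_natr; apply: (@le_trans _ _ ((8 / 7) ^+ 8)); last by lra.
by apply: lerXn2r; rewrite ?nnegrE ?expR_ge0//; lra.
Qed.

Lemma exprz_le_expRN (a b : R) (m : nat) : 0 <= a <= expR (- b) ->
  a ^+ m <= expR (- (b * m%:R)).
Proof.
move=> /andP[a0 ab]; rewrite -mulNr expRM_natr.
by apply: lerXn2r; rewrite ?nnegrE ?expR_ge0.
Qed.

Lemma expRN_le_inv (x y : R) : 0 < y -> ln y <= x -> expR (- x) <= y^-1.
Proof.
by move=> y0 yx; rewrite expRN lef_pV2 ?posrE ?expR_gt0// -ler_ln ?posrE ?expR_gt0// expRK.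
Qed.

Lemma abs_ceil_ge (x : R) : 0 <= x -> x <= `|Num.ceil x|%N%:R.
Proof.
move=> x0; rewrite natr_absz ger0_norm ?ceil_ge//.
by rewrite ceil_ge0; apply: lt_le_trans x0; rewrite ltrN10.
Qed.

Lemma abs_ceil_le (x : R) : 0 <= x -> `|Num.ceil x|%N%:R <= x + 1.
Proof.
move=> x0; rewrite natr_absz ger0_norm; last first.
  by rewrite ceil_ge0; apply: lt_le_trans x0; rewrite ltrN10.
have /andP[] := ceil_itv x; rewrite intrD => h _.
by rewrite -lerBlDr; apply: ltW; move: h; rewrite intrN.
Qed.

Lemma sum_sqrD_le (I : finType) (P : pred I) (a b : I -> R) :
  \sum_(i | P i) (a i + b i) ^+ 2 <=
  2 * (\sum_(i | P i) a i ^+ 2) + 2 * (\sum_(i | P i) b i ^+ 2).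
Proof.
rewrite !mulr_sumr -big_split/=; apply: ler_sum => i _.
by have := sqr_ge0 (a i - b i); rewrite sqrrB sqrrD; lra.
Qed.

Lemma sum_pred_le (I : finType) (P : pred I) (a : I -> R) :
  (forall i, 0 <= a i) -> \sum_(i | P i) a i <= \sum_i a i.
Proof. by move=> a0; rewrite [leRHS](bigID P)/= lerDl sumr_ge0. Qed.

End Numerics.

(** * Coordinates in an orthonormal eigenbasis *)

Section Spectral.
Context {R : realType} {d : nat} (O : 'M[R]_d) (l : 'rV[R]_d) (M : 'M[R]_d).

Definition ecoord (x : 'cV[R]_d) (i : 'I_d) : R := (O^T *m x) i 0.

Definition eigenbasis : Prop := O^T *m O = 1%:M /\ M = O *m diag_mx l *m O^T.

Hypothesis HO : eigenbasis.

Lemma dotv_ecoord x y : dotv x y = \sum_i ecoord x i * ecoord y i.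
Proof.
rewrite -dotvE dotv_orth// trmxK; apply: orthC; exact: HO.1.
Qed.

Lemma sum_ecoord_sqr x : \sum_i ecoord x i ^+ 2 = dotv x x.
Proof. by rewrite dotv_ecoord; apply: eq_bigr => i _; rewrite expr2. Qed.

Lemma ecoordZ a x i : ecoord (a *: x) i = a * ecoord x i.
Proof. by rewrite /ecoord -scalemxAr mxE. Qed.

Lemma ecoordD x y i : ecoord (x + y) i = ecoord x i + ecoord y i.
Proof. by rewrite /ecoord mulmxDr mxE. Qed.

Lemma ecoordB x y i : ecoord (x - y) i = ecoord x i - ecoord y i.
Proof. by rewrite -scaleN1r ecoordD ecoordZ mulN1r. Qed.

Lemma ecoord_mul (f : 'rV[R]_d) x i :
  ecoord (O *m diag_mx f *m O^T *m x) i = f 0 i * ecoord x i.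
Proof.
rewrite /ecoord -!mulmxA mulmxA HO.1 mul1mx mul_diag_mx !mxE.
by [].
Qed.

Lemma ecoordM x i : ecoord (M *m x) i = l 0 i * ecoord x i.
Proof. by rewrite {1}HO.2 ecoord_mul. Qed.

Lemma eigen_sym : M^T = M.
Proof. by rewrite HO.2 !trmx_mul trmxK tr_diag_mx mulmxA. Qed.

Lemma ecoord_col j i : ecoord (col j O) i = (i == j)%:R.
Proof.
by rewrite /ecoord colE mulmxA HO.1 mul1mx !mxE eqxx andbT.
Qed.

Lemma ecoord_inj x y : ecoord x =1 ecoord y -> x = y.
Proof.
move=> xy; rewrite -(mul1mx x) -(mul1mx y) -(orthC HO.1) -!mulmxA; congr (_ *m _).
by apply/colP => i; exact: xy.
Qed.

Lemma shift_eigen lam : lam%:M - M = O *m diag_mx (const_mx lam - l) *m O^T.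
Proof.
rewrite HO.2 linearB/= mulmxBr mulmxBl; congr (_ - _).
by rewrite diag_const_mx -scalemx1 -scalemxAr -scalemxAl mulmx1 (orthC HO.1).
Qed.

Lemma shift_posdef lam : (forall i, l 0 i < lam) -> posdef (lam%:M - M).
Proof.
move=> lt; split; first by rewrite linearB/= tr_scalar_mx eigen_sym.
move=> x x0; rewrite quadratic_form shift_eigen dotv_ecoord.
rewrite lt_neqAle sumr_ge0 => [|i _]; last first.
  by rewrite ecoord_mul mulrCA -expr2 mulr_ge0 ?sqr_ge0// !mxE subr_ge0 ltW.
rewrite andbT; apply: contra x0 => /eqP/esym/eqP.
rewrite psumr_eq0 => [/allP h|i _]; last first.
  by rewrite ecoord_mul mulrCA -expr2 mulr_ge0 ?sqr_ge0// !mxE subr_ge0 ltW.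
apply/eqP/ecoord_inj => i; have := h i (mem_index_enum i).
rewrite /= ecoord_mul mulrCA -expr2 mulf_eq0 sqrf_eq0 => /orP[|/eqP->].
  by rewrite !mxE subr_eq0 => /eqP e; have := lt i; rewrite e ltxx.
by rewrite /ecoord mulmx0 mxE.
Qed.

Lemma shift_possemidef lam : (forall i, l 0 i <= lam) -> possemidef (lam%:M - M).
Proof.
move=> lt; split; first by rewrite linearB/= tr_scalar_mx eigen_sym.
move=> x; rewrite quadratic_form shift_eigen dotv_ecoord sumr_ge0// => i _.
by rewrite ecoord_mul mulrCA -expr2 mulr_ge0 ?sqr_ge0// !mxE subr_ge0.
Qed.

Lemma ecoord_shift_inv lam x i : (forall i, l 0 i < lam) ->
  ecoord (invmx (lam%:M - M) *m x) i = ecoord x i / (lam - l 0 i).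
Proof.
move=> lt; pose f : 'rV[R]_d := \row_i (lam - l 0 i)^-1.
have BC : (lam%:M - M) *m (O *m diag_mx f *m O^T) = 1%:M.
  rewrite shift_eigen !mulmxA -(mulmxA _ O^T O) HO.1 mulmx1 -(mulmxA O).
  have -> : diag_mx (const_mx lam - l) *m diag_mx f = 1%:M.
    apply/matrixP => a b; rewrite mul_diag_mx !mxE.
    have [->|_] := eqVneq a b; last by rewrite !mulr0n mulr0.
    by rewrite !mulr1n divff// subr_eq0 gt_eqF.
  by rewrite mulmx1 (orthC HO.1).
have -> : invmx (lam%:M - M) = O *m diag_mx f *m O^T.
  by have [U _] := mulmx1_unit BC; rewrite -[RHS](mulKmx U) BC mulmx1.
by rewrite ecoord_mul mxE mulrC.
Qed.

End Spectral.

(** * AppxPCA *)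

Section InversePower.
Context {R : realType} {d : nat}.
Context (A : inversion_method R d) (s : nat) (M : 'M[R]_d) (w0 : 'cV[R]_d).
Context (O : 'M[R]_d) (l : 'rV[R]_d) (l1 : R).
Hypothesis A_correct : inversion_correct A.
Hypothesis HO : eigenbasis O l M.
Hypothesis l_le : forall i, l 0 i <= l1.

Let l_lt lam : l1 < lam -> forall i, l 0 i < lam.
Proof. by move=> h i; apply: le_lt_trans (l_le i) h. Qed.

(* Rescaled by (lam - l1)^t, the exact inverse iteration contracts every
   eigencomponent, so that the errors of the approximate one only add up. *)
Lemma inverse_power_error r lam eta t : 0 < eta -> l1 < lam -> lam - l1 <= 3 / 2 ->
  enorm (\col_i ((lam - l1) ^+ t * ecoord O (inverse_power A s r lam M eta w0 t) i
         - ((lam - l1) / (lam - l 0 i)) ^+ t * ecoord O w0 i)) <=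
  eta * (t%:R * (3 / 2) ^+ t).
Proof.
move=> eta0 lt1 le32; set g := lam - l1.
have g0 : 0 < g by rewrite subr_gt0.
have gl i : 0 < lam - l 0 i by rewrite subr_gt0 l_lt.
have gll i : g <= lam - l 0 i by rewrite /g lerB.
elim: t => [|t IH].
  rewrite (_ : \col_i _ = 0) ?enormE ?dotv0r ?sqrtr0 ?mul0r ?mulr0//.
  by apply/colP => i; rewrite !mxE !expr0 !mul1r subrr.
set x := inverse_power A s r lam M eta w0 t in IH *.
rewrite /= -/x; set y := A _ _ _ _ _.
have /= := A_correct (s, r, t.+1) x eta0 (shift_posdef HO (l_lt lt1)).
rewrite -/y; set e := y - _ => e_le.
(* The new error is that of the present call, scaled by [g^(t+1) <= (3/2)^(t+1)], plus the previous
   error, contracted by [g / (lam - l_i) <= 1]. *)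
rewrite (_ : \col_i _ = g ^+ t.+1 *: (O^T *m e) +
   \col_i (g / (lam - l 0 i) * (g ^+ t * ecoord O x i - (g / (lam - l 0 i)) ^+ t * ecoord O w0 i)));
  last first.
  apply/colP => i; rewrite mxE [RHS]mxE [X in _ = X + _]mxE [X in _ = _ + X]mxE.
  rewrite -[(O^T *m e) i 0]/(ecoord O e i) ecoordB (ecoord_shift_inv HO _ _ (l_lt lt1)) !exprS.
  by ring.
apply: le_trans (enormD _ _) _.
rewrite enormZ normrX (ger0_norm (ltW g0)) enorm_orth; last first.
  by rewrite trmxK (orthC HO.1).
have h2 : enorm (\col_i (g / (lam - l 0 i) *
    (g ^+ t * ecoord O x i - (g / (lam - l 0 i)) ^+ t * ecoord O w0 i))) <=
    eta * (t%:R * (3 / 2) ^+ t).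
  apply: le_trans IH; rewrite !enormE ler_sqrt ?dotvv_ge0// !dotvv_sum.
  apply: ler_sum => i _; rewrite !mxE exprMn ler_piMl ?sqr_ge0//.
  by apply: exprn_ile1; [rewrite divr_ge0 ?ltW|rewrite ler_pdivrMr ?mul1r].
have h1 : g ^+ t.+1 * enorm e <= (3 / 2) ^+ t.+1 * eta.
  apply: ler_pM => //; rewrite ?enorm_ge0// ?exprn_ge0 ?(ltW g0)//.
  by apply: lerXn2r; rewrite ?nnegrE ?(ltW g0)//; lra.
apply: le_trans (lerD h1 h2) _.
have : 0 <= eta * (t%:R * (3 / 2) ^+ t).
  by rewrite !mulr_ge0 ?exprn_ge0 ?(ltW eta0)//; lra.
by rewrite exprS -natr1; lra.
Qed.

(** The rescaled exact iterate [y] has factor 1 on the top eigenspace, so its squared norm is at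
    least [theta], while on [P] it is at most [kappa^(2t)]. The inequality
    [(a + b)^2 <= 2 a^2 + 2 b^2] carries both bounds over to the computed iterate [h], and the
    normalization cancels the scale [(lam - l1)^t]. *)
Lemma inverse_power_mass r lam eta t (P : pred 'I_d) (theta kappa : R) :
  0 < eta -> l1 < lam -> lam - l1 <= 3 / 2 -> enorm w0 = 1 ->
  theta <= \sum_(i | l 0 i == l1) ecoord O w0 i ^+ 2 ->
  (forall i, P i -> (lam - l1) / (lam - l 0 i) <= kappa) ->
  let E2 := (eta * (t%:R * (3 / 2) ^+ t)) ^+ 2 in
  0 < theta / 2 - E2 ->
  let x := inverse_power A s r lam M eta w0 t in
  enorm (normalize x) = 1 /\
  (\sum_(i | P i) ecoord O (normalize x) i ^+ 2) * (theta / 2 - E2) <=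
    2 * (kappa ^+ 2) ^+ t + 2 * E2.
Proof.
move=> eta0 lt1 le32 w1 th Pk E2 E2lt x.
set g := lam - l1 in Pk.
have g0 : 0 < g by rewrite subr_gt0.
have gl i : 0 < lam - l 0 i by rewrite subr_gt0 l_lt.
pose y i := (g / (lam - l 0 i)) ^+ t * ecoord O w0 i.
pose h i := g ^+ t * ecoord O x i.
have err : \sum_i (h i - y i) ^+ 2 <= E2.
  have := inverse_power_error r t eta0 lt1 le32.
  rewrite enorm_le; last by rewrite !mulr_ge0 ?exprn_ge0 ?(ltW eta0)//; lra.
  rewrite dotvv_sum; apply: le_trans; apply: ler_sum => i _.
  by rewrite !mxE.
have err' : \sum_i (y i - h i) ^+ 2 <= E2.
  by apply: le_trans err; apply: ler_sum => i _; rewrite -sqrrN opprB.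
have top : theta <= \sum_i y i ^+ 2.
  apply: le_trans th _; apply: le_trans (sum_pred_le _ _); last first.
    by move=> i; rewrite sqr_ge0.
  by apply: ler_sum => i /eqP li; rewrite /y li divff ?gt_eqF// expr1n mul1r.
have hge : theta / 2 - E2 <= \sum_i h i ^+ 2.
  have := sum_sqrD_le (fun=> true) h (fun i => y i - h i).
  under eq_bigr do rewrite addrC subrK.
  by move: top err'; lra.
have hP : \sum_(i | P i) h i ^+ 2 <= 2 * (kappa ^+ 2) ^+ t + 2 * E2.
  have := sum_sqrD_le P y (fun i => h i - y i).
  under eq_bigr do rewrite addrC subrK.
  have : \sum_(i | P i) (h i - y i) ^+ 2 <= E2.
    by apply: le_trans (sum_pred_le _ _) err => i; rewrite sqr_ge0.
  have : \sum_(i | P i) y i ^+ 2 <= (kappa ^+ 2) ^+ t.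
    apply: (@le_trans _ _ (\sum_(i | P i) (kappa ^+ 2) ^+ t * ecoord O w0 i ^+ 2)).
      apply: ler_sum => i Pi; rewrite /y exprMn ler_wpM2r ?sqr_ge0// [leLHS]exprAC.
      have k0 : 0 <= g / (lam - l 0 i) by rewrite divr_ge0 ?ltW.
      apply: lerXn2r; rewrite ?nnegrE ?sqr_ge0// ler_sqr ?nnegrE//.
        exact: Pk.
      by rewrite (le_trans k0)// Pk.
    rewrite -mulr_sumr ler_piMr//; first by rewrite exprn_ge0 ?sqr_ge0.
    apply: le_trans (sum_pred_le _ _) _ => [i|]; first by rewrite sqr_ge0.
    by rewrite (sum_ecoord_sqr HO) (enorm_eq1 w1).
  by lra.
have hx : \sum_i h i ^+ 2 = (g ^+ t) ^+ 2 * dotv x x.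
  by rewrite -(sum_ecoord_sqr HO) mulr_sumr; apply: eq_bigr => i _; rewrite exprMn.
have gt2 : 0 < (g ^+ t) ^+ 2 by rewrite !exprn_gt0.
have xx : 0 < dotv x x by rewrite -(pmulr_rgt0 _ gt2) -hx (lt_le_trans E2lt).
have x0 : x != 0 by rewrite -dotvv_eq0 gt_eqF.
rewrite enorm_normalize//; split => //.
apply: le_trans hP.
have -> : \sum_(i | P i) h i ^+ 2 =
    (\sum_(i | P i) ecoord O (normalize x) i ^+ 2) * \sum_i h i ^+ 2.
  rewrite hx mulr_suml; apply: eq_bigr => i _.
  rewrite /normalize ecoordZ /h !exprMn -enorm_sqr.
  by field; rewrite enorm_eq0.
rewrite ler_wpM2l//; apply: sumr_ge0 => i _; exact: sqr_ge0.
Qed.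

End InversePower.

(** The repeat loop cut off after [fuel.+1] passes. Unlike the relation [pca_loop] it has a value
    for every input, so measurability can be stated without knowing that the loop terminates. *)
Fixpoint pca_loop_fuel (R : realType) (d : nat) (A : inversion_method R d)
    (s : nat) (M : 'M[R]_d) (delta p : R) (w0 : 'cV[R]_d) (fuel r : nat)
    (lam : R) : R :=
  let lam' := pass_lambda A s M delta p w0 r lam in
  if fuel is fuel'.+1 then
    if pass_Delta A s M delta p w0 r lam <= delta * lam' / 3 then lam'
    else pca_loop_fuel A s M delta p w0 fuel' r.+1 lam'
  else lam'.

Definition appxpca_fuel (R : realType) (d : nat) (A : inversion_method R d)
    (s : nat) (M : 'M[R]_d) (delta eps p : R) (fuel : nat) (w0 : 'cV[R]_d) :
    'cV[R]_d :=
  normalize (inverse_power A s 0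
    (pca_loop_fuel A s M delta p w0 fuel 1 (1 + delta)) M
    (pca_tol2 d delta eps p) w0 (pca_m2 d eps p)).

Fixpoint all_calls (R : realType) (d : nat) (P : call R d -> Prop)
    (tr : seq (call R d)) : Prop :=
  if tr is c :: tr' then P c /\ all_calls P tr' else True.

Lemma all_calls_cat (R : realType) (d : nat) (P : call R d -> Prop) tr1 tr2 :
  all_calls P tr1 -> all_calls P tr2 -> all_calls P (tr1 ++ tr2).
Proof. by elim: tr1 => //= c tr1 IH [? ?] ?; split => //; apply: IH. Qed.

Lemma all_calls_map (R : realType) (d : nat) (P : call R d -> Prop)
    (f : nat -> call R d) ns : (forall i, P (f i)) -> all_calls P (map f ns).
Proof. by move=> h; elim: ns => //= i ns IH; split. Qed.

(** * Step counts and tolerances of AppxPCA *)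

Section Tolerances.
Context {R : realType} (d : nat) (delta eps p : R).
Hypothesis d_gt0 : (0 < d)%N.
Hypothesis delta_bnd : 0 < delta <= 1 / 2.
Hypothesis eps_bnd : 0 < eps < 1.
Hypothesis p_bnd : 0 < p < 1.

(** Along a fixed direction, a uniform unit vector has squared component below this value with
    probability at most [p]. The constants of the algorithm refer to it: [288 = 32 * 9] and
    [36 = 4 * 9]. *)
Definition start_mass : R := p ^+ 2 / (9 * d%:R).

Let d_ge1 : 1 <= d%:R :> R. Proof. by rewrite ler1n. Qed.

Let p2_bnd : 0 < p ^+ 2 < 1.
Proof. by case/andP: p_bnd => p0 p1; rewrite exprn_gt0//= exprn_ilt1// ltW. Qed.

Lemma start_mass_bnd : 0 < start_mass <= 1.
Proof.
have /andP[h0 h1] := p2_bnd.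
rewrite /start_mass divr_gt0//=; last by move: d_ge1; lra.
by rewrite ler_pdivrMr ?mul1r; move: d_ge1; lra.
Qed.

Let arg1_gt : 2 < 288 * d%:R / p ^+ 2.
Proof.
by have /andP[h0 h1] := p2_bnd; rewrite ltr_pdivlMr//; move: d_ge1; nra.
Qed.

Let arg2_gt : 2 < 36 * d%:R / (p ^+ 2 * eps).
Proof.
have /andP[h0 h1] := p2_bnd; have /andP[e0 e1] := eps_bnd.
have h2 : 0 < p ^+ 2 * eps by rewrite mulr_gt0.
have h3 : p ^+ 2 * eps < 1 by nra.
by rewrite ltr_pdivlMr//; move: d_ge1; lra.
Qed.

Lemma pca_m1_bnd : [/\ (0 < pca_m1 d p)%N,
  4 * ln (288 * d%:R / p ^+ 2) <= (pca_m1 d p)%:R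
  & (pca_m1 d p)%:R <= 4 * ln (288 * d%:R / p ^+ 2) + 1].
Proof.
have h : 0 < 4 * ln (288 * d%:R / p ^+ 2) :> R.
  by rewrite mulr_gt0// ln_gt0//; apply: lt_trans arg1_gt; lra.
have h2 := abs_ceil_ge (ltW h).
split => //; last exact: abs_ceil_le (ltW h).
by rewrite -(ltr_nat R); apply: lt_le_trans h h2.
Qed.

Lemma pca_m2_bnd : [/\ (0 < pca_m2 d eps p)%N,
  ln (36 * d%:R / (p ^+ 2 * eps)) <= (pca_m2 d eps p)%:R
  & (pca_m2 d eps p)%:R <= ln (36 * d%:R / (p ^+ 2 * eps)) + 1].
Proof.
have h : 0 < ln (36 * d%:R / (p ^+ 2 * eps)) :> R.
  by rewrite ln_gt0//; apply: lt_trans arg2_gt; lra.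
have h2 := abs_ceil_ge (ltW h).
split => //; last exact: abs_ceil_le (ltW h).
by rewrite -(ltr_nat R); apply: lt_le_trans h h2.
Qed.

Lemma pca_tol1_gt0 : 0 < pca_tol1 d delta p.
Proof.
have [m0 _ _] := pca_m1_bnd; have /andP[h0 h1] := delta_bnd.
rewrite /pca_tol1 mulr_gt0 ?invr_gt0 ?exprn_gt0// ?divr_gt0//.
by rewrite mulr_gt0// ltr0n.
Qed.

Lemma pca_tol2_gt0 : 0 < pca_tol2 d delta eps p.
Proof.
have [m0 _ _] := pca_m2_bnd; have /andP[h0 h1] := delta_bnd.
have /andP[e0 e1] := eps_bnd.
rewrite /pca_tol2 mulr_gt0 ?exprn_gt0// ?divr_gt0//.
by rewrite mulr_gt0// ltr0n.
Qed.

Lemma pca_tol1_le : pca_tol1 d delta p <= 1 / 64.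
Proof.
have [m0 _ _] := pca_m1_bnd; have /andP[h0 h1] := delta_bnd.
rewrite /pca_tol1; move: (pca_m1 d p) m0 => m m0.
have x1 : (delta / 6) ^+ m <= 1 by apply: exprn_ile1; lra.
have m1 : 1 <= m%:R :> R by rewrite ler1n.
have y1 : (64 * m%:R)^-1 <= 64^-1 :> R by rewrite lef_pV2 ?posrE; lra.
have y0 : 0 <= (64 * m%:R)^-1 :> R by rewrite invr_ge0; lra.
by have := ler_wpM2l y0 x1; lra.
Qed.

(** [3/4 <= e^(-1/4)], and the factor 4 in [pca_m1] turns [e^(-m1/4)] into at most
    [p^2 / (288 d)]. *)
Let pow_m1_le (a : R) : 0 <= a <= 3 / 4 -> a ^+ pca_m1 d p <= start_mass / 32.
Proof.
move=> /andP[a0 a1]; have [m0 m1 _] := pca_m1_bnd.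
apply: (@le_trans _ _ (expR (- (1 / 4 * (pca_m1 d p)%:R)))).
  apply: exprz_le_expRN; rewrite a0/=; apply: le_trans (expR_ge1Dx _); lra.
apply: (@le_trans _ _ ((288 * d%:R / p ^+ 2)^-1)).
  apply: expRN_le_inv; first by apply: lt_trans arg1_gt; lra.
  by move: (pca_m1 d p) m1 => m; lra.
rewrite /start_mass le_eqVlt; apply/orP; left; apply/eqP; field.
by rewrite pnatr_eq0 -lt0n d_gt0 (gt_eqF (andP p_bnd).1).
Qed.

Lemma pow_m1 : (9 / 16) ^+ pca_m1 d p <= start_mass / 32.
Proof. by apply: pow_m1_le; lra. Qed.

(** The powers of [delta / 6] in the tolerance absorb the growth [(3/2)^m1] of the error and leave
    [(delta / 4)^m1 / 64], where [delta / 4] is well below 3/4. *)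
Lemma pca_error1 : (pca_tol1 d delta p *
    ((pca_m1 d p)%:R * (3 / 2) ^+ pca_m1 d p)) ^+ 2 <= start_mass / 2048.
Proof.
have [m0 _ _] := pca_m1_bnd; have /andP[h0 h1] := delta_bnd.
have /andP[t0 t1] := start_mass_bnd.
have x1 : (delta / 4) ^+ pca_m1 d p <= start_mass / 32 by apply: pow_m1_le; lra.
have -> : pca_tol1 d delta p * ((pca_m1 d p)%:R * (3 / 2) ^+ pca_m1 d p) =
    (delta / 4) ^+ pca_m1 d p / 64.
  rewrite /pca_tol1 (_ : delta / 4 = (delta / 6) * (3 / 2)); last by field.
  move: (pca_m1 d p) m0 => m m0.
  by rewrite [in RHS]exprMn; field; rewrite pnatr_eq0 -lt0n m0.
move: (pca_m1 d p) x1 => m x1.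
have x0 : 0 <= (delta / 4) ^+ m by apply: exprn_ge0; lra.
by rewrite expr2; nra.
Qed.

Let pow_m2_le (a : R) : 0 <= a <= 1 / 3 ->
  a ^+ pca_m2 d eps p <= start_mass * eps / 4.
Proof.
move=> /andP[a0 a1]; have [m0 m2 _] := pca_m2_bnd.
have /andP[e0 e1] := eps_bnd.
apply: (@le_trans _ _ (expR (- (1 * (pca_m2 d eps p)%:R)))).
  apply: exprz_le_expRN; rewrite a0/=; apply: le_trans a1 _.
  by rewrite expRN div1r lef_pV2 ?posrE ?expR_gt0// expR1_le.
apply: (@le_trans _ _ ((36 * d%:R / (p ^+ 2 * eps))^-1)).
  apply: expRN_le_inv; first by apply: lt_trans arg2_gt; lra.
  by rewrite mul1r.
rewrite /start_mass le_eqVlt; apply/orP; left; apply/eqP; field.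
by rewrite pnatr_eq0 -lt0n d_gt0 !gt_eqF// (andP p_bnd).1.
Qed.

(** [4/25 = (2/5)^2] is the contraction of squared components in the final phase. Writing it as
    [1/2 * 8/25] with [8/25 <= 1/3] gains the factor 1/2, as there is at least one step. *)
Lemma pow_m2 : (4 / 25) ^+ pca_m2 d eps p <= start_mass * eps / 8.
Proof.
have [m0 _ _] := pca_m2_bnd.
have h : (8 / 25) ^+ pca_m2 d eps p <= start_mass * eps / 4.
  by apply: pow_m2_le; lra.
have -> : 4 / 25 = 1 / 2 * (8 / 25) :> R by field.
rewrite exprMn.
move: (pca_m2 d eps p) m0 h => m m0 h.
have : (1 / 2) ^+ m <= 1 / 2 :> R.
  by rewrite -[leRHS]expr1; apply: ler_wiXn2l => //; lra.
have : 0 <= (8 / 25 : R) ^+ m by apply: exprn_ge0; lra.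
by nra.
Qed.

(** The quantity squared is at most 1/8 and at most [start_mass * eps / 32]; its square is bounded
    by the product of the two. *)
Lemma pca_error2 : (pca_tol2 d delta eps p *
    ((pca_m2 d eps p)%:R * (3 / 2) ^+ pca_m2 d eps p)) ^+ 2 <=
    start_mass * eps / 256.
Proof.
have [m0 _ _] := pca_m2_bnd; have /andP[h0 h1] := delta_bnd.
have /andP[t0 t1] := start_mass_bnd; have /andP[e0 e1] := eps_bnd.
have x1 : (delta / 4) ^+ pca_m2 d eps p <= start_mass * eps / 4 by apply: pow_m2_le; lra.
have -> : pca_tol2 d delta eps p *
    ((pca_m2 d eps p)%:R * (3 / 2) ^+ pca_m2 d eps p) =
    eps / 8 * (delta / 4) ^+ pca_m2 d eps p.
  rewrite /pca_tol2 (_ : delta / 4 = (delta / 6) * (3 / 2)); last by field.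
  move: (pca_m2 d eps p) m0 => m m0.
  by rewrite [in RHS]exprMn; field; rewrite pnatr_eq0 -lt0n m0.
move: (pca_m2 d eps p) x1 => m x1.
have x0 : 0 <= (delta / 4) ^+ m by apply: exprn_ge0; lra.
have x2 : (delta / 4) ^+ m <= 1 by apply: exprn_ile1; lra.
have : eps / 8 * (delta / 4) ^+ m <= 1 / 8 by nra.
have : 0 <= eps / 8 * (delta / 4) ^+ m by nra.
have : eps / 8 * (delta / 4) ^+ m <= start_mass * eps / 32 by nra.
by rewrite expr2; nra.
Qed.

End Tolerances.

(** Solves the conclusion of [inverse_power_mass] for the mass: once the error and the contraction
    are measured in units of [theta], this factor cancels and [c] is [(2a + 2b) / (1/2 - b)]. *)
Lemma mass_fraction_le (R : realType) (th x E2 a pw b c : R) : 0 < th ->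
  0 <= x -> E2 <= th * b -> pw <= th * a -> c * (1 / 2 - b) = 2 * a + 2 * b ->
  b < 1 / 2 -> x * (th / 2 - E2) <= 2 * pw + 2 * E2 -> x <= c.
Proof.
move=> th0 x0 Eb pa cE b2 h.
have h1 : x * (th / 2 - th * b) <= x * (th / 2 - E2) by apply: ler_wpM2l => //; lra.
have : th * (x * (1 / 2 - b)) <= th * (c * (1 / 2 - b)) by rewrite cE; lra.
by rewrite ler_pM2l// ler_pM2r//; lra.
Qed.

Lemma mass_pos (R : realType) (th E2 b : R) : 0 < th -> b < 1 / 2 ->
  E2 <= th * b -> 0 < th / 2 - E2.
Proof. by move=> ? ? ?; nra. Qed.

(** * Convergence of AppxPCA from a good start *)

Section AppxPCAAnalysis.
Context {R : realType} {d : nat}.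
Context (A : inversion_method R d) (s : nat) (M : 'M[R]_d) (w0 : 'cV[R]_d).
Context (O : 'M[R]_d) (l : 'rV[R]_d) (l1 : R) (delta eps p : R).
Hypothesis A_correct : inversion_correct A.
Hypothesis HO : eigenbasis O l M.
Hypothesis l_ge0 : forall i, 0 <= l 0 i.
Hypothesis l_le : forall i, l 0 i <= l1.
Hypothesis l1_bnd : 0 < l1 <= 1.
Hypothesis d_gt0 : (0 < d)%N.
Hypothesis delta_bnd : 0 < delta <= 1 / 2.
Hypothesis eps_bnd : 0 < eps < 1.
Hypothesis p_bnd : 0 < p < 1.
Hypothesis w1 : enorm w0 = 1.
Hypothesis start : start_mass d p <= \sum_(i | l 0 i == l1) ecoord O w0 i ^+ 2.

Let l_lt lam : l1 < lam -> forall i, l 0 i < lam.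
Proof. by move=> h i; apply: le_lt_trans (l_le i) h. Qed.

(** The instance [a = 1/32], [b = 1/2048] of the fraction above is about 0.127, hence below 1/4. *)
Lemma pass_vector_mass r lam : l1 < lam -> lam - l1 <= 3 / 2 ->
  let w := pass_vector A s M delta p w0 r lam in enorm w = 1 /\
  \sum_(i | (lam - l1) / (lam - l 0 i) <= 3 / 4) ecoord O w i ^+ 2 <= 1 / 4.
Proof.
move=> lt1 le32.
have /andP[t0 _] := start_mass_bnd d_gt0 p_bnd.
have b1 : 2048^-1 < 1 / 2 :> R by lra.
have b2 : (2 * 32^-1 + 2 * 2048^-1) / (1 / 2 - 2048^-1) * (1 / 2 - 2048^-1) =
  2 * 32^-1 + 2 * 2048^-1 :> R by field; lra.
have b3 : (2 * 32^-1 + 2 * 2048^-1) / (1 / 2 - 2048^-1) <= 1 / 4 :> R by lra.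
have err := pca_error1 d_gt0 delta_bnd p_bnd.
have tol0 := pca_tol1_gt0 d_gt0 delta_bnd p_bnd.
have [||wn low] := @inverse_power_mass _ _ A s M w0 O l l1 A_correct HO l_le r lam
  _ (pca_m1 d p) (fun i => (lam - l1) / (lam - l 0 i) <= 3 / 4) (start_mass d p)
  (3 / 4) tol0 lt1 le32 w1 start; first by [].
  exact: mass_pos b1 err.
split => //; apply: le_trans b3; apply: mass_fraction_le b2 b1 low => //.
  by apply: sumr_ge0 => i _; rewrite sqr_ge0.
rewrite (_ : (3 / 4) ^+ 2 = 9 / 16); last by rewrite expr2; field.
exact: pow_m1.
Qed.

(** With [g = lam - l1], the number [g <w, (lam - M)^-1 w>] is at most 1, and at least
    [3/4 * 3/4 = 9/16] because three quarters of the mass of [w] lie where [g / (lam - l_i) > 3/4].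
    The tolerances cost at most [2 * 3/128], so the denominator [y] of [pass_Delta] satisfies
    [1/2 <= g y <= 1]. *)
Lemma pass_Delta_bnd r lam : l1 < lam -> lam - l1 <= 3 / 2 ->
  (lam - l1) / 2 <= pass_Delta A s M delta p w0 r lam <= lam - l1.
Proof.
move=> lt1 le32; set g := lam - l1.
have g0 : 0 < g by rewrite subr_gt0.
have gl i : 0 < lam - l 0 i by rewrite subr_gt0 l_lt.
have tol0 := pca_tol1_gt0 d_gt0 delta_bnd p_bnd.
have tolle := pca_tol1_le d_gt0 delta_bnd p_bnd.
pose P i := g / (lam - l 0 i) <= 3 / 4.
have [wn lowle] := pass_vector_mass r lt1 le32.
rewrite /pass_Delta.
set w := pass_vector _ _ _ _ _ _ _ _ in wn lowle *; clearbody w.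
set tol := pca_tol1 d delta p in tol0 tolle *.
set v := A _ _ _ _ _; set B := invmx (lam%:M - M).
have vB : `|dotv w v - dotv w (B *m w)| <= tol.
  rewrite -dotvBr; apply: le_trans (ler_dotv _ _) _; rewrite wn mul1r.
  exact: A_correct tol0 (shift_posdef HO (l_lt lt1)).
clearbody tol v.
have ww := enorm_eq1 wn.
have dwB : dotv w (B *m w) = \sum_i ecoord O w i ^+ 2 / (lam - l 0 i).
  rewrite (dotv_ecoord HO); apply: eq_bigr => i _.
  by rewrite (ecoord_shift_inv HO _ _ (l_lt lt1)) mulrA -expr2.
have ub : g * dotv w (B *m w) <= 1.
  rewrite dwB -ww -(sum_ecoord_sqr HO) mulr_sumr; apply: ler_sum => i _.
  rewrite mulrCA ler_piMr ?sqr_ge0// ler_pdivrMr// mul1r lerB//.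
have lb : 9 / 16 <= g * dotv w (B *m w).
  have hi : 3 / 4 <= \sum_(i | ~~ P i) ecoord O w i ^+ 2.
    have := sum_ecoord_sqr HO w; rewrite ww (bigID P)/=.
    by move: lowle; lra.
  apply: (@le_trans _ _ (\sum_(i | ~~ P i) ecoord O w i ^+ 2 * (3 / 4))).
    by rewrite -mulr_suml; lra.
  rewrite dwB mulr_sumr; apply: le_trans (sum_pred_le (fun i => ~~ P i) _) => [|i].
    apply: ler_sum => i; rewrite /P -ltNge => Pi.
    by rewrite [leRHS]mulrCA ler_wpM2l ?sqr_ge0// ltW.
  by rewrite mulr_ge0 ?divr_ge0 ?sqr_ge0// ltW.
rewrite -[(w^T *m v) 0 0]/(dotv w v).
move: vB; rewrite ler_norml => /andP[vl vu].
have gt : g * tol <= 3 / 128.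
  apply: le_trans (_ : (3 / 2) * (1 / 64) <= _); last by lra.
  exact: ler_pM (ltW g0) (ltW tol0) le32 tolle.
(* Subtracting the tolerance makes [y] an underestimate of the exact Rayleigh quotient, so [Delta]
   is never below [g / 2]; the lower bound on [y] pays for the tolerance twice. *)
set y := dotv w v - tol.
have y1 : g * y <= 1.
  by apply: le_trans ub; rewrite ler_pM2l// /y; lra.
have y2 : 1 / 2 <= g * y.
  have : g * (dotv w (B *m w) - 2 * tol) <= g * y by rewrite ler_pM2l// /y; lra.
  by lra.
have y0 : 0 < y by rewrite -(pmulr_rgt0 _ g0); lra.
have De : 2^-1 * y^-1 * y = 2^-1 by field; rewrite gt_eqF.
by apply/andP; split; rewrite -(ler_pM2r y0) De; lra.
Qed.

Lemma pass_lambda_bnd r lam : l1 < lam -> lam - l1 <= 3 / 2 ->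
  (lam - l1) / 2 <= pass_lambda A s M delta p w0 r lam - l1 <= 3 / 4 * (lam - l1).
Proof.
move=> h1 h2; have /andP[] := pass_Delta_bnd r h1 h2.
by rewrite /pass_lambda; lra.
Qed.

Definition admissible_call (c : call R d) : Prop :=
  [/\ call_mx c = M, call_round c = s,
      delta * l1 / 12 <= call_lambda c - l1 <= 3 / 2
    & call_tol c = pca_tol1 d delta p \/ call_tol c = pca_tol2 d delta eps p].

(** Each pass brings [lam - l1] down to between a half and three quarters of its value. If the loop
    goes on, [lam - l1 >= Delta > delta l1 / 3] before the pass, hence more than [delta l1 / 6]
    after it, which is the entry condition again. When the fuel runs out, [lam - l1 <= delta l1 / 3]
    forces the stopping test to succeed. *)
Lemma pca_loopP fuel r lam : delta * l1 / 6 <= lam - l1 <= 3 / 2 ->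
  (3 / 4) ^+ fuel * (lam - l1) <= delta * l1 / 3 ->
  exists tr, let lamf := pca_loop_fuel A s M delta p w0 fuel r lam in
    [/\ pca_loop A s M delta p w0 r lam lamf tr,
        delta * l1 / 12 <= lamf - l1 <= 2 / 3 * (delta * l1),
        all_calls admissible_call tr
      & (size tr <= fuel.+1 * (pca_m1 d p).+1)%N].
Proof.
have /andP[l10 l11] := l1_bnd; have /andP[de0 de1] := delta_bnd.
have dl : 0 < delta * l1 by rewrite mulr_gt0.
elim: fuel r lam => [|fuel IH] r lam /andP[g1 g2] gf.
all: have lt1 : l1 < lam by rewrite -subr_gt0; lra.
all: have /andP[D1 D2] := pass_Delta_bnd r lt1 g2.
all: have /andP[L1 L2] := pass_lambda_bnd r lt1 g2.
all: have pc : all_calls admissible_call (pass_calls A s M delta p w0 r lam).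
1,3: rewrite /pass_calls -cats1; apply: all_calls_cat => /=;
  [apply: all_calls_map => i|split=> //]; split => //=; by [lra|left].
all: have sz : size (pass_calls A s M delta p w0 r lam) = (pca_m1 d p).+1
  by rewrite size_rcons size_map size_iota.
all: have stop : pass_Delta A s M delta p w0 r lam <=
      delta * pass_lambda A s M delta p w0 r lam / 3 ->
    delta * l1 / 12 <= pass_lambda A s M delta p w0 r lam - l1 <=
      2 / 3 * (delta * l1).
(* With [x] the new lambda, [x - l1 <= 3/4 g <= 3/2 Delta <= delta x / 2]; solving for [x] with
   [delta <= 1/2] gives the factor [(1/2) / (3/4) = 2/3]. *)
1,3: by move=> st; apply/andP; split; [lra|];
  move: (pass_lambda _ _ _ _ _ _ _ _) L1 L2 st => x L1 L2 st; nra.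
- exists (pass_calls A s M delta p w0 r lam) => /=.
  have st : pass_Delta A s M delta p w0 r lam <=
      delta * pass_lambda A s M delta p w0 r lam / 3.
    rewrite expr0 mul1r in gf; apply: le_trans D2 (le_trans gf _).
    by rewrite ler_pM2r ?invr_gt0// ler_pM2l//; lra.
  split => //; last by rewrite sz mul1n.
    exact: pca_loop_stop.
  exact: stop.
- rewrite /=; case: ifPn => [st|]; last rewrite -ltNge => nst.
    exists (pass_calls A s M delta p w0 r lam); split => //.
    + exact: pca_loop_stop.
    + exact: stop.
    + by rewrite sz leq_pmull.
  have [] := IH r.+1 (pass_lambda A s M delta p w0 r lam).
  + apply/andP; split; last by lra.
    have : delta * l1 / 3 <= delta * pass_lambda A s M delta p w0 r lam / 3.
      by rewrite ler_pM2r ?invr_gt0// ler_pM2l//; lra.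
    by lra.
  + apply: le_trans gf; rewrite exprSr -mulrA ler_wpM2l// exprn_ge0//; lra.
  move=> tr [lo bn ac szt].
  exists (pass_calls A s M delta p w0 r lam ++ tr); split => //.
  + exact: pca_loop_continue.
  + exact: all_calls_cat.
  + by rewrite size_cat sz mulSn leq_add2l.
Qed.

Lemma appxpcaP fuel : (3 / 4) ^+ fuel * (3 / 2) <= delta * l1 / 3 ->
  exists tr, let w := appxpca_fuel A s M delta eps p fuel w0 in
    [/\ appxpca A s M delta eps p w0 w tr, enorm w = 1,
        \sum_(i | l 0 i <= (1 - delta) * l1) ecoord O w i ^+ 2 <= eps,
        all_calls admissible_call tr
      & (size tr <= fuel.+1 * (pca_m1 d p).+1 + pca_m2 d eps p)%N].
Proof.
have /andP[l10 l11] := l1_bnd; have /andP[de0 de1] := delta_bnd.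
have /andP[e0 e1] := eps_bnd.
have dl : 0 < delta * l1 by rewrite mulr_gt0.
have dl2 : delta * l1 <= 1 / 2 by nra.
move=> hf; have [] := @pca_loopP fuel 1 (1 + delta).
- by apply/andP; split; nra.
- by apply: le_trans hf; rewrite ler_wpM2l ?exprn_ge0//; lra.
move=> tr' /=; set lamf := pca_loop_fuel _ _ _ _ _ _ _ _ _.
move=> [lo /andP[b1 b2] ac sz].
have lt1 : l1 < lamf by rewrite -subr_gt0; lra.
have le32 : lamf - l1 <= 3 / 2 by lra.
exists (tr' ++ inverse_power_calls A s 0 lamf M (pca_tol2 d delta eps p) w0
          (pca_m2 d eps p)).
have tol0 := pca_tol2_gt0 d_gt0 delta_bnd eps_bnd p_bnd.
(* [lamf - l_i] exceeds [lamf - l1 <= 2/3 delta l1] by at least [delta l1], so the ratio is at most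
   [(2/3) / (5/3)]. *)
have Pi i : l 0 i <= (1 - delta) * l1 -> (lamf - l1) / (lamf - l 0 i) <= 2 / 5.
  by move=> Pi; rewrite ler_pdivrMr; [lra|rewrite subr_gt0 l_lt].
have /andP[t0 _] := start_mass_bnd d_gt0 p_bnd.
have c1 : eps / 256 < 1 / 2 by lra.
have c2 : (2 * (eps / 8) + 2 * (eps / 256)) / (1 / 2 - eps / 256) *
    (1 / 2 - eps / 256) = 2 * (eps / 8) + 2 * (eps / 256) by field; lra.
have c3 : (2 * (eps / 8) + 2 * (eps / 256)) / (1 / 2 - eps / 256) <= eps.
  by rewrite ler_pdivrMr; nra.
have err := pca_error2 d_gt0 delta_bnd eps_bnd p_bnd; rewrite -mulrA in err.
have [|wn low] := @inverse_power_mass _ _ A s M w0 O l l1 A_correct HO l_le 0 lamf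
  _ (pca_m2 d eps p) (fun i => l 0 i <= (1 - delta) * l1) (start_mass d p)
  (2 / 5) tol0 lt1 le32 w1 start Pi.
  exact: mass_pos c1 err.
split => //.
- by exists lamf, tr'.
- apply: le_trans c3; apply: mass_fraction_le c2 c1 low => //.
    by apply: sumr_ge0 => i _; rewrite sqr_ge0.
  rewrite (_ : (2 / 5) ^+ 2 = 4 / 25); last by rewrite expr2; field.
  by rewrite mulrA; exact: pow_m2.
- apply: all_calls_cat => //; apply: all_calls_map => i; split => //=; last by right.
  by apply/andP.
- by rewrite size_cat size_map size_iota leq_add2r.
Qed.

End AppxPCAAnalysis.

(** * LazySVD *)

Section Deflation.
Context {R : realType} {d : nat}.
Implicit Types (N O : 'M[R]_d) (v x : 'cV[R]_d).

Definition deflate N v : 'M[R]_d :=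
  (1%:M - v *m v^T) *m N *m (1%:M - v *m v^T).

Definition bounded_by (L : R) N := forall x, enorm (N *m x) <= L * enorm x.

Lemma proj_mul v x : (1%:M - v *m v^T) *m x = x - dotv v x *: v.
Proof. by rewrite mulmxBl mul1mx outer_mulmx. Qed.

Lemma enorm_proj v x : dotv v v = 1 -> enorm ((1%:M - v *m v^T) *m x) <= enorm x.
Proof.
move=> vv; rewrite proj_mul enorm_le ?enorm_ge0// enorm_sqr.
rewrite !(dotvBl, dotvBr, dotvZl, dotvZr) vv (dotvC x v).
by have := sqr_ge0 (dotv v x); lra.
Qed.

Lemma proj_sym v : (1%:M - v *m v^T)^T = 1%:M - v *m v^T.
Proof. by rewrite linearB/= trmx1 trmx_mul trmxK. Qed.

Lemma deflate_sym N v : N^T = N -> (deflate N v)^T = deflate N v.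
Proof. by move=> NT; rewrite /deflate !trmx_mul proj_sym NT mulmxA. Qed.

Lemma deflate_possemidef N v : possemidef N -> possemidef (deflate N v).
Proof.
move=> [NT N0]; split; first exact: deflate_sym.
move=> x; rewrite quadratic_form /deflate -!mulmxA dotv_mulmxr proj_sym.
by rewrite -quadratic_form.
Qed.

Lemma deflate_bounded L N v : 0 <= L -> dotv v v = 1 -> bounded_by L N ->
  bounded_by L (deflate N v).
Proof.
move=> L0 vv NL x; rewrite /deflate -!mulmxA.
apply: le_trans (enorm_proj _ vv) _; apply: le_trans (NL _) _.
by rewrite ler_wpM2l// enorm_proj.
Qed.

Lemma deflate_kernel N v : dotv v v = 1 -> deflate N v *m v = 0.
Proof.
by move=> vv; rewrite /deflate -!mulmxA (proj_mul v v) vv scale1r subrr !mulmx0.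
Qed.

Lemma cauchy_schwarz_sum (P : pred 'I_d) (a b : 'I_d -> R) :
  (\sum_(i | P i) a i * b i) ^+ 2 <=
  (\sum_(i | P i) a i ^+ 2) * (\sum_(i | P i) b i ^+ 2).
Proof.
pose c (f : 'I_d -> R) : 'cV[R]_d := \col_i (if P i then f i else 0).
have cE f g : dotv (c f) (c g) = \sum_(i | P i) f i * g i.
  rewrite dotvE [RHS]big_mkcond; apply: eq_bigr => i _; rewrite !mxE.
  by case: ifP => // _; rewrite mul0r.
have := cauchy_schwarz (c a) (c b); rewrite !cE.
have sq f : \sum_(i | P i) f i * f i = \sum_(i | P i) f i ^+ 2.
  by apply: eq_bigr => i _; rewrite expr2.
by rewrite !sq.
Qed.

Lemma eigenvector_col O l N i : eigenbasis O l N -> N *m col i O = l 0 i *: col i O.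
Proof.
move=> HO; apply: (ecoord_inj HO) => j.
rewrite (ecoordM HO) ecoordZ (ecoord_col HO).
by have [->|_] := eqVneq j i; rewrite ?mulr0.
Qed.

Lemma ecoord_dotv O x i : ecoord O x i = dotv (col i O) x.
Proof.
rewrite /ecoord /dotv !mxE; apply: eq_bigr => j _; by rewrite !mxE.
Qed.

Lemma eigenvalue_ge0 O l N i : eigenbasis O l N -> possemidef N -> 0 <= l 0 i.
Proof.
move=> HO [_ N0]; have := N0 (col i O).
rewrite quadratic_form (eigenvector_col _ HO) dotvZr -ecoord_dotv (ecoord_col HO).
by rewrite eqxx mulr1.
Qed.

Lemma eigenvalue_le O l N i L : eigenbasis O l N -> bounded_by L N -> l 0 i <= L.
Proof.
move=> HO NL; have := NL (col i O); rewrite (eigenvector_col _ HO) enormZ.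
have -> : enorm (col i O) = 1.
  by rewrite enormE -ecoord_dotv (ecoord_col HO) eqxx sqrtr1.
by rewrite !mulr1; apply: le_trans; exact: ler_norm.
Qed.

Definition low_vector O (l : 'rV[R]_d) (t : R) x := forall i, t < l 0 i -> ecoord O x i = 0.

(* The eigenvectors of N up to t almost stay below t' after the deflation of
   N by v: between eigenvectors z of N and y of the deflated matrix, for the
   eigenvalues a <= t < t' < b, (b - a) <z, y> = - <z, v> <v, N y>, which has
   rank one, so the Frobenius norm of the matrix of the <z, y> is small. *)
Lemma eigenspace_step N v O l O' l' (t t' eta L : R) x :
  eigenbasis O l N -> eigenbasis O' l' (deflate N v) -> dotv v v = 1 ->
  bounded_by L N -> 0 <= t < t' -> 0 <= L ->
  \sum_(i | l 0 i <= t) ecoord O v i ^+ 2 <= eta ->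
  low_vector O l t x ->
  exists x', [/\ low_vector O' l' t' x', enorm x' <= enorm x &
    enorm (x - x') <= Num.sqrt eta * L / (t' - t) * enorm x].
Proof.
move=> HO HO' vv NL /andP[t0 tt] L0 veta xlow.
have NT := eigen_sym HO.
have eta0 : 0 <= eta.
  by apply: le_trans veta; apply: sumr_ge0 => i _; rewrite sqr_ge0.
(* [f] is the indicator of the eigenvalues up to [t'], so [x'] is the orthogonal projection of [x]
   on the low eigenspaces of the deflated matrix. *)
pose f : 'rV[R]_d := \row_i ((l' 0 i <= t')%R%:R : R).
pose x' := O' *m diag_mx f *m O'^T *m x.
have cx' i : ecoord O' x' i = ((l' 0 i <= t')%R%:R : R) * ecoord O' x i.
  by rewrite (ecoord_mul HO') mxE.
have xE y : dotv y x = \sum_(i | l 0 i <= t) ecoord O y i * ecoord O x i.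
  rewrite (dotv_ecoord HO) [RHS]big_mkcond; apply: eq_bigr => i _.
  by case: ifPn => //; rewrite -ltNge => /xlow ->; rewrite mulr0.
exists x'; split.
- by move=> i ti; rewrite cx' leNgt ti mul0r.
- rewrite enorm_le ?enorm_ge0// enorm_sqr -!(sum_ecoord_sqr HO').
  apply: ler_sum => i _; rewrite cx' exprMn ler_piMl ?sqr_ge0//.
  by case: (l' 0 i <= t'); rewrite ?expr1n ?expr0n.
have yj j : t' < l' 0 j ->
    ecoord O' x j ^+ 2 <= dotv x x * eta / (t' - t) ^+ 2 * ecoord O' (N *m v) j ^+ 2.
  move=> tj; set y := col j O'.
  have l'0 : 0 < l' 0 j by apply: le_lt_trans tj; lra.
  have N'y := eigenvector_col j HO'.
  (* [v] is in the kernel of the deflated matrix and [y] is an eigenvector for a positive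
     eigenvalue, so they are orthogonal and the right-hand projection fixes [y]. *)
  have vy : dotv v y = 0.
    have := dotv_mulmxr v (deflate N v) y.
    rewrite deflate_sym// deflate_kernel// dotv0l N'y dotvZr => /eqP.
    by rewrite mulf_eq0 gt_eqF//= => /eqP.
  have Ny : N *m y - dotv v (N *m y) *: v = l' 0 j *: y.
    rewrite -N'y /deflate -!mulmxA -proj_mul; congr (_ *m (_ *m _)).
    by rewrite proj_mul vy scale0r subr0.
  have G i : l 0 i <= t -> ecoord O y i ^+ 2 <=
      ecoord O v i ^+ 2 * (ecoord O' (N *m v) j ^+ 2 / (t' - t) ^+ 2).
    move=> it; have := congr1 (fun z => ecoord O z i) Ny.
    rewrite /= ecoordB (ecoordM HO) !ecoordZ => h.
    have {}h : (l' 0 j - l 0 i) * ecoord O y i =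
        - (ecoord O v i * ecoord O' (N *m v) j).
      rewrite [ecoord O' _ _]ecoord_dotv dotv_mulmxr NT -/y (dotvC (N *m y)).
      by lra.
    rewrite mulrA ler_pdivlMr ?exprn_gt0 ?subr_gt0//.
    have -> : ecoord O v i ^+ 2 * ecoord O' (N *m v) j ^+ 2 =
        ((l' 0 j - l 0 i) * ecoord O y i) ^+ 2 by rewrite h sqrrN exprMn.
    rewrite exprMn mulrC ler_wpM2r ?sqr_ge0//.
    by rewrite ler_sqr ?nnegrE; lra.
  rewrite [ecoord O' x j]ecoord_dotv -/y xE.
  apply: le_trans (cauchy_schwarz_sum _ _ _) _.
  have h1 : \sum_(i | l 0 i <= t) ecoord O x i ^+ 2 <= dotv x x.
    rewrite -(sum_ecoord_sqr HO); apply: sum_pred_le => i; exact: sqr_ge0.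
  have h2 : \sum_(i | l 0 i <= t) ecoord O y i ^+ 2 <=
      eta * (ecoord O' (N *m v) j ^+ 2 / (t' - t) ^+ 2).
    apply: le_trans (ler_sum _ G) _; rewrite -mulr_suml ler_wpM2r//.
    by rewrite divr_ge0 ?sqr_ge0.
  have ge0 z : 0 <= \sum_(i | l 0 i <= t) ecoord O z i ^+ 2.
    by apply: sumr_ge0 => i _; rewrite sqr_ge0.
  apply: le_trans (ler_pM (ge0 y) (ge0 x) h2 h1) _.
  by rewrite le_eqVlt; apply/orP; left; apply/eqP; ring.
have c0 : 0 <= dotv x x * eta / (t' - t) ^+ 2.
  by rewrite divr_ge0 ?sqr_ge0// mulr_ge0// dotvv_ge0.
have td : 0 < t' - t by rewrite subr_gt0.
rewrite enorm_le; last first.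
  by rewrite !mulr_ge0 ?invr_ge0 ?sqrtr_ge0 ?enorm_ge0// ltW.
rewrite -(sum_ecoord_sqr HO').
apply: (@le_trans _ _ (\sum_j dotv x x * eta / (t' - t) ^+ 2 *
    ecoord O' (N *m v) j ^+ 2)).
  apply: ler_sum => j _; rewrite ecoordB cx'.
  have [_|/yj h] := leP (l' 0 j) t'; last by rewrite mul0r subr0.
  by rewrite mul1r subrr expr0n mulr_ge0// sqr_ge0.
(* The Frobenius sum over [j] collapses: the squared coordinates of [N v] add up to
   [|N v|^2 <= L^2]. *)
rewrite -mulr_sumr (sum_ecoord_sqr HO').
have : dotv (N *m v) (N *m v) <= L ^+ 2.
  by rewrite -enorm_le//; apply: le_trans (NL v) _; rewrite enormE vv sqrtr1 mulr1.
move=> /(ler_wpM2l c0)/le_trans; apply; rewrite le_eqVlt; apply/orP; left.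
apply/eqP; rewrite !exprMn sqr_sqrtr// enorm_sqr exprVn; ring.
Qed.

End Deflation.

Section DeflationStep.
Context {R : realType} {d : nat}.
Implicit Types (N O Q : 'M[R]_d) (v x : 'cV[R]_d).

(** Applied to the reorthogonalization of [v_s']. Since [Q N = N], eigenvectors for nonzero
    eigenvalues are fixed by [Q], so the coordinates above [tau >= 0] do not change while the norm
    can only decrease; after normalization the low fraction has not grown. *)
Lemma projection_mass N Q O l (tau eta : R) x :
  eigenbasis O l N -> Q^T = Q -> Q *m Q = Q -> N *m Q = N -> 0 <= tau ->
  enorm x = 1 -> \sum_(i | l 0 i <= tau) ecoord O x i ^+ 2 <= eta -> eta < 1 ->
  let v := normalize (Q *m x) in
  [/\ enorm v = 1, Q *m v = v &
      \sum_(i | l 0 i <= tau) ecoord O v i ^+ 2 <= eta].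
Proof.
move=> HO QT QQ NQ tau0 x1 xeta eta1 v.
have QN : Q *m N = N.
  by rewrite -[LHS]trmxK trmx_mul QT (eigen_sym HO) NQ (eigen_sym HO).
have hi i : tau < l 0 i -> ecoord O (Q *m x) i = ecoord O x i.
  move=> ti; have l0 : l 0 i != 0 by rewrite gt_eqF// (le_lt_trans tau0).
  rewrite !ecoord_dotv dotv_mulmxr QT; congr (dotv _ _).
  apply: (scalerI l0); rewrite scalemxAr -(eigenvector_col i HO) mulmxA.
  by rewrite QN.
have hsum : 1 - eta <= \sum_(i | ~~ (l 0 i <= tau)) ecoord O (Q *m x) i ^+ 2.
  have := sum_ecoord_sqr HO x; rewrite (enorm_eq1 x1) (bigID (fun i => l 0 i <= tau))/=.
  rewrite [X in _ <= X](_ : _ = \sum_(i | ~~ (l 0 i <= tau)) ecoord O x i ^+ 2).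
    by lra.
  by apply: eq_bigr => i; rewrite -ltNge => /hi ->.
have Qle : dotv (Q *m x) (Q *m x) <= 1.
  rewrite dotv_mulmxr QT mulmxA QQ.
  have := cauchy_schwarz (Q *m x) x; rewrite (enorm_eq1 x1) mulr1.
  have E : dotv (Q *m x) (Q *m x) = dotv (Q *m x) x.
    by rewrite dotv_mulmxr QT mulmxA QQ.
  rewrite E; have := dotvv_ge0 (Q *m x); rewrite E => h0 h.
  have [//|h1] := leP (dotv (Q *m x) x) 1.
  by exfalso; move: h; rewrite expr2; nra.
have sumQ := sum_ecoord_sqr HO (Q *m x).
rewrite (bigID (fun i => l 0 i <= tau))/= in sumQ.
have low0 : 0 <= \sum_(i | l 0 i <= tau) ecoord O (Q *m x) i ^+ 2.
  by apply: sumr_ge0 => i _; rewrite sqr_ge0.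
have Q0 : 0 < dotv (Q *m x) (Q *m x) by lra.
have Qx0 : Q *m x != 0 by rewrite -dotvv_eq0 gt_eqF.
split; first exact: enorm_normalize.
  by rewrite /v /normalize -scalemxAr mulmxA QQ.
rewrite (eq_bigr (fun i => (dotv (Q *m x) (Q *m x))^-1 * ecoord O (Q *m x) i ^+ 2)); last first.
  by move=> i _; rewrite /v /normalize ecoordZ exprMn exprVn enorm_sqr.
rewrite -mulr_sumr ler_pdivrMl//.
move: Qle sumQ hsum low0 Q0; move: (dotv _ _) (\sum_(i | _) _) (\sum_(i | _) _) => a b c.
by have := dotvv_ge0 x; nra.
Qed.

Lemma top_eigenvalue_ge N O l (c : R) x :
  eigenbasis O l N -> x != 0 -> c * dotv x x <= dotv x (N *m x) ->
  exists2 i0, c <= l 0 i0 & forall i, l 0 i <= l 0 i0.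
Proof.
move=> HO x0 cx.
have [i1 _] : exists i1 : 'I_d, True.
  case: (posnP d) => [d0|d0]; last by exists (Ordinal d0).
  by case/eqP: x0; apply/colP => i; have := ltn_ord i; rewrite {2}d0.
pose i0 := [arg max_(i > i1) l 0 i]%O.
have i0P i : l 0 i <= l 0 i0.
  by rewrite /i0; case: Order.TotalTheory.arg_maxP => // j _; apply.
exists i0 => //.
have xx : 0 < dotv x x by rewrite lt_neqAle dotvv_ge0 eq_sym dotvv_eq0 x0.
rewrite -(ler_pM2r xx); apply: le_trans cx _.
rewrite (dotv_ecoord HO) -(sum_ecoord_sqr HO) mulr_sumr; apply: ler_sum => i _.
by rewrite (ecoordM HO) mulrCA -expr2 ler_wpM2r ?sqr_ge0.
Qed.

Lemma columns_gram (u : nat -> 'cV[R]_d) r :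
  orthonormal_family r u -> (columns u 0 r)^T *m columns u 0 r = 1%:M.
Proof.
move=> ou; apply/matrixP => i j.
have -> : ((columns u 0 r)^T *m columns u 0 r) i j = dotv (u i.+1) (u j.+1).
  by rewrite mxE dotvE; apply: eq_bigr => h _; rewrite !mxE.
by rewrite /dotv ou ?ltnS ?ltn_ord// mxE.
Qed.

Lemma columns_recr (u : nat -> 'cV[R]_d) s :
  castmx (erefl d, addn1 s) (row_mx (columns u 0 s) (u s.+1)) = columns u 0 s.+1.
Proof.
apply/matrixP => i j; rewrite castmxE/= cast_ord_id [LHS]mxE [RHS]mxE add0n.
case: splitP => [h|h] /= ->; first by rewrite mxE.
by rewrite ord1 addn0.
Qed.

Lemma columns_outer_recr (u : nat -> 'cV[R]_d) s :
  columns u 0 s.+1 *m (columns u 0 s.+1)^T =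
  columns u 0 s *m (columns u 0 s)^T + u s.+1 *m (u s.+1)^T.
Proof.
apply/matrixP => i j; rewrite !mxE big_ord_recr/= !mxE; congr (_ + _).
  by apply: eq_bigr => h _; rewrite !mxE.
by rewrite big_ord1 !mxE.
Qed.

Lemma columns_tr_mul (u : nat -> 'cV[R]_d) s x (j : 'I_s) :
  ((columns u 0 s)^T *m x) j 0 = dotv (u j.+1) x.
Proof. by rewrite mxE dotvE; apply: eq_bigr => h _; rewrite !mxE. Qed.

(** [V^T U] has fewer rows than columns. The vector found lies in the span of the leading singular
    vectors and survives all deflations so far, which keeps the top eigenvalue large. *)
Lemma orthogonal_in_span s k (V : 'M[R]_(d, s)) (U : 'M[R]_(d, k)) : (s < k)%N ->
  U^T *m U = 1%:M -> exists2 y : 'cV[R]_k, y != 0 & V^T *m (U *m y) = 0.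
Proof.
move=> sk UU; pose B := (V^T *m U)^T; have : kermx B != 0.
  rewrite -mxrank_eq0 mxrank_ker subn_eq0 -ltnNge.
  by apply: leq_ltn_trans sk; exact: rank_leq_col.
case/rowV0Pn => y /sub_kermxP yB y0; exists y^T.
  by rewrite -(inj_eq trmx_inj) trmxK trmx0.
by rewrite mulmxA -[LHS]trmxK trmx_mul trmxK yB trmx0.
Qed.

End DeflationStep.

Section LazySVDState.
Context {R : realType} {d : nat}.
Context (A : inversion_method R d) (M : 'M[R]_d) (k : nat) (delta eps p : R).
Context (fuel : nat) (w0 : nat -> 'cV[R]_d).

(* The pair (I - V_s V_s^T, M_s). *)
Fixpoint svd_state (s : nat) : 'M[R]_d * 'M[R]_d :=
  if s is s'.+1 then
    let QN := svd_state s' in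
    let v := normalize (QN.1 *m
      appxpca_fuel A s QN.2 (delta / 2) eps (p / k%:R) fuel (w0 s)) in
    (QN.1 - v *m v^T, deflate QN.2 v)
  else (1%:M, M).

Definition svd_mx s := (svd_state s).2.

Definition svd_vec s := normalize ((svd_state s.-1).1 *m
  appxpca_fuel A s (svd_mx s.-1) (delta / 2) eps (p / k%:R) fuel (w0 s)).

Lemma svd_stateS s : svd_state s.+1 =
  ((svd_state s).1 - svd_vec s.+1 *m (svd_vec s.+1)^T,
   deflate (svd_mx s) (svd_vec s.+1)).
Proof. by []. Qed.

End LazySVDState.

(** The sum is the squared norm of the projection of [w] on the top eigenspace, the same for every
    eigenbasis; quantifying over all of them avoids any measurable choice. *)
Definition good_start (R : realType) (d : nat) (N : 'M[R]_d) (w : 'cV[R]_d)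
    (theta : R) : Prop :=
  forall O l l1, eigenbasis O l N -> (forall i, l 0 i <= l1) ->
    (exists i, l 0 i = l1) ->
    theta <= \sum_(i | l 0 i == l1) ecoord O w i ^+ 2.

(** * A run of LazySVD from good starts *)

Section LazySVDRun.
Context {R : realType} {d : nat}.
Context (A : inversion_method R d) (M : 'M[R]_d) (k : nat) (delta eps p L lamk : R).
Context (fuel : nat) (w0 : nat -> 'cV[R]_d) (U : 'M[R]_(d, k)) (mu : 'rV[R]_k).
Hypothesis A_correct : inversion_correct A.
Hypothesis M_psd : possemidef M.
Hypothesis M_bounded : bounded_by L M.
Hypothesis L_bnd : 0 < L <= 1.
Hypothesis U_orth : U^T *m U = 1%:M.
Hypothesis U_eigen : M *m U = U *m diag_mx mu.
Hypothesis mu_ge : forall i, lamk <= mu 0 i.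
Hypothesis lamk_gt0 : 0 < lamk.
Hypothesis delta_bnd : 0 < delta < 1.
Hypothesis eps_bnd : 0 < eps < 1.
Hypothesis p_bnd : 0 < p < 1.
Hypothesis k_bnd : (0 < k <= d)%N.
Hypothesis fuel_ge : (3 / 4) ^+ fuel * (3 / 2) <= delta / 2 * lamk / 3.

Local Notation state := (svd_state A M k delta eps p fuel w0).
Local Notation mx := (svd_mx A M k delta eps p fuel w0).
Local Notation vec := (svd_vec A M k delta eps p fuel w0).
Local Notation q := (p / k%:R).

Hypothesis starts : forall s, (1 <= s <= k)%N -> enorm (w0 s) = 1 /\
  good_start (mx s.-1) (w0 s) (start_mass d q).

(** [l1] is the top eigenvalue of the matrix of the round, recorded only as an upper bound in the
    semidefinite order: [lam - l1] is then a valid spectral margin of the call for the cost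
    estimates. *)
Definition svd_call (c : call R d) : Prop := exists (j : nat) (l1 : R),
  [/\ (j < k)%N /\ call_round c = j.+1, call_mx c = mx j,
      lamk <= l1 <= 1 /\ possemidef (l1%:M - mx j),
      delta / 2 * l1 / 12 <= call_lambda c - l1 <= 3 / 2
    & call_tol c = pca_tol1 d (delta / 2) q \/
      call_tol c = pca_tol2 d (delta / 2) eps q].

Definition round_calls : nat := fuel.+1 * (pca_m1 d q).+1 + pca_m2 d eps q.

Definition run_invariant (s : nat) : Prop :=
  [/\ orthonormal_family s vec,
      (state s).1 = 1%:M - columns vec 0 s *m (columns vec 0 s)^T
      /\ mx s = (state s).1 *m M *m (state s).1,
      possemidef (mx s) /\ bounded_by L (mx s),
      exists tr, [/\ lazysvd_state A M k delta eps p w0 (columns vec 0 s) (mx s) tr,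
        all_calls svd_call tr & (size tr <= s * round_calls)%N]
    & forall j O l, (j < s)%N -> eigenbasis O l (mx j) ->
        \sum_(i | l 0 i <= (1 - delta / 2) * lamk) ecoord O (vec j.+1) i ^+ 2 <= eps].

Let q_bnd : 0 < q < 1.
Proof.
have /andP[p0 p1] := p_bnd; have /andP[k0 _] := k_bnd.
have k1 : 1 <= k%:R :> R by rewrite ler1n.
rewrite divr_gt0//=; last by lra.
by rewrite ltr_pdivrMr; lra.
Qed.

Lemma run_invariant_all s : (s <= k)%N -> run_invariant s.
Proof.
have /andP[L0 L1] := L_bnd; have /andP[de0 de1] := delta_bnd.
have /andP[k0 kd] := k_bnd.
elim: s => [|s IH] sk.
  split.
  - by move=> i j /andP[i1]; rewrite leqn0 => /eqP i0; rewrite i0 in i1.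
  - by rewrite /svd_mx/= mul1mx mulmx1; split => //;
      rewrite (_ : columns vec 0 0 = 0) ?mul0mx ?subr0//; apply/matrixP => i [].
  - by [].
  - exists [::]; split => //.
    rewrite (_ : columns vec 0 0 = 0); first exact: lazysvd_init.
    by apply/matrixP => i [].
  - by [].
have [ov [QE NE] [Npsd Nb] [tr [run okc sz]] mass] := IH (ltnW sk).
have [wn gs] := starts (s := s.+1) sk; rewrite /= in gs.
set V := columns vec 0 s in QE run; set Q := (state s).1 in QE NE.
have VV : V^T *m V = 1%:M by exact: columns_gram.
have QT : Q^T = Q by rewrite QE linearB/= trmx1 trmx_mul trmxK.
have QQ : Q *m Q = Q.
  rewrite {2}QE mulmxBr mulmx1 [X in X - _]QE QE mulmxBl mul1mx.
  by rewrite -!mulmxA (mulmxA V^T V) VV mul1mx subrr subr0.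
have NQ : mx s *m Q = mx s by rewrite NE -!mulmxA QQ.
have NT : (mx s)^T = mx s by case: Npsd.
have [B1 [l HO']] := spectral_theorem NT; have HO : eigenbasis B1 l (mx s) := HO'.
(* A vector [U y] orthogonal to [V] is fixed by [Q], so its Rayleigh quotient for [Q M Q] is the one
   for [M], hence at least [lamk]. *)
have topN O' l' : eigenbasis O' l' (mx s) ->
    exists2 i0, lamk <= l' 0 i0 & forall i, l' 0 i <= l' 0 i0.
  move=> HO2; have [y y0 Vy] := orthogonal_in_span V sk U_orth.
  have Uy0 : U *m y != 0.
    by rewrite -dotvv_eq0 dotv_orth// dotvv_eq0.
  apply: (top_eigenvalue_ge HO2 Uy0).
  have QU : Q *m (U *m y) = U *m y.
    by rewrite QE mulmxBl mul1mx -mulmxA Vy mulmx0 subr0.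
  rewrite NE -!mulmxA QU (dotv_mulmxr _ Q) QT QU (mulmxA M) U_eigen -mulmxA !dotv_orth//.
  rewrite !dotvE mulr_sumr; apply: ler_sum => i _; rewrite mul_diag_mx mxE.
  by rewrite [leRHS]mulrCA ler_wpM2r// -expr2 sqr_ge0.
have l_ge0 i := eigenvalue_ge0 i HO Npsd.
have [i0 l1ge l1max] := topN B1 l HO.
have l1_bnd : 0 < l 0 i0 <= 1.
  apply/andP; split; first exact: lt_le_trans l1ge.
  by apply: le_trans L1; exact: eigenvalue_le HO Nb.
have d0 : (0 < d)%N by apply: leq_trans kd.
have de2 : 0 < delta / 2 <= 1 / 2 by lra.
have fuel' : (3 / 4) ^+ fuel * (3 / 2) <= delta / 2 * l 0 i0 / 3.
  by apply: le_trans fuel_ge _; nra.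
have [tr' [pca xn _ okc' sz']] := appxpcaP s.+1 A_correct HO l1max
  l1_bnd d0 de2 eps_bnd q_bnd wn (gs B1 l _ HO l1max (ex_intro _ i0 erefl)) fuel'.
set x := appxpca_fuel _ _ _ _ _ _ _ _ in pca xn.
have vE : vec s.+1 = normalize (Q *m x) by [].
(* The output of the round does not depend on an eigenbasis, but its mass bound does; AppxPCA is
   therefore analysed again for each eigenbasis. Lowering the threshold from the top eigenvalue to
   [lamk] only drops terms. *)
have massN O' l' : eigenbasis O' l' (mx s) ->
  [/\ enorm (vec s.+1) = 1, Q *m vec s.+1 = vec s.+1 &
   \sum_(i | l' 0 i <= (1 - delta / 2) * lamk) ecoord O' (vec s.+1) i ^+ 2 <= eps].
  move=> HO2; have [i1 l1ge' l1max'] := topN O' l' HO2.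
  have l1_bnd' : 0 < l' 0 i1 <= 1.
    apply/andP; split; first exact: lt_le_trans l1ge'.
    by apply: le_trans L1; exact: eigenvalue_le HO2 Nb.
  have fuel2 : (3 / 4) ^+ fuel * (3 / 2) <= delta / 2 * l' 0 i1 / 3.
    by apply: le_trans fuel_ge _; nra.
  have [tr2 [_ _ m2 _ _]] := appxpcaP s.+1 A_correct HO2 l1max'
    l1_bnd' d0 de2 eps_bnd q_bnd wn (gs O' l' _ HO2 l1max' (ex_intro _ i1 erefl)) fuel2.
  have tau0 : 0 <= (1 - delta / 2) * l' 0 i1 by rewrite mulr_ge0 ?ltW//; lra.
  have eps1 : eps < 1 by case/andP: eps_bnd.
  have [vn Qv vm] := projection_mass HO2 QT QQ NQ tau0 xn m2 eps1.
  split => //; apply: le_trans vm; rewrite vE.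
  rewrite [leLHS]big_mkcond [leRHS]big_mkcond; apply: ler_sum => i _.
  case: ifPn => [h|_]; last by case: ifP => //; rewrite sqr_ge0.
  rewrite ifT//; apply: le_trans h _; rewrite ler_pM2l//; lra.
have [vn Qv _] := massN B1 l HO.
have vv := enorm_eq1 vn.
have Vv : V^T *m vec s.+1 = 0.
  rewrite -Qv mulmxA QE mulmxBr mulmx1 mulmxA VV mul1mx subrr mul0mx.
  by [].
have QvT : (vec s.+1)^T *m Q = (vec s.+1)^T by rewrite -[in LHS]QT -trmx_mul Qv.
(* Because [Q v = v], multiplying the projections amounts to subtracting [v v^T]; successive
   deflations are thus the single compression [Q M Q]. *)
have Qnew : (1%:M - vec s.+1 *m (vec s.+1)^T) *m Q = Q - vec s.+1 *m (vec s.+1)^T.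
  by rewrite mulmxBl mul1mx -mulmxA QvT.
have Qnew' : Q *m (1%:M - vec s.+1 *m (vec s.+1)^T) = Q - vec s.+1 *m (vec s.+1)^T.
  by rewrite mulmxBr mulmx1 mulmxA Qv.
split.
- have dv j : (1 <= j <= s)%N -> dotv (vec j) (vec s.+1) = 0.
    move=> /andP[j1 js]; have js' : (j.-1 < s)%N by rewrite prednK.
    have := columns_tr_mul vec (vec s.+1) (Ordinal js').
    by rewrite -/V Vv mxE /= prednK.
  move=> i j /andP[i1 is1] /andP[j1 js1]; rewrite -/(dotv _ _).
  move: is1 js1; rewrite leq_eqVlt => /orP[/eqP ->|]; rewrite ?ltnS.
    rewrite leq_eqVlt => /orP[/eqP ->|]; first by rewrite eqxx.
    rewrite ltnS => js; rewrite dotvC dv ?j1//.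
    by rewrite (gtn_eqF (_ : j < s.+1)%N).
  move=> is1; rewrite leq_eqVlt => /orP[/eqP ->|].
    by rewrite dv ?i1// (ltn_eqF (_ : i < s.+1)%N).
  by rewrite ltnS => js; apply: ov; apply/andP.
- rewrite svd_stateS /= -/Q; split.
    by rewrite columns_outer_recr opprD addrA -QE.
  by rewrite {1}/svd_mx svd_stateS/= /deflate NE -/Q -!mulmxA Qnew' !mulmxA Qnew.
- rewrite /svd_mx svd_stateS/=; split; first exact: deflate_possemidef.
  by apply: deflate_bounded => //; exact: ltW.
- exists (tr ++ tr'); split.
  + rewrite -columns_recr.
    have -> : vec s.+1 = normalize ((1%:M - V *m V^T) *m x) by rewrite -QE.
    rewrite {1}/svd_mx svd_stateS/=.
    have -> : vec s.+1 = normalize ((1%:M - V *m V^T) *m x) by rewrite -QE.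
    exact: lazysvd_round run pca.
  + apply: all_calls_cat => //.
    elim: tr' okc' {pca sz'} => //= c tr2 IH2 [[c1 c2 c3 c4] oc]; split; last exact: IH2.
    exists s, (l 0 i0); split => //; split => //.
      by rewrite l1ge; case/andP: l1_bnd.
    exact: (shift_possemidef HO l1max).
  + by rewrite size_cat mulSn addnC leq_add.
- move=> j O' l' js; move: js; rewrite ltnS leq_eqVlt => /orP[/eqP ->|js].
    by case/massN.
  exact: mass.
Qed.

(** The part of [V^T x] not yet bounded after [j] rounds, padded with zeros so that all stages have
    the same type. *)
Let tail (j : nat) (x : 'cV[R]_d) : 'cV[R]_k :=
  \col_(i < k) (if (j <= i)%N then dotv (vec i.+1) x else 0).

(** [|V^T x|^2 = <V V^T x, x> <= |V^T x| |x|], and one factor cancels. *)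
Lemma enorm_tr_mul (m r : nat) (V : 'M[R]_(m, r)) x : V^T *m V = 1%:M ->
  enorm (V^T *m x) <= enorm x.
Proof.
move=> VV; have [->|n0] := eqVneq (enorm (V^T *m x)) 0; first exact: enorm_ge0.
have np : 0 < enorm (V^T *m x) by rewrite lt_neqAle enorm_ge0 eq_sym n0.
rewrite -(ler_pM2r np) -expr2 enorm_sqr dotv_mulmxr trmxK.
apply: le_trans (ler_norm _) _; apply: le_trans (ler_dotv _ _) _.
by rewrite enorm_orth// mulrC.
Qed.

Lemma tail_bound j x : enorm (tail j x) <= enorm x.
Proof.
have [ov _ _ _ _] := run_invariant_all (leqnn k).
apply: le_trans (enorm_tr_mul x (columns_gram ov)).
rewrite !enormE ler_sqrt ?dotvv_ge0// !dotvv_sum; apply: ler_sum => i _.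
rewrite mxE columns_tr_mul.
by case: ifP => // _; rewrite expr0n sqr_ge0.
Qed.

Lemma tail_split j x x' : (j < k)%N -> enorm (tail j x) <=
  `|dotv (vec j.+1) x| + enorm (tail j.+1 (x - x')) + enorm (tail j.+1 x').
Proof.
move=> jk; have -> : tail j x = dotv (vec j.+1) x *: delta_mx (Ordinal jk) 0 +
    tail j.+1 (x - x') + tail j.+1 x'.
  apply/colP => i; rewrite !mxE andbT leq_eqVlt eq_sym -val_eqE/=.
  have [ij|_] := eqVneq (val i) j.
    by rewrite ij ltnn !addr0 mulr1.
  by rewrite mulr0 add0r /=; case: ifP => _; rewrite ?addr0// -dotvDr subrK.
apply: le_trans (enormD _ _) _; rewrite lerD2r.
apply: le_trans (enormD _ _) _; rewrite lerD2r enormZ ler_piMr//.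
rewrite enormE dotvv_sum (bigD1 (Ordinal jk))//= big1 => [|i /negPf ij].
  by rewrite !mxE eqxx addr0 expr1n sqrtr1.
by rewrite mxE ij expr0n.
Qed.

Lemma tail_low_bound (j : nat) O l x : (j <= k)%N -> eigenbasis O l (mx j) ->
  low_vector O l ((1 - delta + j%:R * (delta / (2 * k%:R))) * lamk) x ->
  enorm (tail j x) <= (k - j)%:R *
    (Num.sqrt eps + Num.sqrt eps * L / (delta * lamk / (2 * k%:R))) * enorm x.
Proof.
have [ov _ _ _ mass] := run_invariant_all (leqnn k).
have /andP[L0 L1] := L_bnd; have /andP[de0 de1] := delta_bnd.
have /andP[k0 kd] := k_bnd.
have k1 : 0 < k%:R :> R by rewrite ltr0n.
set z := Num.sqrt eps * L / _.
have z0 : 0 <= z.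
  by rewrite /z !mulr_ge0 ?sqrtr_ge0 ?invr_ge0 ?ltW// !mulr_gt0 ?invr_gt0 ?mulr_gt0.
move: {2}(k - j)%N (erefl (k - j)%N) => n; elim: n j O l x => [|n IH] j O l x kj jk HO xlow.
  rewrite kj mul0r mul0r (_ : tail j x = 0) ?enormE ?dotv0r ?sqrtr0//.
  apply/colP => i; rewrite !mxE ifF//; apply/negbTE; rewrite -ltnNge.
  by apply: leq_trans (ltn_ord i) _; rewrite -subn_eq0 kj.
have jk' : (j < k)%N by rewrite -subn_gt0 kj.
have [_ _ [Npsd' _] _ _] := run_invariant_all jk'.
have [_ _ [Npsd Nb] _ _] := run_invariant_all jk.
have vv : dotv (vec j.+1) (vec j.+1) = 1.
  by rewrite /dotv ov ?eqxx.
have [B' [l' HB]] := spectral_theorem Npsd'.1.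
have HB' : eigenbasis B' l' (deflate (mx j) (vec j.+1)) by [].
set t := (1 - delta + j%:R * (delta / (2 * k%:R))) * lamk in xlow.
have s0 : 0 < delta / (2 * k%:R) by rewrite divr_gt0// mulr_gt0.
have t0 : 0 <= t.
  by rewrite /t mulr_ge0 ?(ltW lamk_gt0)// addr_ge0 ?mulr_ge0 ?(ltW s0)//; lra.
have tS : (1 - delta + j.+1%:R * (delta / (2 * k%:R))) * lamk - t =
    delta * lamk / (2 * k%:R).
  by rewrite /t -natr1; ring.
have tt : 0 <= t < (1 - delta + j.+1%:R * (delta / (2 * k%:R))) * lamk.
  by rewrite t0 -subr_gt0 tS !mulr_gt0 ?invr_gt0 ?mulr_gt0.
(* All [k] thresholds stay below the level at which the mass of each [v_{j+1}] is known to be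
   small. *)
have tle : t <= (1 - delta / 2) * lamk.
  rewrite /t ler_pM2r//.
  have : j%:R * (delta / (2 * k%:R)) <= delta / 2.
    have -> : delta / 2 = k%:R * (delta / (2 * k%:R)) by field; rewrite gt_eqF.
    by rewrite ler_pM2r// ler_nat.
  by lra.
have vmass : \sum_(i | l 0 i <= t) ecoord O (vec j.+1) i ^+ 2 <= eps.
  apply: le_trans (mass j O l jk' HO).
  rewrite [leLHS]big_mkcond [leRHS]big_mkcond; apply: ler_sum => i _.
  case: ifPn => [h|_]; last by case: ifP => //; rewrite sqr_ge0.
  by rewrite ifT//; apply: le_trans h tle.
have [x' [x'low x'le xx']] :=
  eigenspace_step HO HB' vv Nb tt (ltW L0) vmass xlow.
apply: le_trans (tail_split x x' jk') _.
have h1 : `|dotv (vec j.+1) x| <= Num.sqrt eps * enorm x.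
  have e0 : 0 <= eps by case/andP: eps_bnd => /ltW.
  rewrite -ler_sqr ?nnegrE ?mulr_ge0 ?sqrtr_ge0 ?enorm_ge0//.
  rewrite real_normK ?num_real// exprMn sqr_sqrtr// enorm_sqr.
  have -> : dotv (vec j.+1) x =
      \sum_(i | l 0 i <= t) ecoord O (vec j.+1) i * ecoord O x i.
    rewrite (dotv_ecoord HO) [RHS]big_mkcond; apply: eq_bigr => i _.
    by case: ifPn => //; rewrite -ltNge => /xlow ->; rewrite mulr0.
  apply: le_trans (cauchy_schwarz_sum _ _ _) _; apply: ler_pM => //.
  1,2: by apply: sumr_ge0 => i _; rewrite sqr_ge0.
  by rewrite -(sum_ecoord_sqr HO); apply: sum_pred_le => i; rewrite sqr_ge0.
have h2 : enorm (tail j.+1 (x - x')) <= z * enorm x.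
  by apply: le_trans (tail_bound _ _) _; rewrite tS in xx'; exact: xx'.
have kj' : (k - j.+1 = n)%N by rewrite subnS kj.
have h3 := IH _ _ _ _ kj' jk' HB x'low; rewrite kj' in h3.
have h4 : n%:R * (Num.sqrt eps + z) * enorm x' <= n%:R * (Num.sqrt eps + z) * enorm x.
  by rewrite ler_wpM2l// mulr_ge0// addr_ge0// sqrtr_ge0.
rewrite kj -natr1; lra.
Qed.

Lemma lazysvd_correct : exists (V : 'M[R]_(d, k)) tr,
  [/\ lazysvd A M k delta eps p w0 V tr, V^T *m V = 1%:M,
      forall O l x, eigenbasis O l M -> low_vector O l ((1 - delta) * lamk) x ->
        enorm (V^T *m x) <=
        k%:R * (Num.sqrt eps + Num.sqrt eps * L / (delta * lamk / (2 * k%:R))) * enorm x,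
      all_calls svd_call tr & (size tr <= k * round_calls)%N].
Proof.
have [ov _ _ [tr [run ok sz]] _] := run_invariant_all (leqnn k).
exists (columns vec 0 k), tr; split => //; first by exists (mx k).
  exact: columns_gram.
move=> O l x HO xlow; have := @tail_low_bound 0 O l x (leq0n _) HO.
rewrite mul0r addr0 subn0 => /(_ xlow); apply: le_trans.
rewrite le_eqVlt; apply/orP; left; apply/eqP; congr enorm; apply/colP => i.
by rewrite columns_tr_mul mxE.
Qed.

End LazySVDRun.

(** * Uniform unit vectors *)

Section MeasurableMatrix.
Context {R : realType} {dT : measure_display} {T : measurableType dT}.

Lemma measurable_entry m n i j :
  measurable_fun [set: borel_mx R m n] (fun B : borel_mx R m n => B i j : R).
Proof.
apply: (measurability _ (RGenOpens.measurableE R)).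
move=> _ [_ [a [b ->] <-]]; rewrite setTI.
apply: sub_sigma_algebra.
apply: (@open_comp 'M[R]_(m, n) R (fun B => B i j)); last exact: interval_open.
by move=> B _; exact: coord_continuous.
Qed.

(** An open set is the union of the boxes with rational centre and radius [1/(K+1)] that it
    contains. There are countably many, enumerated by [unpickle], and each is a finite intersection
    of conditions on entries. *)
Lemma measurable_mx m n (f : T -> 'M[R]_(m, n)) :
  (forall i j, measurable_fun [set: T] (fun t => f t i j)) ->
  measurable_fun [set: T] (f : T -> borel_mx R m n).
Proof.
move=> mf; apply: (@measurability _ _ T (borel_mx R m n) setT f open) => //.
move=> _ [U oU <-]; rewrite setTI.
pose box (c : 'M[rat]_(m, n) * nat) : set 'M[R]_(m, n) :=
  [set B | forall i j, `|B i j - ratr (c.1 i j)| < c.2.+1%:R^-1].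
pose F (N : nat) : set T := if unpickle N is Some c then
  if `[< box c `<=` U >] then f @^-1` box c else set0 else set0.
have -> : f @^-1` U = \bigcup_N F N.
  apply/seteqP; split=> [t /= Uft|t [N _]]; last first.
    by rewrite /F; case: unpickle => // c; case: asboolP => // cU /cU.
  have /nbhs_ballP[e /= e0 eU] : nbhs (f t) U by exact: open_nbhs_nbhs.
  have [K K0 Ke] : exists2 K : nat, True & K.+1%:R^-1 < e / 2.
    have e2 : 0 < e / 2 by rewrite divr_gt0.
    exists `|Num.floor ((e / 2)^-1)|%N => //.
    rewrite -[ltRHS]invrK ltf_pV2 ?posrE ?invr_gt0//.
    rewrite -[ltRHS]natr1 natr_absz ger0_norm ?floor_ge0 ?invr_ge0 ?(ltW e2)//.
    by have := floorD1_gt ((e / 2)^-1); rewrite intrD.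
  have q_ex i j : exists q : rat, `|f t i j - ratr q| < K.+1%:R^-1.
    have K1 : 0 < K.+1%:R^-1 :> R by rewrite invr_gt0.
    have lt : f t i j - K.+1%:R^-1 < f t i j + K.+1%:R^-1.
      by move: (_^-1) K1 => a K1; lra.
    have [q] := rat_in_itvoo lt.
    rewrite in_itv/= => /andP[q1 q2]; exists q.
    by rewrite ltr_norml; move: (_^-1) q1 q2 => a q1 q2; apply/andP; split; lra.
  pose q i j := projT1 (cid (q_ex i j)).
  have qE i j : `|f t i j - ratr (q i j)| < K.+1%:R^-1 by exact: projT2 (cid (q_ex i j)).
  pose c : 'M[rat]_(m, n) * nat := (\matrix_(i, j) q i j, K).
  exists (pickle c) => //; rewrite /F pickleK.
  case: asboolP => [_|]; first by move=> i j /=; rewrite mxE.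
  case=> B cB; apply: eU; split => // i j.
  have := cB i j; rewrite /= mxE => h1; have h2 := qE i j.
  rewrite /ball/= (_ : f t i j - B i j =
    (f t i j - ratr (q i j)) - (B i j - ratr (q i j))); last by ring.
  apply: le_lt_trans (ler_normB _ _) (lt_trans (ltrD h2 h1) _).
  by rewrite [ltRHS]splitr ltrD.
apply: bigcupT_measurable => N; rewrite /F; case: unpickle => // c.
case: ifP => // _.
have -> : f @^-1` box c = \bigcap_(i in [set: 'I_m]) \bigcap_(j in [set: 'I_n])
    [set t | `|f t i j - ratr (c.1 i j)| < c.2.+1%:R^-1].
  by apply/seteqP; split=> [t h i _ j _|t h i j]; [exact: h|exact: h].
apply: fin_bigcap_measurable => // i _; apply: fin_bigcap_measurable => // j _.
rewrite -[X in measurable X]setTI.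
apply: (measurable_fun_ltr (f := fun t => `|f t i j - ratr (c.1 i j)|)
   (g := cst c.2.+1%:R^-1)) => //.
by apply: measurableT_comp => //; apply: measurable_funB.
Qed.

Lemma measurable_mx_entry m n (f : T -> 'M[R]_(m, n)) i j :
  measurable_fun [set: T] (f : T -> borel_mx R m n) ->
  measurable_fun [set: T] (fun t => f t i j).
Proof. by move=> mf; exact: (measurableT_comp (@measurable_entry m n i j) mf). Qed.

Lemma measurable_mulmx m n r (f : T -> 'M[R]_(m, n)) (g : T -> 'M[R]_(n, r)) :
  measurable_fun [set: T] (f : T -> borel_mx R m n) ->
  measurable_fun [set: T] (g : T -> borel_mx R n r) ->
  measurable_fun [set: T] ((fun t => f t *m g t) : T -> borel_mx R m r).
Proof.
move=> mf mg; apply: measurable_mx => i j.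
rewrite (_ : (fun t => (f t *m g t) i j) = fun t => \sum_k f t i k * g t k j).
  apply: measurable_sum => k; apply: measurable_funM; exact: measurable_mx_entry.
by apply/funext => t; rewrite mxE.
Qed.

Lemma measurable_trmx m n (f : T -> 'M[R]_(m, n)) :
  measurable_fun [set: T] (f : T -> borel_mx R m n) ->
  measurable_fun [set: T] ((fun t => (f t)^T) : T -> borel_mx R n m).
Proof.
move=> mf; apply: measurable_mx => i j.
rewrite (_ : (fun t => (f t)^T i j) = fun t => f t j i).
  exact: measurable_mx_entry.
by apply/funext => t; rewrite mxE.
Qed.

Lemma measurable_mxB m n (f g : T -> 'M[R]_(m, n)) :
  measurable_fun [set: T] (f : T -> borel_mx R m n) ->
  measurable_fun [set: T] (g : T -> borel_mx R m n) ->
  measurable_fun [set: T] ((fun t => f t - g t) : T -> borel_mx R m n).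
Proof.
move=> mf mg; apply: measurable_mx => i j.
rewrite (_ : (fun t => (f t - g t) i j) = fun t => f t i j - g t i j).
  by apply: measurable_funB; exact: measurable_mx_entry.
by apply/funext => t; rewrite !mxE.
Qed.

Lemma measurable_mxZ m n (a : T -> R) (f : T -> 'M[R]_(m, n)) :
  measurable_fun [set: T] a ->
  measurable_fun [set: T] (f : T -> borel_mx R m n) ->
  measurable_fun [set: T] ((fun t => a t *: f t) : T -> borel_mx R m n).
Proof.
move=> ma mf; apply: measurable_mx => i j.
rewrite (_ : (fun t => (a t *: f t) i j) = fun t => a t * f t i j).
  by apply: measurable_funM => //; exact: measurable_mx_entry.
by apply/funext => t; rewrite !mxE.
Qed.

Lemma measurable_dotv m (f g : T -> 'cV[R]_m) :
  measurable_fun [set: T] (f : T -> borel_mx R m 1) ->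
  measurable_fun [set: T] (g : T -> borel_mx R m 1) ->
  measurable_fun [set: T] (fun t => dotv (f t) (g t)).
Proof.
move=> mf mg; rewrite /dotv.
apply: (measurable_mx_entry (f := fun t => (f t)^T *m g t)).
by apply: measurable_mulmx => //; exact: measurable_trmx.
Qed.

(** [1/a = a |a|^(-2)] reduces inversion to a real power; at 0 both sides are 0 because of the
    factor [a]. *)
Lemma measurable_invr (a : T -> R) : measurable_fun [set: T] a ->
  measurable_fun [set: T] (fun t => (a t)^-1).
Proof.
move=> ma; rewrite (_ : (fun t => _) = fun t => a t * `|a t| `^ (-2)).
  apply: measurable_funM => //.
  apply: (measurableT_comp (f := fun x => x `^ (-2))); first exact: measurable_powR.
  exact: measurableT_comp.
apply/funext => t; have [->|a0] := eqVneq (a t) 0; first by rewrite invr0 mul0r.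
rewrite powRN -[2]/(2%:R) powR_mulrn// real_normK ?num_real// expr2 invfM mulrA.
by rewrite divff// mul1r.
Qed.

Lemma measurable_enorm m (f : T -> 'cV[R]_m) :
  measurable_fun [set: T] (f : T -> borel_mx R m 1) ->
  measurable_fun [set: T] (fun t => enorm (f t)).
Proof.
move=> mf; rewrite (_ : (fun t => _) = Num.sqrt \o fun t => dotv (f t) (f t)).
  apply: measurableT_comp; last exact: measurable_dotv.
  by apply: continuous_measurable_fun => x; exact: sqrt_continuous.
by apply/funext => t /=; rewrite enormE.
Qed.

Lemma measurable_normalize m (f : T -> 'cV[R]_m) :
  measurable_fun [set: T] (f : T -> borel_mx R m 1) ->
  measurable_fun [set: T] ((fun t => normalize (f t)) : T -> borel_mx R m 1).
Proof.
move=> mf; apply: measurable_mxZ => //; apply: measurable_invr.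
exact: measurable_enorm.
Qed.

End MeasurableMatrix.

(** * First-order expansion under a small rotation *)

Section PolynomialTaylor.
Context {R : realType}.
Implicit Type p : {poly R}.

Lemma poly_bounded p : exists2 B : R, 0 <= B & forall x, `|x| <= 1 -> `|p.[x]| <= B.
Proof.
elim/poly_ind: p => [|p c [B B0 IH]]; first by exists 0 => // x _; rewrite horner0 normr0.
exists (B + `|c|) => [|x x1]; first by rewrite addr_ge0.
rewrite hornerMXaddC; apply: le_trans (ler_normD _ _) _; rewrite lerD2r normrM.
by apply: le_trans (ler_pM _ _ (IH x x1) x1) _ => //; rewrite mulr1.
Qed.

Lemma poly_taylor p : exists2 C : R, 0 <= C & forall x h, `|x| <= 1 -> `|h| <= 1 ->
  `|p.[x + h] - p.[x] - h * p^`().[x]| <= C * h ^+ 2.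
Proof.
elim/poly_ind: p => [|p c [C C0 IH]].
  by exists 0 => // x h _ _; rewrite deriv0 !horner0 mulr0 !subr0 normr0 mul0r.
have [B B0 pB] := poly_bounded p^`().
exists (2 * C + B) => [|x h x1 h1]; first by rewrite addr_ge0// mulr_ge0.
rewrite !hornerMXaddC derivD derivC addr0 derivM derivX mulr1 hornerD hornerM hornerX.
set e := p.[x + h] - p.[x] - h * p^`().[x] in IH *.
rewrite (_ : _ - _ = (x + h) * (p.[x + h] - p.[x] - h * p^`().[x]) +
  p^`().[x] * h ^+ 2); last by ring.
apply: le_trans (ler_normD _ _) _; rewrite [leRHS]mulrDl; apply: lerD.
  rewrite normrM; apply: le_trans (ler_pM _ _ (_ : _ <= 2) (IH x h x1 h1)) _ => //.
    by apply: le_trans (ler_normD _ _) _; lra.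
  by rewrite mulrA.
by rewrite normrM (ger0_norm (sqr_ge0 h)) ler_wpM2r ?sqr_ge0// pB.
Qed.

(** For [a = <u, x>] and [b = <v, x>], this expands [p(<u, x>) <v, x>] after a rotation of sine [s],
    uniformly in [x]. The cosine contributes only to second order, as [1 - c <= s^2]. *)
Lemma rotation_taylor p : exists C : R, forall a b c s, `|a| <= 1 -> `|b| <= 1 ->
  0 <= s <= 1 / 2 -> 0 <= c -> c ^+ 2 + s ^+ 2 = 1 ->
  `|p.[c * a + s * b] * (c * b - s * a) - p.[a] * b -
    s * (p^`().[a] * b ^+ 2 - a * p.[a])| <= C * s ^+ 2.
Proof.
have [B B0 pB] := poly_bounded p; have [B' B'0 pB'] := poly_bounded p^`().
have [C C0 pT] := poly_taylor p.
exists (B + 4 * B' + 8 * C) => a b c s a1 b1 /andP[s0 s12] c0 cs.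
have c1 : c <= 1 by nra.
have cs2 : 1 - c <= s ^+ 2 by nra.
have c10 : 0 <= 1 - c by lra.
pose h := s * b - (1 - c) * a.
have -> : c * a + s * b = a + h by rewrite /h; ring.
have hs : `|h| <= 2 * s.
  apply: le_trans (ler_normB _ _) _; rewrite !normrM (ger0_norm s0) (ger0_norm c10).
  by have := normr_ge0 a; have := normr_ge0 b; nra.
have h2 : h ^+ 2 <= 4 * s ^+ 2.
  rewrite -(real_normK (num_real h)) (_ : 4 * s ^+ 2 = (2 * s) ^+ 2); last by ring.
  by rewrite ler_sqr ?nnegrE//; lra.
have hT : `|p.[a + h] - p.[a] - h * p^`().[a]| <= C * h ^+ 2.
  by apply: pT => //; apply: le_trans hs _; lra.
set r := _ - _ - _ in hT.
have rs : `|r| <= 4 * C * s ^+ 2.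
  by apply: le_trans hT _; rewrite (mulrC 4) -mulrA ler_wpM2l.
have kE : `|c * b - s * a| <= 2.
  apply: le_trans (ler_normB _ _) _; rewrite !normrM (ger0_norm s0) (ger0_norm c0).
  by have := normr_ge0 a; have := normr_ge0 b; nra.
have -> : p.[a + h] * (c * b - s * a) - p.[a] * b - s * (p^`().[a] * b ^+ 2 - a * p.[a]) =
  r * (c * b - s * a) - p.[a] * (b * (1 - c)) -
  p^`().[a] * (s * (b * (s * a + (1 - c) * b)) + (1 - c) * (a * (c * b - s * a))).
  by rewrite /r /h; ring.
have q1 : `|r * (c * b - s * a)| <= 8 * C * s ^+ 2.
  rewrite normrM (_ : 8 * C * s ^+ 2 = 4 * C * s ^+ 2 * 2); last by ring.
  by apply: ler_pM.
have q2 : `|p.[a] * (b * (1 - c))| <= B * s ^+ 2.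
  rewrite !normrM; apply: ler_pM => //; first exact: pB.
  rewrite (ger0_norm c10).
  by have := normr_ge0 b; nra.
have q3 : `|p^`().[a] * (s * (b * (s * a + (1 - c) * b)) + (1 - c) * (a * (c * b - s * a)))|
    <= B' * (4 * s ^+ 2).
  rewrite normrM; apply: ler_pM => //; first exact: pB'.
  apply: le_trans (ler_normD _ _) _.
  have u1 : `|s * a + (1 - c) * b| <= 2 * s.
    apply: le_trans (ler_normD _ _) _; rewrite !normrM (ger0_norm s0) (ger0_norm c10).
    by have := normr_ge0 a; have := normr_ge0 b; nra.
  have u2 : `|b * (s * a + (1 - c) * b)| <= 2 * s.
    by rewrite normrM; have := normr_ge0 b; have := normr_ge0 (s * a + (1 - c) * b); nra.
  have u3 : `|a * (c * b - s * a)| <= 2.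
    by rewrite normrM; have := normr_ge0 a; have := normr_ge0 (c * b - s * a); nra.
  rewrite (normrM s) (normrM (1 - c)) (ger0_norm s0) (ger0_norm c10).
  have := normr_ge0 (b * (s * a + (1 - c) * b)).
  by have := normr_ge0 (a * (c * b - s * a)); nra.
apply: le_trans (ler_normB _ _) _; apply: le_trans (lerD (ler_normB _ _) (lexx _)) _.
by lra.
Qed.

End PolynomialTaylor.

Section PlaneRotation.
Context {R : realType} {n : nat}.

(** For orthonormal [u] and [v], the rotation of their plane with cosine [c] and sine [s], extended
    by the identity on the orthogonal complement. *)
Definition plane_rotation (u v : 'cV[R]_n) (c s : R) : 'M[R]_n :=
  1%:M + ((c - 1) *: (u *m u^T + v *m v^T) + s *: (u *m v^T - v *m u^T)).

Lemma plane_rotation_mul u v c s x : plane_rotation u v c s *m x =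
  x + ((c - 1) * dotv u x + s * dotv v x) *: u +
      ((c - 1) * dotv v x - s * dotv u x) *: v.
Proof.
rewrite /plane_rotation mulmxDl mul1mx -addrA; congr (_ + _).
rewrite mulmxDl -!scalemxAl mulmxDl mulmxBl !outer_mulmx.
by apply/colP => i; rewrite !mxE; ring.
Qed.

Lemma plane_rotation_orth u v c s : dotv u u = 1 -> dotv v v = 1 -> dotv u v = 0 ->
  c ^+ 2 + s ^+ 2 = 1 -> (plane_rotation u v c s)^T *m plane_rotation u v c s = 1%:M.
Proof.
move=> uu vv uv cs; have vu : dotv v u = 0 by rewrite dotvC.
have -> : (plane_rotation u v c s)^T = plane_rotation u v c (- s).
  apply/matrixP => i j; rewrite /plane_rotation !mxE !big_ord1 !mxE eq_sym.
  by ring.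
apply/matrixP => i j.
have -> : (plane_rotation u v c (- s) *m plane_rotation u v c s) i j =
    (plane_rotation u v c (- s) *m (plane_rotation u v c s *m (delta_mx j 0 : 'cV[R]_n))) i 0.
  by rewrite mulmxA -colE [RHS]mxE.
have -> : (1%:M : 'M[R]_n) i j = (1%:M *m (delta_mx j 0 : 'cV[R]_n)) i 0.
  by rewrite -colE [RHS]mxE.
congr ((_ : 'cV_n) _ _); set x : 'cV[R]_n := delta_mx j 0.
rewrite !plane_rotation_mul mul1mx.
rewrite !(dotvDr, dotvZr) uu vv uv vu.
move: (dotv u x) (dotv v x) => a b; apply/colP => h; rewrite !mxE.
have c2 : c ^+ 2 = 1 - s ^+ 2 by rewrite -cs addrK.
rewrite -[RHS]addr0 -!addrA; congr (_ + _).
transitivity ((u h 0 * a + v h 0 * b) * (c ^+ 2 - (1 - s ^+ 2))); first by ring.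
by rewrite c2 subrr mulr0.
Qed.

Lemma dotv_plane_rotation u v c s x : dotv u u = 1 -> dotv v v = 1 -> dotv u v = 0 ->
  dotv u (plane_rotation u v c s *m x) = c * dotv u x + s * dotv v x /\
  dotv v (plane_rotation u v c s *m x) = c * dotv v x - s * dotv u x.
Proof.
move=> uu vv uv; have vu : dotv v u = 0 by rewrite dotvC.
by rewrite plane_rotation_mul !(dotvDr, dotvZr) uu vv uv vu; split; ring.
Qed.

End PlaneRotation.

(** * Moments of one coordinate of a uniform unit vector *)

Section SphereLaw.
Context {R : realType} {dT : measure_display} {T : measurableType dT}.
Context (P : probability T R) (n : nat) (w : T -> 'cV[R]_n.+1).
Hypothesis w_unif : uniform_unit_vector P w.

Let mw : measurable_fun [set: T] (w : T -> borel_mx R n.+1 1).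
Proof. by case: w_unif. Qed.

Let S : set (borel_mx R n.+1 1) := [set x | enorm x = 1].
Let D := w @^-1` S.

Lemma measurable_sphere (m : nat) : measurable ([set x | enorm x = 1] : set (borel_mx R m 1)).
Proof.
have mE : measurable_fun [set: borel_mx R m 1] (fun x : borel_mx R m 1 => enorm x == 1).
  apply: (measurable_fun_eqr (f := fun x : borel_mx R m 1 => enorm x) (g := cst 1)) => //.
  exact: (measurable_enorm (f := fun x : borel_mx R m 1 => x : 'cV[R]_m)).
rewrite (_ : [set x | _] = [set: borel_mx R m 1] `&`
    (fun x : borel_mx R m 1 => enorm x == 1) @^-1` [set true]).
  exact: mE.
by apply/seteqP; split=> x /=; [move=> ->; rewrite eqxx|case=> _ /eqP].
Qed.

Let mD : measurable D.
Proof. by rewrite -[X in measurable X]setTI; apply: mw => //; exact: measurable_sphere. Qed.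

Lemma unit_probability : P D = 1%E.
Proof.
have [_ [N [mN N0 DN]] _] := w_unif.
have PDC : P (~` D) = 0%E.
  apply: (subset_measure0 (B := N)) => //; first exact: measurableC.
by rewrite -[X in P X]setCK probability_setC ?PDC ?sube0//; exact: measurableC.
Qed.

(** Bounded on the sphere only: the integrands are polynomials in coordinates, unbounded on the
    whole space. This is why means are taken over the event [D], of probability 1, where [w] is a
    unit vector. *)
Definition sphere_bounded (F : 'cV[R]_n.+1 -> R) : Prop :=
  measurable_fun [set: borel_mx R n.+1 1] F /\
  exists C, forall x, enorm x = 1 -> `|F x| <= C.

Lemma sphere_bounded_cst c : sphere_bounded (fun=> c).
Proof. by split => //; exists `|c|. Qed.

Lemma sphere_boundedD F G : sphere_bounded F -> sphere_bounded G ->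
  sphere_bounded (fun x => F x + G x).
Proof.
move=> [mF [B FB]] [mG [C GC]]; split; first exact: measurable_funD.
exists (B + C) => x x1; apply: le_trans (ler_normD _ _) _.
by apply: lerD; [exact: FB|exact: GC].
Qed.

Lemma sphere_boundedM F G : sphere_bounded F -> sphere_bounded G ->
  sphere_bounded (fun x => F x * G x).
Proof.
move=> [mF [B FB]] [mG [C GC]]; split; first exact: measurable_funM.
exists (B * C) => x x1; rewrite normrM.
by apply: ler_pM => //; [exact: FB|exact: GC].
Qed.

Lemma sphere_boundedX F m : sphere_bounded F -> sphere_bounded (fun x => F x ^+ m).
Proof.
move=> bF; elim: m => [|m IH]; first exact: sphere_bounded_cst.
under eq_fun do rewrite exprS; exact: sphere_boundedM.
Qed.

Lemma sphere_bounded_dotv u : sphere_bounded (dotv u).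
Proof.
split; first exact: (measurable_dotv (f := fun=> u) (g := fun x : borel_mx R n.+1 1 => x : 'cV[R]_n.+1)).
by exists (enorm u) => x x1; rewrite -[leRHS]mulr1 -x1 ler_dotv.
Qed.

Lemma sphere_bounded_horner F (p : {poly R}) : sphere_bounded F ->
  sphere_bounded (fun x => p.[F x]).
Proof.
move=> bF; elim/poly_ind: p => [|p c IH].
  under eq_fun do rewrite horner0; exact: sphere_bounded_cst.
under eq_fun do rewrite hornerMXaddC.
by apply: sphere_boundedD; [exact: sphere_boundedM|exact: sphere_bounded_cst].
Qed.

Lemma sphere_bounded_comp F (Q : 'M[R]_n.+1) : Q^T *m Q = 1%:M ->
  sphere_bounded F -> sphere_bounded (fun x => F (Q *m x)).
Proof.
move=> QQ [mF [B FB]]; split; last first.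
  by exists B => x x1; apply: FB; rewrite enorm_orth.
have mQ : measurable_fun [set: borel_mx R n.+1 1]
    ((fun x : borel_mx R n.+1 1 => Q *m (x : 'cV[R]_n.+1)) : _ -> borel_mx R n.+1 1).
  apply: (measurable_mulmx (f := fun=> Q)
    (g := fun x : borel_mx R n.+1 1 => x : 'cV[R]_n.+1)); last exact: measurable_id.
  exact: measurable_cst.
exact: (measurableT_comp mF mQ).
Qed.

Definition sphere_mean (F : 'cV[R]_n.+1 -> R) : R := \int[P]_(t in D) F (w t).

Lemma sphere_integrable F : sphere_bounded F -> P.-integrable D (EFin \o (F \o w)).
Proof.
move=> [mF [B FB]]; apply: measurable_bounded_integrable => //.
- by apply: le_lt_trans (probability_le1 P mD) _; rewrite ltry.
- by apply: measurable_funTS; exact: (measurableT_comp mF mw).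
exists B; split; first exact: num_real.
by move=> M BM t Dt /=; apply: le_trans (ltW BM); apply: FB.
Qed.

Lemma sphere_meanD F G : sphere_bounded F -> sphere_bounded G ->
  sphere_mean (fun x => F x + G x) = sphere_mean F + sphere_mean G.
Proof. by move=> bF bG; rewrite /sphere_mean RintegralD//; exact: sphere_integrable. Qed.

Lemma sphere_meanZ c F : sphere_bounded F ->
  sphere_mean (fun x => c * F x) = c * sphere_mean F.
Proof. by move=> bF; rewrite /sphere_mean RintegralZl//; exact: sphere_integrable. Qed.

Lemma sphere_mean_le F G : sphere_bounded F -> sphere_bounded G ->
  (forall x, enorm x = 1 -> F x <= G x) -> sphere_mean F <= sphere_mean G.
Proof.
move=> bF bG FG; apply: le_Rintegral => //; try exact: sphere_integrable.
by move=> t Dt; exact: FG.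
Qed.

Lemma eq_sphere_mean F G : (forall x, enorm x = 1 -> F x = G x) ->
  sphere_mean F = sphere_mean G.
Proof. by move=> FG; apply: eq_Rintegral => t /set_mem Dt; exact: FG. Qed.

Lemma sphere_mean_cst c : sphere_mean (fun=> c) = c.
Proof.
rewrite /sphere_mean Rintegral_cst// (_ : fine _ = 1) ?mulr1//.
exact: (congr1 fine unit_probability).
Qed.

Lemma sphere_bounded_sum (I : Type) (s : seq I) (A : pred I) (F : I -> 'cV[R]_n.+1 -> R) :
  (forall i, sphere_bounded (F i)) ->
  sphere_bounded (fun x => \sum_(i <- s | A i) F i x).
Proof.
move=> bF; elim: s => [|i s IH].
  by under eq_fun do rewrite big_nil; exact: sphere_bounded_cst.
under eq_fun do rewrite big_cons; case: (A i) => //; exact: sphere_boundedD.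
Qed.

Lemma sphere_mean_sum (I : Type) (s : seq I) (A : pred I) (F : I -> 'cV[R]_n.+1 -> R) :
  (forall i, sphere_bounded (F i)) ->
  sphere_mean (fun x => \sum_(i <- s | A i) F i x) = \sum_(i <- s | A i) sphere_mean (F i).
Proof.
move=> bF; elim: s => [|i s IH].
  rewrite big_nil -[RHS](sphere_mean_cst 0).
  by apply: eq_sphere_mean => x _; rewrite big_nil.
rewrite big_cons; case: ifPn => Ai; rewrite -IH.
  rewrite -sphere_meanD//; last exact: sphere_bounded_sum.
  by apply: eq_sphere_mean => x _; rewrite big_cons Ai.
by apply: eq_sphere_mean => x _; rewrite big_cons (negbTE Ai).
Qed.

Lemma sphere_mean_rot F (Q : 'M[R]_n.+1) : Q^T *m Q = 1%:M -> sphere_bounded F ->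
  sphere_mean (fun x => F (Q *m x)) = sphere_mean F.
Proof.
move=> QQ bF; have [_ _ inv] := w_unif; have [mF _] := bF.
pose wB : T -> borel_mx R n.+1 1 := w.
pose wQ : T -> borel_mx R n.+1 1 := fun t => Q *m w t.
have mwQ : measurable_fun [set: T] wQ.
  exact: (measurable_mulmx (f := fun=> Q) (g := w)).
have DQ : wQ @^-1` S = D.
  by apply/seteqP; split=> t /=; rewrite /D /S /wQ /= enorm_orth.
rewrite /sphere_mean /Rintegral; congr fine.
have -> : (\int[P]_(t in D) (F (w t))%:E = \int[pushforward P wB]_(x in S) (F x)%:E)%E.
  rewrite integral_pushforward//; [exact/measurable_EFinP|exact: sphere_integrable|].
  exact: measurable_sphere.
have -> : (\int[P]_(t in D) (F (Q *m w t))%:E = \int[pushforward P wQ]_(x in S) (F x)%:E)%E.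
  rewrite integral_pushforward//; [by rewrite DQ|exact/measurable_EFinP| |].
    by rewrite DQ; exact: (sphere_integrable (sphere_bounded_comp QQ bF)).
  exact: measurable_sphere.
apply: (@eq_measure_integral _ _ R S (measure_function_pushforward__canonical__measure_function_Measure P mw)
   (measure_function_pushforward__canonical__measure_function_Measure P mwQ)).
by move=> A mA _; exact: inv.
Qed.

(* The derivative at angle 0 of the mean of p(<u, x>) <v, x> under the rotation
   of the plane of u and v. *)
Lemma sphere_stein (p : {poly R}) (u v : 'cV[R]_n.+1) :
  dotv u u = 1 -> dotv v v = 1 -> dotv u v = 0 ->
  sphere_mean (fun x => p^`().[dotv u x] * dotv v x ^+ 2 +
                        -1 * (dotv u x * p.[dotv u x])) = 0.
Proof.
move=> uu vv uv; have [C HC] := rotation_taylor p.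
have bu := sphere_bounded_dotv u; have bv := sphere_bounded_dotv v.
pose F x := p.[dotv u x] * dotv v x.
pose G x := p^`().[dotv u x] * dotv v x ^+ 2 + -1 * (dotv u x * p.[dotv u x]).
have bF : sphere_bounded F.
  by apply: sphere_boundedM bv; exact: sphere_bounded_horner.
have bG : sphere_bounded G.
  apply: sphere_boundedD; apply: sphere_boundedM.
  - exact: sphere_bounded_horner.
  - exact: sphere_boundedX.
  - exact: sphere_bounded_cst.
  - by apply: sphere_boundedM => //; exact: sphere_bounded_horner.
have le1 y x : dotv y y = 1 -> enorm x = 1 -> `|dotv y x| <= 1.
  move=> yy x1; apply: le_trans (ler_dotv _ _) _.
  by rewrite x1 mulr1 enormE yy sqrtr1.
have small s : 0 < s <= 1 / 2 -> `|sphere_mean G| <= C * s.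
  move=> /andP[s0 s12]; set c := Num.sqrt (1 - s ^+ 2).
  have s21 : 0 <= 1 - s ^+ 2 by nra.
  have cs : c ^+ 2 + s ^+ 2 = 1 by rewrite sqr_sqrtr// subrK.
  have c0 : 0 <= c by exact: sqrtr_ge0.
  pose Q := plane_rotation u v c s.
  have QQ : Q^T *m Q = 1%:M by exact: plane_rotation_orth.
  have bFQ := sphere_bounded_comp QQ bF.
  have bound x : enorm x = 1 -> `|F (Q *m x) - F x - s * G x| <= C * s ^+ 2.
    move=> x1; have [e1 e2] := dotv_plane_rotation c s x uu vv uv.
    rewrite /F /G e1 e2 mulN1r; apply: HC => //; [exact: le1|exact: le1|].
    by rewrite (ltW s0).
  have bsG := sphere_boundedM (sphere_bounded_cst s) bG.
  have EFG : sphere_mean (fun x => F x + s * G x) = sphere_mean F + s * sphere_mean G.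
    by rewrite (sphere_meanD bF bsG) (sphere_meanZ _ bG).
  have EFQ e : sphere_mean (fun x => F (Q *m x) + e) = sphere_mean F + e.
    by rewrite (sphere_meanD bFQ (sphere_bounded_cst e)) sphere_mean_cst (sphere_mean_rot QQ).
  (* By rotation invariance the means of [F (Q x)] and [F x] agree and cancel, leaving [s] times the
     mean of [G] against an error of order [s^2]. *)
  have m1 : sphere_mean F + s * sphere_mean G <= sphere_mean F + C * s ^+ 2.
    rewrite -EFG -EFQ; apply: sphere_mean_le; [exact: sphere_boundedD| |].
      exact: sphere_boundedD bFQ (sphere_bounded_cst _).
    by move=> x /bound; rewrite ler_norml => /andP[]; lra.
  have m2 : sphere_mean F + - (C * s ^+ 2) <= sphere_mean F + s * sphere_mean G.
    rewrite -EFG -EFQ; apply: sphere_mean_le; [|exact: sphere_boundedD|].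
      exact: sphere_boundedD bFQ (sphere_bounded_cst _).
    by move=> x /bound; rewrite ler_norml => /andP[]; lra.
  rewrite -(ler_pM2l s0) -[X in X * `|_|](gtr0_norm s0) -normrM ler_norml.
  by apply/andP; split; lra.
rewrite -[LHS]/(sphere_mean G); apply/eqP; rewrite -normr_eq0 eq_le normr_ge0 andbT.
rewrite leNgt; apply/negP => g0.
(* Chosen so that [C s] is less than [|mean G|], against [small]. *)
pose s := Num.min (1 / 2) (`|sphere_mean G| / (2 * (`|C| + 1))).
have C1 : 0 < 2 * (`|C| + 1) by have := normr_ge0 C; lra.
have s0 : 0 < s by rewrite lt_min (divr_gt0 g0 C1) andbT; lra.
have := small s; rewrite s0 ge_min lexx/= => /(_ isT).
have : s * (2 * (`|C| + 1)) <= `|sphere_mean G|.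
  by rewrite -ler_pdivlMr// ge_min lexx orbT.
by have := ler_norm C; nra.
Qed.

Section Moments.
Context (O : 'M[R]_n.+1).
Hypothesis OO : O^T *m O = 1%:M.

Let u := col 0 O.

Let colO i j : dotv (col i O) (col j O) = (i == j)%:R.
Proof. by rewrite !colE dotv_orth// dotvE (bigD1 i)//= big1 => [|k /negPf ki];
  rewrite !mxE ?eqxx ?addr0 ?mul1r ?andbT// ki mul0r. Qed.

Definition cap_moment (N : nat) : R := sphere_mean (fun x => (1 - dotv u x ^+ 2) ^+ N).

Let b_moment N : sphere_bounded (fun x => (1 - dotv u x ^+ 2) ^+ N).
Proof.
apply: sphere_boundedX.
under eq_fun do rewrite -mulN1r.
apply: sphere_boundedD (sphere_bounded_cst _) _.
apply: sphere_boundedM (sphere_bounded_cst _) _; apply: sphere_boundedX.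
exact: sphere_bounded_dotv.
Qed.

(** The Stein identity for [p = X (1 - X^2)^N], summed over the [n] basis vectors orthogonal to [u]:
    their squared coordinates add up to [1 - a^2], and [a p(a) = (1 - a^2)^N - (1 - a^2)^(N+1)]. *)
Lemma cap_momentS N :
  (n.+1%:R + 2 * N%:R) * cap_moment N.+1 = (n%:R + 2 * N%:R) * cap_moment N.
Proof.
pose p : {poly R} := 'X * (1 - 'X^2) ^+ N.
have pE a : p.[a] = a * (1 - a ^+ 2) ^+ N by rewrite !hornerE.
have p'E a : (1 - a ^+ 2) * p^`().[a] =
    (1 + 2 * N%:R) * (1 - a ^+ 2) ^+ N.+1 - 2 * N%:R * (1 - a ^+ 2) ^+ N.
  rewrite /p derivM derivX mul1r deriv_exp derivB derivC derivXn sub0r.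
  rewrite !(hornerD, hornerM, hornerMn, hornerN, hornerX, hornerXn, horner_exp, hornerC).
  rewrite expr1; case: N {p pE} => [|N]; first by rewrite mulr0n mulr0; ring.
  rewrite -expr2 [N.+1.-1]/= !(exprS (1 - a ^+ 2)); move: ((1 - a ^+ 2) ^+ N) => b.
  by rewrite -[_ *+ N.+1]mulr_natl -(natr1 N); ring.
have : sphere_mean (fun x => \sum_(i | i != 0) (p^`().[dotv u x] * dotv (col i O) x ^+ 2 +
    -1 * (dotv u x * p.[dotv u x]))) = 0.
  rewrite sphere_mean_sum => [|i].
    by apply: big1 => i i0; rewrite sphere_stein ?colO ?eqxx// eq_sym (negbTE i0).
  have bu := sphere_bounded_dotv u.
  apply: sphere_boundedD; apply: sphere_boundedM.
  - exact: sphere_bounded_horner.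
  - by apply: sphere_boundedX; exact: sphere_bounded_dotv.
  - exact: sphere_bounded_cst.
  - by apply: sphere_boundedM => //; exact: sphere_bounded_horner.
have -> : sphere_mean (fun x => \sum_(i | i != 0) (p^`().[dotv u x] * dotv (col i O) x ^+ 2 +
    -1 * (dotv u x * p.[dotv u x]))) =
  sphere_mean (fun x => (n.+1%:R + 2 * N%:R) * (1 - dotv u x ^+ 2) ^+ N.+1 +
     (- (n%:R + 2 * N%:R)) * (1 - dotv u x ^+ 2) ^+ N).
  apply: eq_sphere_mean => x x1.
  rewrite big_split/= -mulr_sumr sumr_const.
  have -> : #|[pred i : 'I_n.+1 | i != 0]| = n.
    by rewrite -[RHS]/(n.+1.-1) -[n.+1 in RHS](card_ord n.+1) -(cardC1 ord0); apply: eq_card.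
  have -> : \sum_(i | i != 0) dotv (col i O) x ^+ 2 = 1 - dotv u x ^+ 2.
    have : \sum_i dotv (col i O) x ^+ 2 = 1.
      rewrite -(enorm_eq1 x1) -(dotv_orth (Q := O^T)) ?trmxK ?(orthC OO)//.
      by rewrite dotvv_sum; apply: eq_bigr => i _; rewrite -[(O^T *m x) i 0]/(ecoord O x i) ecoord_dotv.
    by rewrite (bigD1 0)//= -/u => h; rewrite -[X in _ = X - _]h addrAC subrr add0r.
  rewrite mulrC p'E pE -mulr_natl exprS -natr1; ring.
rewrite sphere_meanD ?sphere_meanZ//.
- by rewrite -/(cap_moment _) -/(cap_moment _) mulNr => /eqP; rewrite subr_eq0 => /eqP.
- exact: sphere_boundedM (sphere_bounded_cst _) (b_moment _).
- exact: sphere_boundedM (sphere_bounded_cst _) (b_moment _).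
Qed.

Lemma cap_moment_ge0 N : 0 <= cap_moment N.
Proof.
rewrite -(sphere_mean_cst 0); apply: sphere_mean_le => //; first exact: sphere_bounded_cst.
move=> x x1; apply: exprn_ge0; rewrite subr_ge0 -(enorm_eq1 x1).
have := cauchy_schwarz u x; rewrite {1}/u {1}/u colO eqxx mul1r.
by [].
Qed.

(** With [x = d + 2N] the recursion multiplies the moment by [(x - 1) / x], and
    [(x - 1)^2 (x + 2) <= x^3]; so the left-hand side does not increase with [N], starting from
    [d]. *)
Lemma cap_moment_le N : cap_moment N ^+ 2 * (n.+1%:R + 2 * N%:R) <= n.+1%:R.
Proof.
elim: N => [|N IH].
  rewrite mulr0 addr0 (_ : cap_moment 0 = 1) ?expr1n ?mul1r//.
  by rewrite /cap_moment; under eq_sphere_mean do rewrite expr0; rewrite sphere_mean_cst.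
apply: le_trans IH; set x : R := n.+1%:R + 2 * N%:R.
have x1 : 1 <= x by rewrite /x -natr1; have := ler0n R n; have := ler0n R N; lra.
have rec : x * cap_moment N.+1 = (x - 1) * cap_moment N.
  by rewrite cap_momentS /x -(natr1 n); congr (_ * _); ring.
have -> : n.+1%:R + 2 * N.+1%:R = x + 2 by rewrite /x -(natr1 N); ring.
have x2 : 0 < x ^+ 2 by rewrite exprn_gt0//; lra.
rewrite -(ler_pM2l x2).
have -> : x ^+ 2 * (cap_moment N.+1 ^+ 2 * (x + 2)) =
    cap_moment N ^+ 2 * ((x - 1) ^+ 2 * (x + 2)).
  rewrite mulrA -exprMn rec; ring.
rewrite [leRHS]mulrCA ler_wpM2l ?sqr_ge0//.
by rewrite -subr_ge0 (_ : _ - _ = 3 * x - 2); [lra|ring].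
Qed.

End Moments.

(* On the band <x, w>^2 < theta the function (1 - <x, w>^2)^N is at least 1/2
   for N = floor (1 / (2 theta)), while its mean is at most
   sqrt (d / (d + 2 N)). *)
Lemma anticoncentration (x : 'cV[R]_n.+1) (q : R) : (0 < n)%N -> enorm x = 1 ->
  0 < q < 1 ->
  (P [set t | (dotv x (w t) ^+ 2 < start_mass n.+1 q)%R] <= q%:E)%E.
Proof.
move=> n0 x1 q01; have /andP[q0 q1] := q01.
have [B [BB Bx]] := orth_first_column x1.
set theta := start_mass n.+1 q.
have /andP[th0 th1] : 0 < theta <= 1 by exact: start_mass_bnd.
have thE : theta * (9 * n.+1%:R) = q ^+ 2.
  by rewrite /theta /start_mass divfK// mulf_neq0// pnatr_eq0.
pose N := `|Num.floor (2 * theta)^-1|%N.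
have y0 : 0 < (2 * theta)^-1 by rewrite invr_gt0; lra.
have NE : N%:R = (Num.floor (2 * theta)^-1)%:~R :> R.
  by rewrite natr_absz ger0_norm// floor_ge0 ltW.
have thI : (2 * theta)^-1 * theta = 2^-1 by field; rewrite gt_eqF.
have Nle : N%:R * theta <= 1 / 2.
  have : N%:R <= (2 * theta)^-1 by rewrite NE floor_le.
  by move/(ler_wpM2r (ltW th0)); rewrite thI; lra.
have Nge : 1 <= (2 * N%:R + 2) * theta.
  have : (2 * theta)^-1 <= N%:R + 1 by rewrite NE -[1]/(1%:~R) -intrD ltW// floorD1_gt.
  by move/(ler_wpM2r (ltW th0)); rewrite thI; lra.
have mle : cap_moment B N <= q / 3.
  have h := cap_moment_le BB N; have h0 := cap_moment_ge0 BB N.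
  rewrite -ler_sqr ?nnegrE ?divr_ge0 ?(ltW q0)//.
  (* Dimension at least 2 makes up for rounding [N] down:
     [(d + 2N) theta >= (2N + 2) theta >= 1]. *)
  have n2 : 2 <= n.+1%:R :> R by rewrite ler_nat.
  have hd : 1 <= (n.+1%:R + 2 * N%:R) * theta by nra.
  (* [d theta = q^2 / 9] bounds the moment by [q / 3]; as the integrand is at least 1/2 on the band,
     the band has probability at most [2q / 3]. *)
  apply: (@le_trans _ _ (n.+1%:R * theta)); last by rewrite expr_div_n -thE; lra.
  apply: le_trans (_ : cap_moment B N ^+ 2 * ((n.+1%:R + 2 * N%:R) * theta) <= _).
    by rewrite ler_peMr ?sqr_ge0.
  by rewrite mulrA ler_wpM2r// ltW.
pose cap : set (borel_mx R n.+1 1) := [set y | dotv x y ^+ 2 < theta].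
have [mdx _] := sphere_boundedX 2 (sphere_bounded_dotv x).
have mcap : measurable cap.
  rewrite (_ : cap = [set: borel_mx R n.+1 1] `&`
    (fun y : borel_mx R n.+1 1 => dotv x y ^+ 2 < theta) @^-1` [set true]).
    by apply: (measurable_fun_ltr (g := cst theta)).
  by apply/seteqP; split=> y /=; [|case].
have bcap : sphere_bounded (\1_cap : _ -> R).
  split; first exact: measurable_indic.
  by exists 1 => y _; rewrite indicE; case: (_ \in _); rewrite ?normr1 ?normr0.
have bern (y : R) m : 0 <= y <= 1 -> 1 - m%:R * y <= (1 - y) ^+ m.
  move=> /andP[yy0 yy1]; elim: m => [|m IH]; first by rewrite mul0r subr0 expr0.
  rewrite exprS; apply: le_trans (ler_wpM2l _ IH); last by lra.
  by rewrite -natr1; have := ler0n R m; nra.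
have le : sphere_mean (fun y => 2^-1 * \1_cap y) <= cap_moment B N.
  apply: sphere_mean_le.
  - exact: sphere_boundedM (sphere_bounded_cst _) bcap.
  - apply: sphere_boundedX; under eq_fun do rewrite -mulN1r.
    apply: sphere_boundedD (sphere_bounded_cst _) _.
    apply: sphere_boundedM (sphere_bounded_cst _) _; apply: sphere_boundedX.
    exact: sphere_bounded_dotv.
  move=> y y1; rewrite Bx indicE.
  have d1 : dotv x y ^+ 2 <= 1.
    by have := cauchy_schwarz x y; rewrite (enorm_eq1 x1) (enorm_eq1 y1) mulr1.
  case: (boolP (y \in cap)) => [/set_mem cy|_]; last first.
    by rewrite mulr0 exprn_ge0// subr_ge0.
  rewrite mulr1; apply: le_trans (bern _ _ _); last by rewrite sqr_ge0.
  have : N%:R * dotv x y ^+ 2 <= N%:R * theta by rewrite ler_wpM2l// ltW.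
  by lra.
rewrite sphere_meanZ// in le.
have E : sphere_mean \1_cap = fine (P ((w @^-1` cap) `&` D)).
  have mcw : measurable (w @^-1` cap) by rewrite -[X in measurable X]setTI; exact: mw.
  by rewrite /sphere_mean /Rintegral -(integral_indic P mD mcw).
have mcw : measurable (w @^-1` cap) by rewrite -[X in measurable X]setTI; exact: mw.
have -> : P [set t | dotv x (w t) ^+ 2 < theta] = P ((w @^-1` cap) `&` D).
  apply/eqP; rewrite eq_le; apply/andP; split; last first.
    by rewrite le_measure ?inE//; exact: measurableI.
  have PDC : P (~` D) = 0%E by rewrite probability_setC ?unit_probability ?subee.
  rewrite -[leRHS]adde0 -PDC; apply: le_trans (measureU2 _ _ _); first last.
  - exact: measurableC.
  - exact: measurableI.
  apply: le_measure; rewrite ?inE//.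
    by apply: measurableU; [exact: measurableI|exact: measurableC].
  by move=> t ct; case: (pselect (D t)) => Dt; [left|right].
rewrite -[leLHS]fineK ?fin_num_measure//; last exact: measurableI.
by rewrite lee_fin -E; lra.
Qed.

End SphereLaw.

(** * Random starts *)

Section MeasurableRun.
Context {R : realType} {dX dT : measure_display}.
Context {X : measurableType dX} {T : measurableType dT} {d : nat}.
Context (inv : X -> inversion_method R d) (xi : T -> X).
Hypothesis m_inv : inversion_measurable inv.
Hypothesis m_xi : measurable_fun [set: T] xi.

Local Notation mfun_mx m n f := (measurable_fun [set: T] (f : T -> borel_mx R m n)).

Lemma measurable_inversion l (lam : T -> R) (M : T -> 'M[R]_d) (b : T -> 'cV[R]_d) eta :
  measurable_fun [set: T] lam -> mfun_mx d d M -> mfun_mx d 1 b ->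
  mfun_mx d 1 (fun t => inv (xi t) l (lam t) (M t) (b t) eta).
Proof.
move=> mlam mM mb.
apply: (measurableT_comp (m_inv l) (_ : measurable_fun [set: T]
  (fun t => (xi t, ((lam t : measurableTypeR R), (M t : borel_mx R d d),
     (b t : borel_mx R d 1), (eta : measurableTypeR R)))))).
apply: measurable_fun_pair => //; apply: measurable_fun_pair => //.
by apply: measurable_fun_pair => //; exact: measurable_fun_pair.
Qed.

Lemma measurable_inverse_power s r (lam : T -> R) (M : T -> 'M[R]_d) eta
    (w : T -> 'cV[R]_d) m :
  measurable_fun [set: T] lam -> mfun_mx d d M -> mfun_mx d 1 w ->
  mfun_mx d 1 (fun t => inverse_power (inv (xi t)) s r (lam t) (M t) eta (w t) m).
Proof.
move=> mlam mM mw; elim: m => [//|m IH] /=; exact: measurable_inversion.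
Qed.

Context (M : T -> 'M[R]_d) (w : T -> 'cV[R]_d) (delta p : R) (s : nat).
Hypothesis m_M : mfun_mx d d M.
Hypothesis m_w : mfun_mx d 1 w.

Lemma measurable_pass_vector r (lam : T -> R) : measurable_fun [set: T] lam ->
  mfun_mx d 1 (fun t => pass_vector (inv (xi t)) s (M t) delta p (w t) r (lam t)).
Proof.
by move=> mlam; apply: measurable_normalize; exact: measurable_inverse_power.
Qed.

Lemma measurable_pass_Delta r (lam : T -> R) : measurable_fun [set: T] lam ->
  measurable_fun [set: T]
    (fun t => pass_Delta (inv (xi t)) s (M t) delta p (w t) r (lam t)).
Proof.
move=> mlam; rewrite /pass_Delta; apply: measurable_funM => //.
apply: measurable_invr; apply: measurable_funB => //.
apply: (measurable_dotv (f := fun t => pass_vector _ _ _ _ _ _ _ _)).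
  exact: measurable_pass_vector.
by apply: measurable_inversion => //; exact: measurable_pass_vector.
Qed.

Lemma measurable_pass_lambda r (lam : T -> R) : measurable_fun [set: T] lam ->
  measurable_fun [set: T]
    (fun t => pass_lambda (inv (xi t)) s (M t) delta p (w t) r (lam t)).
Proof.
move=> mlam; apply: measurable_funB => //; apply: measurable_funM => //.
exact: measurable_pass_Delta.
Qed.

Lemma measurable_pca_loop_fuel fuel r (lam : T -> R) : measurable_fun [set: T] lam ->
  measurable_fun [set: T]
    (fun t => pca_loop_fuel (inv (xi t)) s (M t) delta p (w t) fuel r (lam t)).
Proof.
elim: fuel r lam => [|fuel IH] r lam mlam /=; first exact: measurable_pass_lambda.
apply: measurable_fun_ifT; last by apply: IH; exact: measurable_pass_lambda.
  apply: measurable_fun_ler; first exact: measurable_pass_Delta.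
  apply: measurable_funM => //; apply: measurable_funM => //.
  exact: measurable_pass_lambda.
exact: measurable_pass_lambda.
Qed.

Lemma measurable_appxpca_fuel eps fuel :
  mfun_mx d 1 (fun t => appxpca_fuel (inv (xi t)) s (M t) delta eps p fuel (w t)).
Proof.
apply: measurable_normalize; apply: measurable_inverse_power => //.
exact: measurable_pca_loop_fuel.
Qed.

End MeasurableRun.

(** The source space is arbitrary. For the sample space with the sigma-algebra of the past, the
    lemma says that [M_s] is determined by the seed and the first [s] starts. *)
Lemma measurable_svd_state (R : realType) (dX dT : measure_display)
    (X : measurableType dX) (T : measurableType dT) (d : nat)
    (inv : X -> inversion_method R d) (xi : T -> X) (M : 'M[R]_d) (k : nat)
    (delta eps p : R) (fuel : nat) (w0 : nat -> T -> 'cV[R]_d) (s : nat) :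
  inversion_measurable inv -> measurable_fun [set: T] xi ->
  (forall j, (1 <= j <= s)%N -> measurable_fun [set: T] (w0 j : T -> borel_mx R d 1)) ->
  let state t := svd_state (inv (xi t)) M k delta eps p fuel (w0 ^~ t) s in
  measurable_fun [set: T] ((fun t => (state t).1) : T -> borel_mx R d d) /\
  measurable_fun [set: T] ((fun t => (state t).2) : T -> borel_mx R d d).
Proof.
move=> minv mxi; elim: s => [|s IH] mw; first by split; exact: measurable_cst.
have [j /andP[j1 js]|mQ mN] := IH; first by apply: mw; rewrite j1 leqW.
pose v t := svd_vec (inv (xi t)) M k delta eps p fuel (w0 ^~ t) s.+1.
have mv : measurable_fun [set: T] (v : T -> borel_mx R d 1).
  apply: measurable_normalize; apply: measurable_mulmx => //.
  apply: measurable_appxpca_fuel => //.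
  by apply: mw; rewrite leqnn.
have mvv : measurable_fun [set: T] ((fun t => v t *m (v t)^T) : T -> borel_mx R d d).
  by apply: measurable_mulmx => //; exact: measurable_trmx.
have mP : measurable_fun [set: T] ((fun t => 1%:M - v t *m (v t)^T) : T -> borel_mx R d d).
  by apply: measurable_mxB => //; exact: measurable_cst.
split; first exact: measurable_mxB mQ mvv.
exact: measurable_mulmx (measurable_mulmx mP mN) mP.
Qed.

(** * Rational directions near the top eigenspace *)

Section RationalDirections.
Context {R : realType} {n : nat}.

(* Countably many directions allow a near-top direction of a random matrix to
   be chosen measurably. *)
Definition rational_direction (j : nat) : 'cV[R]_n.+1 :=
  let x := map_mx ratr (odflt 0 (unpickle j : option 'cV[rat]_n.+1)) in
  if x == 0 then delta_mx 0 0 else normalize x.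

Lemma enorm_rational_direction j : enorm (rational_direction j) = 1.
Proof.
rewrite /rational_direction; case: ifPn => [_|]; last exact: enorm_normalize.
rewrite enormE dotvE (bigD1 0)//= big1 => [|i /negPf i0].
  by rewrite !mxE eqxx mulr1 addr0 sqrtr1.
by rewrite !mxE i0 mul0r.
Qed.

Lemma rational_approximation (z : 'cV[R]_n.+1) (h : R) : 0 < h ->
  exists q : 'cV[rat]_n.+1, enorm (map_mx ratr q - z) <= h.
Proof.
move=> h0; pose e := h / n.+1%:R.
have e0 : 0 < e by rewrite divr_gt0.
have q_ex i : exists q : rat, `|ratr q - z i 0| <= e.
  have lt : z i 0 - e < z i 0 + e by lra.
  have [q] := rat_in_itvoo lt; rewrite in_itv/= => /andP[q1 q2]; exists q.
  by rewrite ler_norml; apply/andP; split; lra.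
pose q i := projT1 (cid (q_ex i)).
have qE i : `|ratr (q i) - z i 0| <= e by exact: projT2 (cid (q_ex i)).
exists (\col_i q i); rewrite enorm_le ?(ltW h0)// dotvv_sum.
apply: (@le_trans _ _ (\sum_(i < n.+1) e ^+ 2)).
  apply: ler_sum => i _; rewrite !mxE -(real_normK (num_real _)).
  by rewrite ler_sqr ?nnegrE ?(ltW e0)//; exact: qE.
rewrite sumr_const card_ord -mulr_natl.
have -> : h ^+ 2 = n.+1%:R ^+ 2 * e ^+ 2.
  by rewrite -exprMn /e mulrCA divff ?mulr1// pnatr_eq0.
rewrite ler_wpM2r ?sqr_ge0// expr2 ler_peMl//.
by rewrite ler1n.
Qed.

(** A rational vector within [h] of the unit eigenvector has quadratic form at least [l1 (1 - h)^2],
    the other terms being nonnegative, and squared norm at most [(1 + h)^2]; moreover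
    [(1 - 4h) (1 + h)^2 <= (1 - h)^2]. *)
Lemma rational_direction_dense (N O : 'M[R]_n.+1) l i0 (e : R) :
  possemidef N -> eigenbasis O l N -> 0 < e ->
  exists j, l 0 i0 - e <= dotv (rational_direction j) (N *m rational_direction j).
Proof.
move=> Npsd HO e0; have l0 i := eigenvalue_ge0 i HO Npsd.
set l1 := l 0 i0; have l10 : 0 <= l1 by exact: l0.
pose h := Num.min (1 / 2) (e / (4 * (l1 + 1))).
have hp : 0 < 4 * (l1 + 1) by lra.
have h0 : 0 < h by rewrite lt_min (divr_gt0 e0 hp) andbT; lra.
have h12 : h <= 1 / 2 by rewrite ge_min lexx.
have he : h * (4 * (l1 + 1)) <= e by rewrite -ler_pdivlMr// ge_min lexx orbT.
have [q qz] := rational_approximation (col i0 O) h0.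
set x := map_mx ratr q in qz; set z := col i0 O in qz.
have zz : dotv z z = 1 by rewrite -ecoord_dotv (ecoord_col HO) eqxx.
have z1 : enorm z = 1 by rewrite enormE zz sqrtr1.
have xz : x = z + (x - z) by rewrite addrC subrK.
have xle : enorm x <= 1 + h.
  by rewrite xz; apply: le_trans (enormD _ _) _; rewrite z1 lerD2l.
have cx : 1 - h <= ecoord O x i0.
  rewrite ecoord_dotv -/z {1}xz dotvDr zz.
  have := ler_dotv z (x - z); rewrite z1 mul1r ler_norml => /andP[].
  by move: qz; lra.
have xNx : l1 * (1 - h) ^+ 2 <= dotv x (N *m x).
  rewrite (dotv_ecoord HO) (bigD1 i0)//= (ecoordM HO).
  apply: (@le_trans _ _ (l1 * ecoord O x i0 ^+ 2)).
    by rewrite ler_wpM2l// ler_sqr ?nnegrE; lra.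
  rewrite expr2 mulrCA lerDl sumr_ge0// => i _.
  by rewrite (ecoordM HO) mulrCA -expr2 mulr_ge0 ?sqr_ge0.
have x0 : x != 0.
  apply: contraTneq cx => ->; rewrite /ecoord mulmx0 mxE -ltNge; lra.
have xx : 0 < dotv x x by rewrite lt_neqAle dotvv_ge0 eq_sym dotvv_eq0 x0.
exists (pickle q); rewrite /rational_direction pickleK/= -/x (negbTE x0).
rewrite /normalize -scalemxAr dotvZl dotvZr mulrA -invfM -expr2 enorm_sqr mulrC.
rewrite ler_pdivlMr//.
have xx2 : dotv x x <= (1 + h) ^+ 2 by rewrite -enorm_le//; lra.
have [neg|pos] := leP (l1 - e) 0.
  apply: (@le_trans _ _ 0); first by rewrite mulr_le0_ge0// ltW.
  by apply: le_trans xNx; rewrite mulr_ge0// sqr_ge0.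
apply: le_trans (ler_wpM2l (ltW pos) xx2) (le_trans _ xNx).
have : l1 - e <= l1 * (1 - 4 * h) by nra.
move/(ler_wpM2r (sqr_ge0 (1 + h)))/le_trans; apply.
rewrite -mulrA ler_wpM2l//.
have : 0 <= h ^+ 2 * (8 + 4 * h) by rewrite mulr_ge0 ?sqr_ge0//; lra.
by rewrite !expr2; lra.
Qed.

Lemma positive_gap (l : 'rV[R]_n.+1) (l1 : R) : (forall i, l 0 i <= l1) ->
  exists2 g, 0 < g & forall i, l 0 i != l1 -> l 0 i <= l1 - g.
Proof.
(* The initial value 1 of the minimum covers the case where all eigenvalues equal [l1]. *)
move=> le; exists (\big[Num.min/1]_(i | l 0 i != l1) (l1 - l 0 i)).
  elim/big_ind: _ => // [a b a0 b0|i li]; first by rewrite lt_min a0.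
  by rewrite subr_gt0 lt_neqAle li le.
by move=> i li; rewrite lerBrDl -lerBrDr; exact: bigmin_le_cond.
Qed.

(** If the top mass [m] of [w] were below [theta], put [D = sqrt theta - sqrt m]. A unit vector
    whose Rayleigh quotient is within [2e] of the top has mass at most [2e / g] off the top
    eigenspace, [g] being the eigenvalue gap; [e = g D^2 / 8] makes this [D^2 / 4], so
    [|<y, w>| <= sqrt m + D/2 < sqrt theta]. *)
Lemma good_start_limit (N : 'M[R]_n.+1) w (theta : R) : possemidef N ->
  enorm w = 1 -> 0 < theta ->
  (forall e, 0 < e -> exists y, [/\ enorm y = 1,
     forall i, dotv (rational_direction i) (N *m rational_direction i) <=
       dotv y (N *m y) + e & theta <= dotv y w ^+ 2]) ->
  good_start N w theta.
Proof.
move=> Npsd w1 th0 H O l l1 HO lle [i0 li0].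
set m := \sum_(i | _) _; rewrite leNgt; apply/negP => mth.
have m0 : 0 <= m by apply: sumr_ge0 => i _; rewrite sqr_ge0.
have [g g0 gap] := positive_gap lle.
pose D := Num.sqrt theta - Num.sqrt m.
have D0 : 0 < D by rewrite subr_gt0 ltr_sqrt.
pose e := g * D ^+ 2 / 8.
have e0 : 0 < e by rewrite divr_gt0// mulr_gt0// exprn_gt0.
have [y [y1 ymax yw]] := H e e0.
have yN : l1 - 2 * e <= dotv y (N *m y).
  have [j jE] := rational_direction_dense i0 Npsd HO e0.
  by rewrite li0 in jE; have := ymax j; lra.
have yy := enorm_eq1 y1; have ww := enorm_eq1 w1.
have mass : g * \sum_(i | l 0 i != l1) ecoord O y i ^+ 2 <= 2 * e.
  have : \sum_i (l1 - l 0 i) * ecoord O y i ^+ 2 <= 2 * e.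
    have -> : \sum_i (l1 - l 0 i) * ecoord O y i ^+ 2 = l1 - dotv y (N *m y).
      rewrite (dotv_ecoord HO) -[X in X - _]mulr1 -yy -(sum_ecoord_sqr HO).
      rewrite mulr_sumr -sumrB; apply: eq_bigr => i _; rewrite (ecoordM HO); ring.
    by lra.
  apply: le_trans; rewrite mulr_sumr.
  apply: (@le_trans _ _ (\sum_(i | l 0 i != l1) (l1 - l 0 i) * ecoord O y i ^+ 2)).
    by apply: ler_sum => i /gap li; rewrite ler_wpM2r ?sqr_ge0//; lra.
  apply: sum_pred_le => i; rewrite mulr_ge0 ?sqr_ge0//.
  by rewrite subr_ge0.
set b := \sum_(i | l 0 i != l1) ecoord O y i ^+ 2 in mass.
have bD : b <= D ^+ 2 / 4.
  by rewrite -(ler_pM2l g0); apply: le_trans mass _; rewrite /e; lra.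
have ywE : dotv y w = \sum_(i | l 0 i == l1) ecoord O y i * ecoord O w i +
    \sum_(i | l 0 i != l1) ecoord O y i * ecoord O w i.
  by rewrite (dotv_ecoord HO) (bigID (fun i => l 0 i == l1)).
have c1 : `|\sum_(i | l 0 i == l1) ecoord O y i * ecoord O w i| <= Num.sqrt m.
  rewrite -sqrtr_sqr ler_sqrt//; apply: le_trans (cauchy_schwarz_sum _ _ _) _.
  rewrite ler_piMl// -yy -(sum_ecoord_sqr HO).
  by apply: sum_pred_le => i; rewrite sqr_ge0.
have c2 : `|\sum_(i | l 0 i != l1) ecoord O y i * ecoord O w i| <= D / 2.
  have -> : D / 2 = Num.sqrt (D ^+ 2 / 4).
    rewrite (_ : D ^+ 2 / 4 = (D / 2) ^+ 2); last by field.
    by rewrite sqrtr_sqr ger0_norm//; lra.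
  rewrite -sqrtr_sqr ler_sqrt; last by rewrite divr_ge0 ?sqr_ge0.
  apply: le_trans (cauchy_schwarz_sum _ _ _) (le_trans _ bD).
  rewrite ler_piMr//; first by apply: sumr_ge0 => i _; rewrite sqr_ge0.
  rewrite -ww -(sum_ecoord_sqr HO).
  by apply: sum_pred_le => i; rewrite sqr_ge0.
have : Num.sqrt theta <= `|dotv y w|.
  by rewrite -[leRHS]sqrtr_sqr ler_sqrt// sqr_ge0.
rewrite ywE => /le_trans/(_ (ler_normD _ _))/le_trans/(_ (lerD c1 c2)).
by rewrite leNgt => /negP; apply; rewrite -/D; move: D0; rewrite /D; lra.
Qed.

End RationalDirections.

(** * Independence of a start from the past *)

Section Past.
Context {R : realType} {dT dX : measure_display}.
Context {T : measurableType dT} {X : measurableType dX} (P : probability T R).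
Context {d k : nat} (xi : T -> X) (w : nat -> T -> 'cV[R]_d).
Hypothesis m_xi : measurable_fun [set: T] xi.
Hypothesis m_w : forall s, (1 <= s <= k)%N ->
  measurable_fun [set: T] (w s : T -> borel_mx R d 1).
Hypothesis indep : independent_starts P k xi w.

(** A family of rectangles closed under intersection, generating the sigma-algebra of the seed and
    the first [s] starts. *)
Definition past (s : nat) : set (set T) :=
  [set A | exists (S : set X) (B : nat -> set (borel_mx R d 1)),
    [/\ measurable S, (forall j, measurable (B j)) &
      A = [set t | S (xi t) /\ forall j, (1 <= j <= s)%N -> B j (w j t)]]].

Lemma past_setI s : setI_closed (past s).
Proof.
move=> _ _ [S [B [mS mB ->]]] [S' [B' [mS' mB' ->]]].
exists (S `&` S'), (fun j => B j `&` B' j); split; first exact: measurableI.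
  by move=> j; exact: measurableI.
apply/seteqP; split=> t /=.
  by move=> [[St Bt] [S't B't]]; split=> // j js; split; [exact: Bt|exact: B't].
by move=> [[St S't] BB't]; split; split=> // j /BB't[].
Qed.

Lemma past_setT s : past s setT.
Proof.
by exists setT, (fun=> setT); split=> //; apply/seteqP; split.
Qed.

Lemma past_measurable s : (s <= k)%N -> past s `<=` @measurable _ T.
Proof.
move=> sk _ [S [B [mS mB ->]]].
rewrite (_ : [set t | _] = (xi @^-1` S) `&`
  \bigcap_j (if (1 <= j <= s)%N then w j @^-1` B j else setT)); last first.
  apply/seteqP; split=> t /= [St Bt]; split=> // j.
    by case: ifP => // js _; exact: Bt.
  by move=> js; have := Bt j I; rewrite js.
apply: measurableI; first by rewrite -[X in measurable X]setTI; exact: m_xi.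
apply: bigcapT_measurable => j; case: ifP => // /andP[j1 js].
rewrite -[X in measurable X]setTI; apply: m_w => //.
by rewrite j1 (leq_trans js).
Qed.

Lemma past_xi s : measurable_fun [set: g_sigma_algebraType (past s)]
  (xi : g_sigma_algebraType (past s) -> X).
Proof.
move=> _ S mS; rewrite setTI; apply: sub_sigma_algebra.
exists S, (fun=> setT); split=> //.
by apply/seteqP; split=> t /= => [|[]].
Qed.

Lemma past_w s j : (1 <= j <= s)%N ->
  measurable_fun [set: g_sigma_algebraType (past s)]
    (w j : g_sigma_algebraType (past s) -> borel_mx R d 1).
Proof.
move=> js _ B mB; rewrite setTI; apply: sub_sigma_algebra.
exists setT, (fun i => if i == j then B else setT); split=> //.
  by move=> i; case: ifP.
apply/seteqP; split=> t /=.
  by move=> Bt; split=> // i _; case: eqP => // ->.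
by move=> [_ /(_ j js)]; rewrite eqxx.
Qed.

Lemma past_independent_rect s (C : set (borel_mx R d 1)) A : (s < k)%N ->
  measurable C -> past s A ->
  P (A `&` (w s.+1 @^-1` C)) = (P A * P (w s.+1 @^-1` C))%E.
Proof.
move=> sk mC [S [B [mS mB ->]]].
(* Both events are padded with the whole space up to index [k], so that the product rule applies;
   they differ only in the factor at [s + 1]. *)
pose B0 (j : nat) : set (borel_mx R d 1) := if (j <= s)%N then B j else setT.
pose B1 (j : nat) : set (borel_mx R d 1) :=
  if (j <= s)%N then B j else if j == s.+1 then C else setT.
have mB0 j : measurable (B0 j) by rewrite /B0; case: ifP.
have mB1 j : measurable (B1 j) by rewrite /B1; case: ifP => // _; case: ifP.
have -> : [set t | S (xi t) /\ (forall j, (1 <= j <= s)%N -> B j (w j t))] `&`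
    (w s.+1 @^-1` C) =
    [set t | S (xi t) /\ (forall j, (1 <= j <= k)%N -> B1 j (w j t))].
  apply/seteqP; split=> t /=.
    move=> [[St Bt] Ct]; split=> // j /andP[j1 jk]; rewrite /B1.
    by case: ifPn => [js|_]; [apply: Bt; rewrite j1|case: eqP => // ->].
  move=> [St Bt]; split; last by have := Bt s.+1 sk; rewrite /B1 ltnn eqxx.
  split=> // j /andP[j1 js]; have := Bt j; rewrite /B1 js; apply.
  by rewrite j1 (leq_trans js)// ltnW.
have -> : [set t | S (xi t) /\ (forall j, (1 <= j <= s)%N -> B j (w j t))] =
    [set t | S (xi t) /\ (forall j, (1 <= j <= k)%N -> B0 j (w j t))].
  apply/seteqP; split=> t /= [St Bt]; split=> // j /andP[j1 js].
    by rewrite /B0; case: ifPn => // js'; apply: Bt; rewrite j1.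
  have := Bt j; rewrite /B0 js; apply.
  by rewrite j1 (leq_trans js)// ltnW.
rewrite (indep mS mB1) (indep mS mB0) -muleA; congr (_ * _)%E.
have split (F : nat -> \bar R) : (\prod_(1 <= i < k.+1) F i =
    \prod_(1 <= i < s.+1) F i * (F s.+1 * \prod_(s.+2 <= i < k.+1) F i))%E.
  rewrite (@big_cat_nat _ _ _ s.+1)//=; last exact: ltnW.
  by rewrite (@big_ltn _ _ _ s.+1).
rewrite !split.
have E1 : (\prod_(1 <= i < s.+1) P [set t | B1 i (w i t)] =
   \prod_(1 <= i < s.+1) P [set t | B0 i (w i t)])%E.
  by apply: eq_big_nat => i /andP[_]; rewrite ltnS /B1 /B0 => ->.
have E2 : (\prod_(s.+2 <= i < k.+1) P [set t | B1 i (w i t)] =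
   \prod_(s.+2 <= i < k.+1) P [set t | B0 i (w i t)])%E.
  by apply: eq_big_nat => i /andP[si _]; rewrite /B1 /B0 leqNgt (ltnW si)/= gtn_eqF.
rewrite E1 E2 /B1 /B0 ltnn eqxx.
have -> : [set t | ([set: borel_mx R d 1] : set _) (w s.+1 t)] = setT.
  by apply/seteqP; split.
rewrite probability_setT mul1e -muleA; congr (_ * _)%E.
by rewrite muleC.
Qed.

(** As functions of [A] both sides are finite measures, [P] restricted to an event and a multiple of
    [P]; they agree on the rectangles, hence on the generated sigma-algebra. *)
Lemma past_independent s (C : set (borel_mx R d 1)) A : (s < k)%N ->
  measurable C -> <<s past s >> A ->
  P (A `&` (w s.+1 @^-1` C)) = (P A * P (w s.+1 @^-1` C))%E.
Proof.
move=> sk mC sA.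
have mW : measurable (w s.+1 @^-1` C).
  by rewrite -[X in measurable X]setTI; exact: m_w.
have c0 : 0 <= fine (P (w s.+1 @^-1` C)) by exact: fine_ge0.
pose c := NngNum c0.
have cE : (c%:num)%:E = P (w s.+1 @^-1` C) by rewrite /= fineK// fin_num_measure.
have h := @g_sigma_algebra_measure_unique _ R T (past s) (past_measurable (ltnW sk))
  (fun=> setT) (fun=> past_setT s) _ (mrestr P mW) (mscale c P) (@past_setI s) _ _ A sA.
have -> : P (A `&` (w s.+1 @^-1` C)) = mrestr P mW A by [].
have scE B : mscale c P B = (P B * P (w s.+1 @^-1` C))%E.
  by rewrite muleC -cE.
rewrite h; first exact: scE.
- by apply: bigcup_const; exists 0%N.
- by move=> B pB; apply: etrans (past_independent_rect sk mC pB) (esym (scE B)).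
- move=> _; apply: le_lt_trans (probability_le1 P (measurableI _ _ measurableT mW)) _.
  by rewrite ltry.
Qed.

End Past.

(** * Probability that a start is good *)

Section StartProbability.
Context {R : realType} {dT : measure_display} {T : measurableType dT}.
Context (P : probability T R) {n : nat} (G : set (set T)).
Context (M : T -> 'M[R]_n.+1) (w : T -> 'cV[R]_n.+1) (q : R).
Hypothesis G_meas : <<s G >> `<=` @measurable _ T.
Hypothesis m_M : measurable_fun [set: g_sigma_algebraType G]
  (M : g_sigma_algebraType G -> borel_mx R n.+1 n.+1).
Hypothesis M_psd : forall t, possemidef (M t).
Hypothesis n_gt0 : (0 < n)%N.
Hypothesis q_bnd : 0 < q < 1.
Hypothesis w_unif : uniform_unit_vector P w.
Hypothesis w_indep : forall (C : set (borel_mx R n.+1 1)) A, measurable C ->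
  <<s G >> A -> P (A `&` (w @^-1` C)) = (P A * P (w @^-1` C))%E.

Let y := @rational_direction R n.
Let theta := start_mass n.+1 q.

Let rayleigh (j : nat) (t : T) : R := dotv (y j) (M t *m y j).

Let m_rayleigh j :
  measurable_fun [set: g_sigma_algebraType G] (rayleigh j : g_sigma_algebraType G -> R).
Proof.
pose T' := g_sigma_algebraType G.
apply: (@measurable_dotv R _ T' n.+1 (fun=> y j) (fun t : T' => M t *m y j)).
  exact: measurable_cst.
by apply: (@measurable_mulmx R _ T' _ _ _ M (fun=> y j)).
Qed.

(** The slack [1/(m+1)] is there because no rational direction need attain the supremum of the
    Rayleigh quotients. *)
Let near_best (m j : nat) : set T :=
  \bigcap_i [set t | rayleigh i t <= rayleigh j t + m.+1%:R^-1].

Let near_best_meas m j : <<s G >> (near_best m j).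
Proof.
suff : measurable (near_best m j : set (g_sigma_algebraType G)) by [].
apply: bigcapT_measurable => i.
rewrite -[X in measurable X]setTI.
have mb : measurable_fun [set: g_sigma_algebraType G]
    (fun t : g_sigma_algebraType G => rayleigh i t <= rayleigh j t + m.+1%:R^-1).
  apply: measurable_fun_ler; first exact: m_rayleigh.
  by apply: measurable_funD; [exact: m_rayleigh|exact: measurable_cst].
by have := mb measurableT [set true]; apply.
Qed.

(* Taking the first such direction partitions the sample space into events of
   the past, on each of which the direction is constant. *)
Let first_best (m j : nat) : set T := seqDU (near_best m) j.

Let first_best_meas m j : <<s G >> (first_best m j).
Proof.
suff : measurable (first_best m j : set (g_sigma_algebraType G)) by [].
apply: measurableD; first exact: near_best_meas.
by apply: bigsetU_measurable => i _; exact: near_best_meas.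
Qed.

Let cap (j : nat) : set (borel_mx R n.+1 1) := [set x | dotv (y j) x ^+ 2 < theta].

Let cap_meas j : measurable (cap j).
Proof.
have mb : measurable_fun [set: borel_mx R n.+1 1]
    (fun x : borel_mx R n.+1 1 => dotv (y j) x ^+ 2 < theta).
  apply: (measurable_fun_ltr (g := cst theta)) => //; apply: measurable_funX.
  apply: (measurable_dotv (f := fun=> y j)
    (g := fun x : borel_mx R n.+1 1 => x : 'cV[R]_n.+1)); first exact: measurable_cst.
  exact: measurable_id.
by have := mb measurableT [set true]; rewrite setTI; apply.
Qed.

Let capw_meas j : measurable (w @^-1` cap j).
Proof.
by have [mw _ _] := w_unif; rewrite -[X in measurable X]setTI; exact: mw.
Qed.

Let bad (m : nat) : set T := \bigcup_j (first_best m j `&` (w @^-1` cap j)).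

Let bad_meas m : measurable (bad m).
Proof.
apply: bigcupT_measurable => j; apply: measurableI => //.
exact: (G_meas (first_best_meas m j)).
Qed.

(** On each piece the direction is fixed, so independence and anticoncentration give at most [q]
    times the probability of the piece; the pieces are disjoint. *)
Let bad_prob m : (P (bad m) <= q%:E)%E.
Proof.
have q0 : 0 <= q by case/andP: q_bnd => /ltW.
have triv : trivIset setT (first_best m) by exact: trivIset_seqDU.
have mf j : measurable (first_best m j) by exact: (G_meas (first_best_meas m j)).
rewrite /bad measure_bigcup//; last 2 first.
- by move=> j _; exact: measurableI.
- exact: trivIset_setIr triv.
apply: (@le_trans _ _ (\sum_(0 <= j <oo | j \in setT) (q%:E * P (first_best m j)))%E).
  apply: lee_nneseries => // j _.
  apply: (@le_trans _ _ (P (first_best m j) * P (w @^-1` cap j))%E).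
    by rewrite -(w_indep (cap_meas j) (first_best_meas m j)).
  rewrite muleC; apply: lee_wpmul2r => //.
  exact: anticoncentration (enorm_rational_direction _) q_bnd.
rewrite nneseriesZl//.
rewrite -[leRHS]mule1; apply: lee_wpmul2l; first by rewrite lee_fin.
rewrite -measure_bigcup//; apply: probability_le1.
by apply: bigcupT_measurable.
Qed.

(** [E] is the lower limit of the events [bad m]: an increasing union of sets, each inside some
    [bad N], so its probability stays at most [q], which a plain union would not give. Outside [E],
    infinitely many [m] are not bad, and these supply directions of any precision. *)
Lemma start_probability : exists E : set T,
  [/\ measurable E, (P E <= q%:E)%E &
    forall t, ~ E t -> enorm (w t) = 1 -> good_start (M t) (w t) theta].
Proof.
have [q0 q1] := andP q_bnd.
pose U (N : nat) := \bigcap_(m in [set m | (N <= m)%N]) bad m.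
have mU N : measurable (U N) by apply: bigcap_measurableType.
exists (\bigcup_N U N); split.
- exact: bigcupT_measurable.
- have ndU : nondecreasing_seq U.
    move=> a b ab; apply/subsetPset => t Ut m /= bm; apply: Ut.
    exact: leq_trans ab bm.
  have cv := @nondecreasing_cvg_mu _ _ _ P U mU (bigcupT_measurable U mU) ndU.
  rewrite -(cvg_lim (@ereal_hausdorff R) cv); apply: lime_le.
    by apply/cvg_ex; exists (P (\bigcup_N U N)).
  apply: nearW => N; apply: le_trans (bad_prob N).
  apply: le_measure; rewrite ?inE//.
  by move=> t; apply => /=.
move=> t nE w1; apply: good_start_limit => //.
  by have /andP[] := start_mass_bnd (ltn0Sn n) q_bnd.
move=> e e0; pose N := `|Num.floor (e^-1)|%N.
have Ne : N.+1%:R^-1 <= e.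
  rewrite -[leRHS]invrK lef_pV2 ?posrE ?invr_gt0//.
  rewrite -[leRHS]natr1 natr_absz ger0_norm ?floor_ge0 ?invr_ge0 ?(ltW e0)//.
  by have := floorD1_gt (e^-1); rewrite intrD => /ltW.
have [m Nm nbad] : exists2 m, (N <= m)%N & ~ bad m t.
  apply: contra_notP nE => h; exists N => // m /= Nm.
  by apply: contrapT => nb; apply: h; exists m.
have me : m.+1%:R^-1 <= e.
  by apply: le_trans Ne; rewrite lef_pV2 ?posrE ?ltr0n// ler_nat.
have [j fj] : exists j, first_best m j t.
  have : (\bigcup_j near_best m j) t.
    have [Z [l HO']] := spectral_theorem (M_psd t).1.
    have HO : eigenbasis Z l (M t) := HO'.
    have [i0 i0P] : exists i0, forall i, l 0 i <= l 0 i0.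
      exists [arg max_(i > ord0) l 0 i]%O => i.
      by case: Order.TotalTheory.arg_maxP => // j _; apply.
    have m0 : 0 < m.+1%:R^-1 :> R by rewrite invr_gt0.
    have [j jE] := rational_direction_dense i0 (M_psd t) HO m0.
    exists j => // i _ /=; move: jE; rewrite lerBlDr; apply: le_trans.
    rewrite /rayleigh (dotv_ecoord HO) -[leRHS]mulr1.
    rewrite -(enorm_eq1 (@enorm_rational_direction R n i)) -(sum_ecoord_sqr HO) mulr_sumr.
    apply: ler_sum => h _; rewrite (ecoordM HO) mulrCA -expr2.
    by rewrite ler_wpM2r ?sqr_ge0.
  by rewrite (seqDU_bigcup_eq (near_best m)) => -[j _ fj]; exists j.
exists (y j); split; first exact: enorm_rational_direction.
  move=> i; have [nb _] := fj; apply: le_trans (nb i I) _.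
  by rewrite lerD2l.
rewrite leNgt; apply/negP => lt; apply: nbad; exists j => //.
Qed.

End StartProbability.

(** * Running time *)

Section LogBounds.
Context {R : realType}.

Lemma ln_le (x : R) : 0 < x -> ln x <= x.
Proof.
have -> : x = 1 + (x - 1) by ring.
move=> x0; apply: le_trans (le_ln1Dx _) _; lra.
Qed.

Lemma ln_nat_le (m : nat) : ln m%:R <= m%:R :> R.
Proof.
case: m => [|m]; first by rewrite ln0.
by rewrite ln_le ?ltr0n.
Qed.

Lemma ln_mul3 (a b c : R) : 0 < a -> 0 < b -> 0 < c ->
  ln (a * b * c) = ln a + ln b + ln c.
Proof. by move=> *; rewrite !lnM ?posrE ?mulr_gt0. Qed.

Lemma ln_mul2 (a b : R) : 0 < a -> 0 < b -> ln (a * b) = ln a + ln b.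
Proof. by move=> *; rewrite lnM. Qed.

Lemma ln_exp (a : R) m : 0 < a -> ln (a ^+ m) = m%:R * ln a.
Proof. by move=> a0; rewrite lnXn// mulr_natl. Qed.

Lemma polylogE (q : nat) (xs : seq R) : polylog q xs = polylog 1 xs ^+ q.
Proof.
by rewrite /polylog prodrXl; congr (_ ^+ _); apply: eq_bigr => x _.
Qed.

Lemma polylog1_ge1 (xs : seq R) : 1 <= polylog 1 xs.
Proof.
rewrite /polylog; elim/big_ind: _ => // [x y x1 y1|x _].
  by apply: (le_trans x1); rewrite ler_peMr//; apply: le_trans x1.
by rewrite expr1 lerDl le_max lexx.
Qed.

Lemma polylog1_ge (xs : seq R) x : x \in xs -> ln x <= polylog 1 xs.
Proof.
elim: xs => // y xs IH; rewrite inE /polylog big_cons -/(polylog 1 xs) expr1.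
have h1 := polylog1_ge1 xs; have h0 : 0 <= Num.max 0 (ln y) by rewrite le_max lexx.
case/predU1P => [->|/IH h].
  apply: le_trans (_ : 1 + Num.max 0 (ln y) <= _); last by rewrite ler_peMr//; lra.
  by have : ln y <= Num.max 0 (ln y); [rewrite le_max lexx orbT|lra].
by apply: le_trans h _; rewrite ler_peMl//; lra.
Qed.

(** The arithmetic is separated from the logarithms, which appear here as variables. Constants are
    generous since [ln 288] is merely bounded by 288. *)
Let m1_arith (a b c Lm : R) : 1 <= Lm -> b <= Lm -> c <= 2 * Lm -> a <= 288 ->
  4 * (a + b + 2 * c) + 1 <= 1200 * Lm.
Proof. lra. Qed.

Let m2_arith (a b c e Lm : R) : 1 <= Lm -> b <= Lm -> c <= 2 * Lm ->
  e <= 16 + 14 * Lm -> a <= 36 -> a + b + 2 * c + e + 1 <= 100 * Lm.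
Proof. lra. Qed.

Let fuel_arith (a b c Lm : R) : b <= Lm -> c <= 2 * Lm -> a <= 9 ->
  a + b + 2 * c <= 9 + 5 * Lm.
Proof. lra. Qed.

Let fuel_arith2 (a Lm : R) : 1 <= Lm -> a <= 9 + 5 * Lm -> 4 * a + 1 <= 100 * Lm.
Proof. lra. Qed.

Let calls_arith (f m1 m2 Lm : R) : 1 <= Lm -> f <= 100 * Lm -> m1 <= 1200 * Lm ->
  m2 <= 100 * Lm -> 0 <= m1 ->
  (f + 1) * (m1 + 1) + m2 <= (101 * 1201 + 100) * Lm ^+ 2.
Proof.
move=> L1 fl ml m2l m10.
have f1 : f + 1 <= 101 * Lm by lra.
have m11 : m1 + 1 <= 1201 * Lm by lra.
have L2 : Lm <= Lm ^+ 2 by rewrite expr2 ler_peMl//; lra.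
have h1 : (f + 1) * (m1 + 1) <= 101 * Lm * (m1 + 1) by rewrite ler_wpM2r//; lra.
have h2 : 101 * Lm * (m1 + 1) <= 101 * Lm * (1201 * Lm) by rewrite ler_wpM2l//; lra.
have -> : (101 * 1201 + 100) * Lm ^+ 2 = 101 * Lm * (1201 * Lm) + 100 * Lm ^+ 2 by ring.
lra.
Qed.

Let ratio_arith (gap lam l1 : R) : 0 < gap -> gap < 1 -> 0 < l1 ->
  gap / 2 * l1 / 12 <= lam - l1 -> lam * gap <= 25 * (lam - l1).
Proof.
move=> g0 g1 l0 h.
have d0 : 0 <= lam - l1 by apply: le_trans h; rewrite !mulr_ge0// ?invr_ge0// ltW.
have : (lam - l1) * gap <= (lam - l1) * 1 by rewrite ler_wpM2l// ltW.
have -> : lam * gap = (lam - l1) * gap + gap * l1 by ring.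
move: h; rewrite -[gap / 2 * l1]mulrAC; move: (_ * gap) (gap * l1) => u v; lra.
Qed.

Let tol1_arith (m y z Lm : R) : 1 <= Lm -> m <= 1200 * Lm -> z <= 12 + Lm ->
  y <= 64 * m -> 0 <= m -> y + m * z <= 1200 * 77 * Lm ^+ 2.
Proof.
move=> L1 mL zL ym m0.
have h1 : m * z <= m * (12 + Lm) by rewrite ler_wpM2l.
have a2 : 76 + Lm <= 77 * Lm by lra.
have h2 : m * (76 + Lm) <= m * (77 * Lm) by rewrite ler_wpM2l.
have h3 : m * (77 * Lm) <= 1200 * Lm * (77 * Lm) by rewrite ler_wpM2r//; lra.
have -> : 1200 * 77 * Lm ^+ 2 = 1200 * Lm * (77 * Lm) by ring.
lra.
Qed.

Let tol2_arith (m y z e Lm : R) : 1 <= Lm -> m <= 100 * Lm -> z <= 12 + Lm ->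
  e <= 16 + 14 * Lm -> y <= 8 * m -> 0 <= m ->
  y + e + m * z <= 1200 * 77 * Lm ^+ 2.
Proof.
move=> L1 mL zL eL ym m0.
have h1 : m * z <= m * (12 + Lm) by rewrite ler_wpM2l.
have a2 : 20 + Lm <= 21 * Lm by lra.
have h2 : m * (20 + Lm) <= m * (21 * Lm) by rewrite ler_wpM2l.
have h3 : m * (21 * Lm) <= 100 * Lm * (21 * Lm) by rewrite ler_wpM2r//; lra.
have L2 : Lm <= Lm ^+ 2 by rewrite expr2 ler_peMl//; lra.
have h4 : 100 * Lm * (21 * Lm) = 2100 * Lm ^+ 2 by ring.
lra.
Qed.

Let accuracy_arith (r t Lm : R) : 1 <= Lm -> r <= 25 + Lm -> t <= 1200 * 77 * Lm ^+ 2 ->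
  Num.max 1 (r + t) <= (1200 * 77 + 26) * Lm ^+ 2.
Proof.
move=> L1 rL tL; have L2 : Lm <= Lm ^+ 2 by rewrite expr2 ler_peMl//; lra.
by rewrite ge_max; apply/andP; split; lra.
Qed.

Context (d k : nat) (gap eps p s1 sk Lm : R).
Hypothesis k_bnd : (0 < k <= d)%N.
Hypothesis gap_bnd : 0 < gap < 1.
Hypothesis eps_gt0 : 0 < eps.
Hypothesis p_bnd : 0 < p < 1.
Hypothesis s1_gt0 : 0 < s1.
Hypothesis sk_bnd : 0 < sk <= 1.
Hypothesis Lm_ge1 : 1 <= Lm.
Hypothesis Lm_gap : ln gap^-1 <= Lm.
Hypothesis Lm_eps : ln eps^-1 <= Lm.
Hypothesis Lm_p : ln p^-1 <= Lm.
Hypothesis Lm_d : ln d%:R <= Lm.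
Hypothesis Lm_k : ln k%:R <= Lm.
Hypothesis Lm_s1 : ln s1^-1 <= Lm.
Hypothesis Lm_s1k : ln (s1 / sk) <= Lm.

Let eta := 16^-1 * (eps ^+ 4 * gap ^+ 2 / (k%:R ^+ 4 * (s1 / sk) ^+ 4)).
Hypothesis eta_bnd : 0 < eta < 1.

Let q := p / k%:R.
Let delta := gap / 2.

(** From [(3/4)^f <= e^(-f/4) <= gap sk^2 / 9], multiplied by 3/2, one gets the fuel condition at
    the smallest possible top eigenvalue [sk^2]. *)
Definition pass_bound : nat := `|Num.ceil (4 * ln (9 / (gap * sk ^+ 2)))|%N.

Let k0 : 0 < k%:R :> R. Proof. by rewrite ltr0n; case/andP: k_bnd. Qed.
Let d0 : 0 < d%:R :> R.
Proof. by rewrite ltr0n; case/andP: k_bnd => ? ?; apply: leq_trans; eassumption. Qed.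
Let p0 : 0 < p. Proof. by case/andP: p_bnd. Qed.
Let gap0 : 0 < gap. Proof. by case/andP: gap_bnd. Qed.
Let sk_gt0 : 0 < sk. Proof. by case/andP: sk_bnd. Qed.
Let q_bnd : 0 < q < 1.
Proof.
have k1 : 1 <= k%:R :> R by rewrite ler1n; case/andP: k_bnd.
case/andP: p_bnd => ? ?.
by rewrite divr_gt0//= ltr_pdivrMr; lra.
Qed.
Let q0 : 0 < q. Proof. by case/andP: q_bnd. Qed.
Let dn0 : (0 < d)%N. Proof. by rewrite -(ltr0n R). Qed.

Let ln_q : ln q^-1 <= 2 * Lm.
Proof.
have -> : ln q^-1 = ln k%:R + ln p^-1 by rewrite /q invf_div lnM ?posrE ?invr_gt0.
move: Lm_k Lm_p; move: (ln k%:R) (ln p^-1) => a b; lra.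
Qed.

(** The inverse of [sigma_k] is not among the quantities whose logarithms are hidden; it is the
    product of two that are. *)
Let ln_sk : ln sk^-1 <= 2 * Lm.
Proof.
have -> : sk^-1 = s1^-1 * (s1 / sk) by rewrite mulrA mulVf ?mul1r// gt_eqF.
have -> : ln (s1^-1 * (s1 / sk)) = ln s1^-1 + ln (s1 / sk).
  by rewrite [LHS]lnM ?posrE ?invr_gt0 ?divr_gt0//.
move: Lm_s1 Lm_s1k; move: (ln s1^-1) (ln (s1 / sk)) => a b; lra.
Qed.

Let ln_eta : ln eta^-1 <= 16 + 14 * Lm.
Proof.
have -> : eta^-1 = 16 * (eps^-1 ^+ 4 * gap^-1 ^+ 2 * k%:R ^+ 4 * (s1 / sk) ^+ 4).
  rewrite /eta; field; rewrite !gt_eqF//.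
have e0 : 0 < eps^-1 by rewrite invr_gt0.
have g0 : 0 < gap^-1 by rewrite invr_gt0.
have r0 : 0 < s1 / sk by rewrite divr_gt0.
have -> : ln (16 * (eps^-1 ^+ 4 * gap^-1 ^+ 2 * k%:R ^+ 4 * (s1 / sk) ^+ 4)) =
    ln 16 + (4 * ln eps^-1 + 2 * ln gap^-1 + 4 * ln k%:R + 4 * ln (s1 / sk)).
  have pw (x : R) m : 0 < x -> 0 < x ^+ m by exact: exprn_gt0.
  have p3 : 0 < eps^-1 ^+ 4 * gap^-1 ^+ 2 * k%:R ^+ 4 by rewrite mulr_gt0 ?pw// mulr_gt0 ?pw.
  have p4 : 0 < eps^-1 ^+ 4 * gap^-1 ^+ 2 * k%:R ^+ 4 * (s1 / sk) ^+ 4.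
    by rewrite mulr_gt0 ?pw.
  by rewrite (ln_mul2 _ p4)// (ln_mul2 p3) ?pw// ln_mul3 ?pw// !ln_exp.
have := ln_nat_le 16.
  move: Lm_eps Lm_gap Lm_k Lm_s1k; move: (ln 16) (ln eps^-1) (ln gap^-1) (ln k%:R) (ln (s1 / sk)) => a b c e f; lra.
Qed.

Let ln_gap12 : ln (12 / gap) <= 12 + Lm.
Proof.
have -> : ln (12 / gap) = ln 12 + ln gap^-1 by rewrite lnM ?posrE ?invr_gt0.
have := ln_nat_le 12.
  move: Lm_gap; move: (ln 12) (ln gap^-1) => a b; lra.
Qed.

Lemma pass_bound_enough : (3 / 4) ^+ pass_bound * (3 / 2) <= gap / 2 * sk ^+ 2 / 3.
Proof.
have x0 : 0 < gap * sk ^+ 2 by rewrite mulr_gt0// exprn_gt0.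
set y := 9 / (gap * sk ^+ 2); have y0 : 0 < y by rewrite divr_gt0.
have le1 : 0 <= (3 / 4 : R) <= expR (- (1 / 4)).
  by apply/andP; split; [lra|]; apply: le_trans (expR_ge1Dx _); lra.
have h := exprz_le_expRN pass_bound le1.
have : (3 / 4) ^+ pass_bound <= y^-1.
  apply: le_trans h _; apply: expRN_le_inv => //.
  have [ny|] := leP 0 (4 * ln y); last first.
    move=> neg; apply: (@le_trans _ _ 0); first by lra.
    by rewrite mulr_ge0.
  have := abs_ceil_ge ny; rewrite -/pass_bound; move: (ln y) (pass_bound%:R) => a b; lra.
have -> : y^-1 = gap * sk ^+ 2 / 9 by rewrite /y invf_div.
move: ((3 / 4) ^+ _) {h} => a; lra.
Qed.

Let m1_le : (pca_m1 d q)%:R <= 1200 * Lm.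
Proof.
have [_ _ h] := pca_m1_bnd dn0 q_bnd; apply: le_trans h _.
have -> : 288 * d%:R / q ^+ 2 = 288 * d%:R * q^-1 ^+ 2 by rewrite exprVn.
have iq : 0 < q^-1 by rewrite invr_gt0.
have p288 : 0 < 288 :> R by rewrite ltr0n.
have -> : ln (288 * d%:R * q^-1 ^+ 2) = ln 288 + ln d%:R + 2 * ln q^-1.
  by rewrite ln_mul3 ?exprn_gt0// ln_exp.
exact: m1_arith Lm_ge1 Lm_d ln_q (ln_nat_le 288).
Qed.

Let m2_le : (pca_m2 d eta q)%:R <= 100 * Lm.
Proof.
have [_ _ h] := pca_m2_bnd dn0 eta_bnd q_bnd; apply: le_trans h _.
have e0 : 0 < eta^-1 by rewrite invr_gt0; case/andP: eta_bnd.
have -> : 36 * d%:R / (q ^+ 2 * eta) = 36 * d%:R * q^-1 ^+ 2 * eta^-1.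
  by rewrite exprVn invfM !mulrA.
have iq : 0 < q^-1 by rewrite invr_gt0.
have p36 : 0 < 36 :> R by rewrite ltr0n.
have -> : ln (36 * d%:R * q^-1 ^+ 2 * eta^-1) =
    ln 36 + ln d%:R + 2 * ln q^-1 + ln eta^-1.
  have p3 : 0 < 36 * d%:R * q^-1 ^+ 2 by rewrite mulr_gt0 ?exprn_gt0// mulr_gt0.
  by rewrite (ln_mul2 p3 e0) ln_mul3 ?exprn_gt0// ln_exp.
exact: m2_arith Lm_ge1 Lm_d ln_q ln_eta (ln_nat_le 36).
Qed.

Let fuel_le : pass_bound%:R <= 100 * Lm.
Proof.
have x0 : 0 < gap * sk ^+ 2 by rewrite mulr_gt0// exprn_gt0.
set y := 9 / (gap * sk ^+ 2).
have lny : ln y <= 9 + 5 * Lm.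
  have -> : y = 9 * gap^-1 * sk^-1 ^+ 2 by rewrite /y exprVn invfM mulrA.
  have ig : 0 < gap^-1 by rewrite invr_gt0.
  have ik : 0 < sk^-1 by rewrite invr_gt0.
  have -> : ln (9 * gap^-1 * sk^-1 ^+ 2) = ln 9 + ln gap^-1 + 2 * ln sk^-1.
    by rewrite ln_mul3 ?exprn_gt0// ln_exp.
  exact: fuel_arith Lm_gap ln_sk (ln_nat_le 9).
have ny : 0 <= 4 * ln y.
  rewrite mulr_ge0// ln_ge0// ler_pdivlMr// mul1r.
  have := gap_bnd; have := sk_bnd; move=> /andP[s0 sk1] /andP[g0 g1].
  have : sk ^+ 2 <= 1 by rewrite exprn_ile1// ltW.
  by have := exprn_gt0 2 s0; nra.
by apply: le_trans (abs_ceil_le ny) _; move: Lm_ge1 lny; exact: fuel_arith2.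
Qed.

Definition calls_const : R := 101 * 1201 + 100.

Definition accuracy_const : R := 1200 * 77 + 26.

Lemma round_calls_le : (round_calls (d := d) k eta p pass_bound)%:R <= calls_const * Lm ^+ 2.
Proof.
rewrite /round_calls natrD natrM -!natr1.
exact: calls_arith Lm_ge1 fuel_le m1_le m2_le (ler0n _ _).
Qed.

(** [lam = (lam - l1) + l1] with [l1 <= 24 (lam - l1) / gap] and [gap < 1]. *)
Lemma ratio_le lam l1 : 0 < l1 -> gap / 2 * l1 / 12 <= lam - l1 ->
  lam / (lam - l1) <= 25 / gap.
Proof.
move=> l10 h; have /andP[_ g1] := gap_bnd.
have g0 : 0 < lam - l1 by apply: lt_le_trans h; rewrite !mulr_gt0 ?invr_gt0.
rewrite ler_pdivrMr// mulrAC ler_pdivlMr//.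
exact: ratio_arith gap0 g1 l10 h.
Qed.

(** The tolerance is essentially [(gap / 12)^m1]; both [m1] and [ln (12 / gap)] are linear in [Lm],
    whence the square. *)
Let ln_tol1 : ln (pca_tol1 d delta q)^-1 <= 1200 * 77 * Lm ^+ 2.
Proof.
have [m0 _ _] := pca_m1_bnd dn0 q_bnd.
have g12 : 0 < 12 / gap by rewrite divr_gt0.
have m64 : 0 < 64 * (pca_m1 d q)%:R :> R by rewrite mulr_gt0// ltr0n.
have -> : (pca_tol1 d delta q)^-1 = 64 * (pca_m1 d q)%:R * (12 / gap) ^+ pca_m1 d q.
  rewrite /pca_tol1 invfM invrK -exprVn; congr (_ * _ ^+ _).
  by rewrite /delta; field; rewrite gt_eqF.
rewrite (ln_mul2 m64) ?exprn_gt0// ln_exp//.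
exact: tol1_arith Lm_ge1 m1_le ln_gap12 (ln_le m64) (ler0n _ _).
Qed.

Let ln_tol2 : ln (pca_tol2 d delta eta q)^-1 <= 1200 * 77 * Lm ^+ 2.
Proof.
have [m0 _ _] := pca_m2_bnd dn0 eta_bnd q_bnd; have /andP[e0 _] := eta_bnd.
have g12 : 0 < 12 / gap by rewrite divr_gt0.
have m8 : 0 < 8 * (pca_m2 d eta q)%:R :> R by rewrite mulr_gt0// ltr0n.
have ie : 0 < eta^-1 by rewrite invr_gt0.
have -> : (pca_tol2 d delta eta q)^-1 =
    8 * (pca_m2 d eta q)%:R * eta^-1 * (12 / gap) ^+ pca_m2 d eta q.
  rewrite /pca_tol2 invfM invf_div -exprVn; congr (_ * _ ^+ _).
  by rewrite /delta; field; rewrite gt_eqF.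
rewrite ln_mul3 ?exprn_gt0// ln_exp//.
exact: tol2_arith Lm_ge1 m2_le ln_gap12 ln_eta (ln_le m8) (ler0n _ _).
Qed.

Lemma log_accuracy_le lam l1 tol : 0 < l1 -> gap / 2 * l1 / 12 <= lam - l1 ->
  tol = pca_tol1 d delta q \/ tol = pca_tol2 d delta eta q ->
  0 < tol /\ log_accuracy lam (lam - l1) tol <= accuracy_const * Lm ^+ 2.
Proof.
move=> l10 h tolE; have /andP[_ g1] := gap_bnd.
have g0 : 0 < lam - l1 by apply: lt_le_trans h; rewrite !mulr_gt0 ?invr_gt0.
have lam0 : 0 < lam by rewrite -(subrK l1 lam) addr_gt0.
have de2 : 0 < delta <= 1 / 2.
  by rewrite /delta divr_gt0//= ler_pM2r ?invr_gt0// ltW.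
have [tol0 ltol] : 0 < tol /\ ln tol^-1 <= 1200 * 77 * Lm ^+ 2.
  case: tolE => ->; split=> //.
    exact: pca_tol1_gt0.
  exact: pca_tol2_gt0.
split=> //.
have r0 : 0 < lam / (lam - l1) by rewrite divr_gt0.
have E : ln (lam / ((lam - l1) * tol)) = ln (lam / (lam - l1)) + ln tol^-1.
  by rewrite invfM mulrA ln_mul2// invr_gt0.
have rle : ln (lam / (lam - l1)) <= 25 + Lm.
  have r25 : 0 < 25 / gap by rewrite divr_gt0.
  apply: (@le_trans _ _ (ln (25 / gap))).
    by rewrite ler_ln ?posrE//; exact: ratio_le.
  rewrite ln_mul2 ?invr_gt0 ?ltr0n//; apply: lerD Lm_gap.
  exact: (ln_nat_le 25).
rewrite /log_accuracy (mulrC tol) E; exact: accuracy_arith Lm_ge1 rle ltol.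
Qed.

End LogBounds.

Lemma sumr_calls_le (R : realType) (d : nat) (P : call R d -> Prop)
    (f : call R d -> R) (B : R) (tr : seq (call R d)) :
  all_calls P tr -> (forall c, P c -> f c <= B) ->
  \sum_(c <- tr) f c <= (size tr)%:R * B.
Proof.
move=> h fB; elim: tr h => [|c tr IH] /=; first by rewrite big_nil mul0r.
move=> [Pc Ptr]; rewrite big_cons -natr1 mulrDl mul1r addrC.
by apply: lerD; [exact: IH | exact: fB].
Qed.

Lemma apply_timeE (R : realType) (d n : nat) (K : R) (A : 'M[R]_(d, n)) j :
  apply_time K A j = K * (nnz A)%:R + j%:R * (K * d%:R).
Proof.
elim: j => [|j IH] /=; first by rewrite mul0r addr0.
by rewrite IH -addrA -natr1 mulrDl mul1r.
Qed.

(** The squared norms differ by [(2 - |v|^2) <v, a>^2]. The weak hypothesis covers both unit vectors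
    and the zero vector that [normalize] returns at 0. *)
Lemma enorm_deflate_le (R : realType) (d : nat) (v a : 'cV[R]_d) :
  dotv v v <= 2 -> enorm ((1%:M - v *m v^T) *m a) <= enorm a.
Proof.
move=> v2; rewrite enorm_le ?enorm_ge0// enorm_sqr mulmxBl mul1mx outer_mulmx.
rewrite dotvBl !dotvBr !dotvZl !dotvZr (dotvC a v).
have := sqr_ge0 (dotv v a); move: (dotv v a) (dotv a a) v2 => x y.
move: (dotv v v) => z z2; rewrite expr2 => x2.
have : x * x * z <= x * x * 2 by rewrite ler_wpM2l.
have -> : x * (x * z) = x * x * z by rewrite mulrA.
move: (x * x) => X; lra.
Qed.

Lemma normalize_dotv_le (R : realType) (d : nat) (x : 'cV[R]_d) :
  dotv (normalize x) (normalize x) <= 2.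
Proof.
rewrite -enorm_sqr; have [->|/enorm_normalize ->] := eqVneq x 0.
  by rewrite /normalize scaler0 (_ : enorm 0 = 0) ?expr0n//; apply/eqP; rewrite enorm_eq0.
by rewrite expr1n ler1n.
Qed.

Lemma average_outer_deflate (R : realType) (d n : nat) (a : 'I_n -> 'cV[R]_d) v :
  deflate (average_outer a) v =
  average_outer (fun i => (1%:M - v *m v^T) *m a i).
Proof.
have T : (1%:M - v *m v^T)^T = 1%:M - v *m v^T by rewrite linearB/= trmx1 trmx_mul trmxK.
rewrite /deflate /average_outer -scalemxAr -scalemxAl; congr (_ *: _).
rewrite mulmx_sumr mulmx_suml; apply: eq_bigr => i _.
by rewrite trmx_mul T !mulmxA.
Qed.

(** Deflation acts on the vectors [a_i] themselves, so each round stays in the stochastic setting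
    whether or not the starts are good. *)
Lemma svd_mx_average (R : realType) (d n : nat) (A : inversion_method R d)
    (a : 'I_n -> 'cV[R]_d) k delta eps p fuel w0 s :
  (forall i, enorm (a i) <= 1) ->
  exists2 b : 'I_n -> 'cV[R]_d, forall i, enorm (b i) <= 1 &
    svd_mx A (average_outer a) k delta eps p fuel w0 s = average_outer b.
Proof.
move=> a1; elim: s => [|s [b b1 E]]; first by exists a.
have [v v2 vE] : exists2 v, dotv v v <= 2 &
    svd_mx A (average_outer a) k delta eps p fuel w0 s.+1 =
    deflate (svd_mx A (average_outer a) k delta eps p fuel w0 s) v.
  rewrite {1}/svd_mx svd_stateS; eexists; last by [].
  exact: normalize_dotv_le.
exists (fun i => (1%:M - v *m v^T) *m b i); last by rewrite vE E average_outer_deflate.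
by move=> i; apply: le_trans (b1 i); exact: enorm_deflate_le.
Qed.

Lemma svd_mx_possemidef (R : realType) (d : nat) (A : inversion_method R d)
    (M : 'M[R]_d) k delta eps p fuel w0 s : possemidef M ->
  possemidef (svd_mx A M k delta eps p fuel w0 s).
Proof.
move=> psd; elim: s => [|s IH] //.
by rewrite {1}/svd_mx svd_stateS; exact: deflate_possemidef.
Qed.

(** * Cost of a run *)

Section Costs.
Context {R : realType}.
Context (d n k : nat) (gap eps p s1 sk Lm K : R).
Hypothesis K_gt0 : 0 < K.
Hypothesis k_bnd : (0 < k <= d)%N.
Hypothesis gap_bnd : 0 < gap < 1.
Hypothesis eps_gt0 : 0 < eps.
Hypothesis p_bnd : 0 < p < 1.
Hypothesis s1_gt0 : 0 < s1.
Hypothesis sk_bnd : 0 < sk <= 1.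
Hypothesis Lm_ge1 : 1 <= Lm.
Hypothesis Lm_gap : ln gap^-1 <= Lm.
Hypothesis Lm_eps : ln eps^-1 <= Lm.
Hypothesis Lm_p : ln p^-1 <= Lm.
Hypothesis Lm_d : ln d%:R <= Lm.
Hypothesis Lm_k : ln k%:R <= Lm.
Hypothesis Lm_s1 : ln s1^-1 <= Lm.
Hypothesis Lm_s1k : ln (s1 / sk) <= Lm.

Let eta := 16^-1 * (eps ^+ 4 * gap ^+ 2 / (k%:R ^+ 4 * (s1 / sk) ^+ 4)).
Hypothesis eta_bnd : 0 < eta < 1.

Let fuel := pass_bound gap sk.
Context (A : 'M[R]_(d, n)) (inv : inversion_method R d) (w0 : nat -> 'cV[R]_d).
Hypothesis AA_psd : possemidef (A *m A^T).
Context (tr : seq (call R d)).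
Hypothesis tr_calls :
  all_calls (svd_call inv (A *m A^T) k gap eta p (sk ^+ 2) fuel w0) tr.
Hypothesis tr_size : (size tr <= k * round_calls (d := d) k eta p fuel)%N.

Local Notation mx := (svd_mx inv (A *m A^T) k gap eta p fuel w0).
Local Notation acc := (@accuracy_const R).
Local Notation cc := (@calls_const R).

Let gap0 : 0 < gap. Proof. by case/andP: gap_bnd. Qed.
Let sk_gt0 : 0 < sk. Proof. by case/andP: sk_bnd. Qed.

(** The witness [g = lam - l1] is a spectral margin: [lam - M_j - g] is [l1 - M_j], which is
    positive semidefinite. *)
Let call_bounds c :
  svd_call inv (A *m A^T) k gap eta p (sk ^+ 2) fuel w0 c ->
  exists j g, [/\ (j < k)%N /\ call_round c = j.+1, call_mx c = mx j,
    [/\ 0 < call_lambda c, 0 < g & 0 < call_tol c],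
    possemidef (call_mx c) /\
      possemidef ((call_lambda c)%:M - call_mx c - g%:M)
  & [/\ call_lambda c / g <= 25 / gap,
        log_accuracy (call_lambda c) g (call_tol c) <= acc * Lm ^+ 2
      & sk ^+ 2 <= call_lambda c]].
Proof.
move=> [j [l1 [jk cm [/andP[l1ge _] psd] /andP[gl _] tol]]].
have l10 : 0 < l1 by apply: lt_le_trans l1ge; rewrite exprn_gt0.
have g0 : 0 < call_lambda c - l1.
  by apply: lt_le_trans gl; rewrite !mulr_gt0 ?invr_gt0.
have [t0 la] := log_accuracy_le k_bnd gap_bnd eps_gt0 p_bnd s1_gt0 sk_bnd Lm_ge1
  Lm_gap Lm_eps Lm_p Lm_d Lm_k Lm_s1k eta_bnd l10 gl tol.
have ll : l1 <= call_lambda c by rewrite -subr_ge0 ltW.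
exists j, (call_lambda c - l1); split=> //.
- by split=> //; apply: lt_le_trans ll.
- split; first by rewrite cm; exact: svd_mx_possemidef.
  suff -> : (call_lambda c)%:M - call_mx c - (call_lambda c - l1)%:M = l1%:M - mx j by [].
  by rewrite cm raddfB /= opprB addrCA addrAC subrr add0r.
- by split=> //; [exact: ratio_le | exact: le_trans ll].
Qed.

Let calls_le : (size tr)%:R <= k%:R * (cc * Lm ^+ 2).
Proof.
apply: le_trans (_ : (k * round_calls (d := d) k eta p fuel)%:R <= _).
  by rewrite ler_nat.
rewrite natrM ler_wpM2l//.
exact: round_calls_le k_bnd gap_bnd eps_gt0 p_bnd s1_gt0 sk_bnd Lm_ge1 Lm_gap Lm_eps
  Lm_p Lm_d Lm_k Lm_s1 Lm_s1k eta_bnd.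
Qed.

(** One constant for both methods: [5 K^2 acc + K] is the coefficient of a call of gradient descent,
    [5 K acc + K] that of a call of SVRG, and [2 K] pays for the vector operations of the rounds. *)
Definition cost_const : R :=
  cc * (5 * K ^+ 2 * acc + 5 * K * acc + K) + 2 * K.

Let r := (Num.sqrt gap)^-1.

Let r_ge1 : 1 <= r.
Proof.
have /andP[_ g1] := gap_bnd.
rewrite /r invr_ge1 ?sqrtr_gt0// ?unitfE ?gt_eqF ?sqrtr_gt0//.
by rewrite -sqrtr1 ler_wsqrtr// ltW.
Qed.

Let acc_gt0 : 0 < acc.
Proof. by rewrite /accuracy_const; lra. Qed.

Let cc_gt0 : 0 < cc.
Proof. by rewrite /calls_const; lra. Qed.

Lemma cost_const_gt0 : 0 < cost_const.
Proof.
have K2 : 0 < K ^+ 2 by rewrite exprn_gt0.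
rewrite /cost_const addr_gt0 ?mulr_gt0// addr_gt0// addr_gt0// !mulr_gt0//.
Qed.

Let Lm_ge0 : 0 <= Lm. Proof. exact: le_trans ler01 Lm_ge1. Qed.

Let L2_ge1 : 1 <= Lm ^+ 2. Proof. exact: exprn_ege1. Qed.

Let sqrt25 : Num.sqrt (25 / gap) = 5 * r.
Proof.
rewrite sqrtrM ?ler0n// sqrtrV ?(ltW gap0)// (_ : 25 = 5 ^+ 2) ?sqrtr_sqr ?ger0_norm//.
by rewrite -natrX.
Qed.

Let sqrt_ratio (lam g : R) : 0 < lam -> 0 < g -> lam / g <= 25 / gap ->
  Num.sqrt lam / Num.sqrt g <= 5 * r.
Proof.
move=> lam0 g0 h; rewrite -sqrtrV ?(ltW g0)// -sqrtrM ?(ltW lam0)// -sqrt25.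
exact: ler_wsqrtr.
Qed.

(** Of order [k Lm^2] calls, each with a logarithmic factor [Lm^2]: this is where the exponent 4
    arises. *)
Let total_arith (B S2 N C X c0 : R) : 0 <= X -> 0 <= B ->
  N <= k%:R * (cc * Lm ^+ 2) -> k%:R * B <= c0 * X * Lm ^+ 2 ->
  S2 <= C * X -> 0 <= C -> 
  N * B + S2 <= (cc * c0 + C) * X * Lm ^+ 4.
Proof.
move=> X0 B0 NL BL SC C0.
have L4 : Lm ^+ 4 = Lm ^+ 2 * Lm ^+ 2 by rewrite -exprD.
have h1 : N * B <= k%:R * (cc * Lm ^+ 2) * B by rewrite ler_wpM2r.
have h2 : k%:R * B * (cc * Lm ^+ 2) <= c0 * X * Lm ^+ 2 * (cc * Lm ^+ 2).
  by rewrite ler_wpM2r// mulr_ge0 ?(ltW cc_gt0)// exprn_ge0.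
have CX : 0 <= C * X by rewrite mulr_ge0.
have h3 : C * X <= C * X * Lm ^+ 4.
  by rewrite ler_peMr// exprn_ege1.
have -> : (cc * c0 + C) * X * Lm ^+ 4 =
    c0 * X * Lm ^+ 2 * (cc * Lm ^+ 2) + C * X * Lm ^+ 4 by rewrite L4; ring.
apply: lerD; last exact: le_trans h3.
by apply: le_trans h1 _; rewrite mulrAC.
Qed.

Lemma agd_cost (tau : call R d -> R) : agd_time K A tau ->
  lazysvd_agd_time k K tau tr <=
    cost_const * ((k%:R * (nnz A)%:R + k%:R ^+ 2 * d%:R) / Num.sqrt gap) * Lm ^+ 4.
Proof.
move=> htau; have K2 : 0 < K ^+ 2 by rewrite exprn_gt0.
have k1 : 1 <= k%:R :> R by rewrite ler1n; case/andP: k_bnd.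
set S := (nnz A)%:R + k%:R * d%:R : R.
have S0 : 0 <= S by rewrite addr_ge0 ?mulr_ge0.
have dS : d%:R <= S by rewrite /S -[leLHS]add0r lerD// ler_peMl.
have rS0 : 0 <= r * S by rewrite mulr_ge0// ltW// (lt_le_trans ltr01).
have SrS : S <= r * S by rewrite ler_peMl.
set B := (5 * K ^+ 2 * acc + K) * (r * S) * Lm ^+ 2.
have B0 : 0 <= B.
  have c0 : 0 <= 5 * K ^+ 2 * acc + K by rewrite addr_ge0 ?(ltW K_gt0)// !mulr_ge0// ltW.
  by rewrite /B mulr_ge0 ?exprn_ge0// mulr_ge0.
have call_le c : svd_call inv (A *m A^T) k gap eta p (sk ^+ 2) fuel w0 c ->
    tau c + K * d%:R <= B.
  move=> /call_bounds[j [g [[jk cj] cm [lam0 g0 t0] [psd psd'] [rat la _]]]].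
  have [it [itl tl]] := htau c g lam0 g0 t0 psd psd'.
  (* Round [j + 1] multiplies by [A A^T] followed by [j] rank-one corrections; with the [O(d)] of an
     iteration this is at most [nnz A + k d] up to [K]. *)
  have work : K * d%:R + apply_time K A (call_round c).-1 <= K * S.
    rewrite cj /= apply_timeE /S.
    have -> : K * d%:R + (K * (nnz A)%:R + j%:R * (K * d%:R)) =
      K * (nnz A)%:R + K * (j.+1%:R * d%:R) by rewrite -natr1; ring.
    by rewrite mulrDr lerD2l ler_pM2l// ler_wpM2r// ler_nat.
  have iter : it%:R <= K * (5 * r) * (acc * Lm ^+ 2).
    apply: le_trans itl _; apply: ler_pM => //.
    - by rewrite mulr_ge0 ?(ltW K_gt0)// divr_ge0 ?sqrtr_ge0.
    - by rewrite /log_accuracy le_max ler01.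
    - by rewrite ler_pM2l//; exact: sqrt_ratio.
  have h1 : it%:R * (K * d%:R + apply_time K A (call_round c).-1) <= it%:R * (K * S).
    by rewrite ler_wpM2l.
  have h2 : it%:R * (K * S) <= K * (5 * r) * (acc * Lm ^+ 2) * (K * S).
    by rewrite ler_wpM2r// mulr_ge0// ltW.
  have h3 : K * d%:R <= K * (r * S) * Lm ^+ 2.
    apply: le_trans (_ : K * (r * S) <= _).
      by rewrite ler_pM2l//; exact: le_trans SrS.
    by rewrite ler_peMr// mulr_ge0// ltW.
  have -> : B = K * (5 * r) * (acc * Lm ^+ 2) * (K * S) + K * (r * S) * Lm ^+ 2.
    by rewrite /B; ring.
  by apply: lerD h3; apply: le_trans tl _; apply: le_trans h1 _.
rewrite /lazysvd_agd_time.
apply: le_trans (lerD (sumr_calls_le tr_calls call_le) (lexx _)) _.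
have -> : (k%:R * (nnz A)%:R + k%:R ^+ 2 * d%:R) / Num.sqrt gap = k%:R * (r * S).
  by rewrite /S /r; ring.
have X0 : 0 <= k%:R * (r * S) by rewrite mulr_ge0.
have sum2 : \sum_(1 <= s < k.+1) K * (s%:R * d%:R) <= K * (k%:R * (r * S)).
  apply: le_trans (_ : \sum_(1 <= s < k.+1) K * (k%:R * d%:R) <= _).
    rewrite big_nat [leRHS]big_nat; apply: ler_sum => s /andP[_ sk'].
    by rewrite ler_pM2l// ler_wpM2r// ler_nat.
  rewrite sumr_const_nat subn1 /= -[leLHS]mulr_natl mulrCA ler_pM2l// ler_wpM2l//.
  by apply: le_trans SrS; rewrite /S -[leLHS]add0r lerD.
apply: le_trans (total_arith (c0 := 5 * K ^+ 2 * acc + K) X0 B0 calls_le _ sum2 _) _.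
- by rewrite le_eqVlt; apply/orP; left; apply/eqP; rewrite /B; ring.
- exact: ltW.
rewrite ler_wpM2r ?exprn_ge0//.
rewrite ler_wpM2r// /cost_const.
have : 0 <= cc * (5 * K * acc) by rewrite !mulr_ge0// ltW.
move: K_gt0; have -> : cc * (5 * K ^+ 2 * acc + 5 * K * acc + K) =
  cc * (5 * K ^+ 2 * acc + K) + cc * (5 * K * acc) by ring.
move: (cc * (5 * K * acc)) (cc * (_ + K)) => y z; lra.
Qed.

Let quarter_power (x : R) : 0 <= x -> x `^ (1 / 4) = Num.sqrt (Num.sqrt x).
Proof.
move=> x0; rewrite -!powR12_sqrt ?powR_ge0// -powRrM; congr (_ `^ _); lra.
Qed.

Lemma svrg_cost (a : 'I_n -> 'cV[R]_d) (tau : call R d -> R) : (k <= n)%N ->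
  (forall i, enorm (a i) <= 1) -> A *m A^T = average_outer a ->
  svrg_time n K tau ->
  lazysvd_svrg_time n k K tau tr <=
    cost_const * (k%:R * n%:R * d%:R
      + k%:R * n%:R `^ (3 / 4) * d%:R / (Num.sqrt sk * Num.sqrt gap)) * Lm ^+ 4.
Proof.
move=> kn a1 AE htau; have K2 : 0 < K ^+ 2 by rewrite exprn_gt0.
have n1 : 1 <= n%:R :> R.
  by rewrite ler1n; apply: leq_trans kn; case/andP: k_bnd.
set z := (Num.sqrt sk)^-1; have z0 : 0 <= z by rewrite invr_ge0 sqrtr_ge0.
set y := n%:R `^ (3 / 4) * d%:R : R.
have y0 : 0 <= y by rewrite mulr_ge0 ?powR_ge0.
have r0 : 0 <= r by exact: le_trans ler01 r_ge1.
set Y := y * (z * r); have Y0 : 0 <= Y by rewrite !mulr_ge0.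
set S := n%:R * d%:R + Y.
have nd0 : 0 <= n%:R * d%:R :> R by rewrite mulr_ge0.
have S0 : 0 <= S by rewrite addr_ge0.
have ndS : n%:R * d%:R <= S by rewrite /S lerDl.
have dS : d%:R <= S by apply: le_trans ndS; rewrite ler_peMl.
set B := (5 * K * acc + K) * S * Lm ^+ 2.
have B0 : 0 <= B.
  have c0 : 0 <= 5 * K * acc + K by rewrite addr_ge0 ?(ltW K_gt0)// !mulr_ge0// ltW.
  by rewrite /B mulr_ge0 ?exprn_ge0// mulr_ge0.
have call_le c : svd_call inv (A *m A^T) k gap eta p (sk ^+ 2) fuel w0 c ->
    tau c + K * d%:R <= B.
  move=> /call_bounds[j [g [[jk cj] cm [lam0 g0 t0] [psd psd'] [rat la lsk]]]].
  have [b b1 bE] := svd_mx_average inv k gap eta p fuel w0 j a1.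
  have cmb : call_mx c = average_outer b by rewrite cm AE.
  have tl := htau c g b lam0 g0 t0 b1 cmb psd'.
  set lam := call_lambda c in lam0 psd' rat la lsk tl.
  have sl : 0 < Num.sqrt lam by rewrite sqrtr_gt0.
  have ss : 0 < Num.sqrt (Num.sqrt lam) by rewrite sqrtr_gt0.
  (* [lam^(1/4) / sqrt g = lam^(-1/4) sqrt (lam / g)], and [lam >= sk^2] turns the first factor into
     at most [1 / sqrt sk]. *)
  have root : lam `^ (1 / 4) / Num.sqrt g <= z * (5 * r).
    rewrite quarter_power ?(ltW lam0)//.
    have -> : Num.sqrt (Num.sqrt lam) / Num.sqrt g =
        (Num.sqrt (Num.sqrt lam))^-1 * (Num.sqrt lam / Num.sqrt g).
      by rewrite -{3}(sqr_sqrtr (ltW sl)) expr2 !mulrA mulVf ?mul1r// gt_eqF.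
    apply: ler_pM; rewrite ?invr_ge0 ?divr_ge0 ?sqrtr_ge0//; last exact: sqrt_ratio.
    rewrite /z lef_pV2 ?posrE ?sqrtr_gt0//; apply: ler_wsqrtr.
    by rewrite -(ger0_norm (ltW sk_gt0)) -sqrtr_sqr; exact: ler_wsqrtr.
  have work : Num.max (n%:R * d%:R)
      (n%:R `^ (3 / 4) * d%:R * lam `^ (1 / 4) / Num.sqrt g) <= 5 * S.
    have S5 : S <= 5 * S by rewrite ler_peMl// ler1n.
    rewrite ge_max (le_trans ndS S5)/= -mulrA -/y.
    apply: le_trans (_ : y * (z * (5 * r)) <= _); first by rewrite ler_wpM2l.
    have -> : y * (z * (5 * r)) = 5 * Y by rewrite /Y; ring.
    by rewrite ler_pM2l// /S lerDr.
  have h1 : K * Num.max (n%:R * d%:R)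
      (n%:R `^ (3 / 4) * d%:R * lam `^ (1 / 4) / Num.sqrt g)
      * log_accuracy lam g (call_tol c) <= K * (5 * S) * (acc * Lm ^+ 2).
    apply: ler_pM => //.
    - by rewrite mulr_ge0 ?(ltW K_gt0)// le_max nd0.
    - by rewrite /log_accuracy le_max ler01.
    - by rewrite ler_pM2l.
  have h3 : K * d%:R <= K * S * Lm ^+ 2.
    apply: le_trans (_ : K * S <= _); first by rewrite ler_pM2l.
    by rewrite ler_peMr// mulr_ge0// ltW.
  have -> : B = K * (5 * S) * (acc * Lm ^+ 2) + K * S * Lm ^+ 2 by rewrite /B; ring.
  by apply: lerD h3; exact: le_trans tl h1.
rewrite /lazysvd_svrg_time.
apply: le_trans (lerD (sumr_calls_le tr_calls call_le) (lexx _)) _.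
have -> : k%:R * n%:R * d%:R +
    k%:R * n%:R `^ (3 / 4) * d%:R / (Num.sqrt sk * Num.sqrt gap) = k%:R * S.
  by rewrite /S /Y /y /z /r invfM; ring.
have X0 : 0 <= k%:R * S by rewrite mulr_ge0.
have sum2 : \sum_(1 <= s < k.+1) K * (s%:R * d%:R + n%:R * d%:R) <= (2 * K) * (k%:R * S).
  apply: le_trans (_ : \sum_(1 <= s < k.+1) K * (2 * S) <= _).
    rewrite big_nat [leRHS]big_nat; apply: ler_sum => s /andP[_ sk'].
    (* As [s <= k <= n], the projection cost [s d] is absorbed by [n d]. *)
    rewrite ler_pM2l// [2 * S]mulr_natl mulr2n lerD//.
    apply: le_trans ndS; rewrite ler_wpM2r// ler_nat.
    by apply: leq_trans kn; rewrite -ltnS.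
  rewrite sumr_const_nat subn1 /= -[leLHS]mulr_natl.
  by rewrite le_eqVlt; apply/orP; left; apply/eqP; ring.
have K20 : 0 <= 2 * K by rewrite mulr_ge0// ltW.
apply: le_trans (total_arith (c0 := 5 * K * acc + K) X0 B0 calls_le _ sum2 K20) _.
  by rewrite le_eqVlt; apply/orP; left; apply/eqP; rewrite /B; ring.
rewrite ler_wpM2r ?exprn_ge0//.
rewrite ler_wpM2r// /cost_const lerD2r ler_pM2l// -addrA lerDr.
by rewrite !mulr_ge0// ltW.
Qed.

End Costs.

(** * Union bound over the rounds *)

Section Starts.
Context {R : realType} {dT dX : measure_display} {T : measurableType dT}.
Context {X : measurableType dX} (P : probability T R) {n : nat}.
Context (xi : T -> X) (w0 : nat -> T -> 'cV[R]_n.+1).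
Context (inv : X -> inversion_method R n.+1).
Context (M : 'M[R]_n.+1) (k : nat) (delta eps p : R) (fuel : nat).
Hypothesis n_gt0 : (0 < n)%N.
Hypothesis m_xi : measurable_fun [set: T] xi.
Hypothesis w_unif : forall s, (1 <= s <= k)%N -> uniform_unit_vector P (w0 s).
Hypothesis indep : independent_starts P k xi w0.
Hypothesis m_inv : inversion_measurable inv.
Hypothesis M_psd : possemidef M.
Hypothesis p_bnd : 0 < p < 1.
Hypothesis k_gt0 : (0 < k)%N.

Let q := p / k%:R.

Let q_bnd : 0 < q < 1.
Proof.
have /andP[p0 p1] := p_bnd.
rewrite /q divr_gt0 ?ltr0n//= ltr_pdivrMr ?ltr0n// mul1r.
by apply: lt_le_trans p1 _; rewrite ler1n.
Qed.

Let mx s t := svd_mx (inv (xi t)) M k delta eps p fuel (w0 ^~ t) s.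

Let m_w s : (1 <= s <= k)%N ->
  measurable_fun [set: T] (w0 s : T -> borel_mx R n.+1 1).
Proof. by move=> /w_unif[]. Qed.

Let round_start s : (s < k)%N -> exists E : set T,
  [/\ measurable E, (P E <= q%:E)%E & forall t, ~ E t ->
    enorm (w0 s.+1 t) = 1 /\ good_start (mx s t) (w0 s.+1 t) (start_mass n.+1 q)].
Proof.
move=> sk; have sk' : (1 <= s.+1 <= k)%N by [].
have Gm : <<s past xi w0 s >> `<=` @measurable _ T.
  apply: smallest_sub; first exact: sigma_algebra_measurable.
  exact: (past_measurable m_xi m_w (ltnW sk)).
have mM : measurable_fun [set: g_sigma_algebraType (past xi w0 s)]
    (mx s : g_sigma_algebraType (past xi w0 s) -> borel_mx R n.+1 n.+1).
  have h := @measurable_svd_state R _ _ X (g_sigma_algebraType (past xi w0 s)) n.+1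
    inv xi M k delta eps p fuel w0 s m_inv (@past_xi _ _ _ _ _ _ _ _ s).
  by apply: (h _).2 => j js; exact: past_w.
have [E [mE PE hE]] := start_probability Gm mM
  (fun t => svd_mx_possemidef _ _ _ _ _ _ _ _ M_psd) n_gt0 q_bnd (w_unif sk')
  (fun C A mC sA => past_independent m_xi m_w indep sk mC sA).
have mD : measurable (w0 s.+1 @^-1` [set x | enorm x = 1]).
  rewrite -[X in measurable X]setTI; apply: m_w => //; exact: measurable_sphere.
have PD : P (~` (w0 s.+1 @^-1` [set x | enorm x = 1])) = 0%E.
  by rewrite probability_setC ?(unit_probability (w_unif sk')) ?subee.
(* A start has norm 1 only almost surely; the exceptional null event joins the bad one. *)
exists (E `|` ~` (w0 s.+1 @^-1` [set x | enorm x = 1])); split.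
- by apply: measurableU => //; exact: measurableC.
- apply: le_trans (measureU2 _ _ _) _ => //; first exact: measurableC.
  by rewrite [X in (_ + X)%E]PD adde0.
- move=> t /not_orP[nE /contrapT un]; split=> //; exact: hE.
Qed.

Lemma starts_probability : exists2 F : set T, measurable F &
  ((1 - p)%:E <= P F)%E /\ forall t, F t -> forall s, (1 <= s <= k)%N ->
    enorm (w0 s t) = 1 /\ good_start (mx s.-1 t) (w0 s t) (start_mass n.+1 q).
Proof.
have /choice[E hE] : forall s, exists E : set T, (s < k)%N ->
  [/\ measurable E, (P E <= q%:E)%E & forall t, ~ E t ->
    enorm (w0 s.+1 t) = 1 /\ good_start (mx s t) (w0 s.+1 t) (start_mass n.+1 q)].
  move=> s; have [sk|ks] := ltnP s k; last by exists set0.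
  by have [E hE] := round_start sk; exists E.
have mE s : (s < k)%N -> measurable (E s) by case/hE.
have mU : measurable (\big[setU/set0]_(s < k) E s).
  by apply: bigsetU_measurable => i _; exact: mE.
exists (~` \big[setU/set0]_(s < k) E s); first exact: measurableC.
split=> [|t nE [//|s] sk]; last first.
  have [_ _ h] := hE s sk; apply: h => Et; apply: nE.
  by rewrite -bigcup_mkord; exists s.
have PU : (P (\big[setU/set0]_(s < k) E s) <= p%:E)%E.
  apply: le_trans (Boole_inequality _ _) _; first by move=> i; exact: mE.
  apply: (@le_trans _ _ (\sum_(s < k) q%:E)%E).
    by apply: lee_sum => i _; have [] := hE i (ltn_ord i).
  rewrite sumEFin lee_fin sumr_const card_ord -mulr_natl /q mulrC divfK//.
  by rewrite pnatr_eq0 -lt0n.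
rewrite probability_setC// EFinB; exact: leeB.
Qed.

End Starts.

(** * Singular vectors *)

Section SingularSystem.
Context {R : realType} {d n : nat} (A : 'M[R]_(d, n)).
Context (sigma : nat -> R) (u : nat -> 'cV[R]_d).
Hypothesis svd : left_singular_system A sigma u.

Let sum_kronecker (V : lmodType R) m (c : nat -> R) (v : nat -> V) i :
  \sum_(1 <= j < m.+1) (c j * (j == i)%:R) *: v j =
  if (1 <= i <= m)%N then c i *: v i else 0.
Proof.
case: ifP => h.
  rewrite (bigD1_seq i) ?mem_index_iota ?iota_uniq//= eqxx mulr1 big1 ?addr0//.
  by move=> j /negbTE ->; rewrite mulr0 scale0r.
rewrite big_nat big1// => j; rewrite ltnS => jm; case: eqP => [ji|_].
  by rewrite -ji jm in h.
by rewrite mulr0 scale0r.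
Qed.

Lemma singular_value_le i j : (1 <= i <= j)%N -> sigma j <= sigma i.
Proof.
move=> /andP[i1]; have [dec _ _ _] := svd.
elim: j => [|j IH]; first by rewrite leqn0 => /eqP i0; rewrite i0 in i1.
rewrite leq_eqVlt => /orP[/eqP -> //|]; rewrite ltnS => ij.
apply: le_trans (IH ij); have /andP[_ //] := dec j (leq_trans i1 ij).
Qed.

Lemma singular_value_ge0 i : (1 <= i)%N -> 0 <= sigma i.
Proof.
have [dec _ _ _] := svd => i1.
by have /andP[h /(le_trans h)] := dec i i1.
Qed.

Lemma gram_singular_vector i : (1 <= i <= d)%N ->
  A *m A^T *m u i = sigma i ^+ 2 *: u i.
Proof.
move=> id; have [_ zero ou [v [ov AE]]] := svd.
have AT : A^T *m u i = \sum_(1 <= j < (minn d n).+1) (sigma j * (j == i)%:R) *: v j.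
  have -> : A^T = \sum_(1 <= j < (minn d n).+1) sigma j *: (v j *m (u j)^T).
    rewrite {1}AE raddf_sum; apply: eq_bigr => j _ /=.
    by rewrite linearZ/= trmx_mul trmxK.
  rewrite mulmx_suml big_nat [RHS]big_nat; apply: eq_bigr => j.
  rewrite ltnS => /andP[j1 jm].
  rewrite -scalemxAl outer_mulmx scalerA; congr (_ * _ *: _).
  by apply: ou => //; rewrite j1 (leq_trans jm) ?geq_minl.
(* Beyond [minn d n] the sum vanishes, in agreement with the padding of [sigma] by zeros. *)
rewrite -mulmxA AT sum_kronecker; case: ifP => [/andP[i1 im]|im]; last first.
  rewrite mulmx0 zero ?expr0n ?scale0r// ltnNge.
  by apply/negP => h; move: im; rewrite h; case/andP: id => ->.
have Av : A *m v i = \sum_(1 <= j < (minn d n).+1) (sigma j * (j == i)%:R) *: u j.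
  rewrite {1}AE mulmx_suml big_nat [RHS]big_nat; apply: eq_bigr => j.
  rewrite ltnS => /andP[j1 jm].
  rewrite -scalemxAl outer_mulmx scalerA; congr (_ * _ *: _).
  by apply: ov; rewrite ?j1 ?i1.
by rewrite -scalemxAr Av sum_kronecker i1 im scalerA expr2.
Qed.

Lemma gram_columns r : (r <= d)%N -> A *m A^T *m columns u 0 r =
  columns u 0 r *m diag_mx (\row_j sigma j.+1 ^+ 2).
Proof.
move=> rd; apply/matrixP => i j; rewrite mul_mx_diag [RHS]mxE.
have -> : (A *m A^T *m columns u 0 r) i j = (A *m A^T *m u j.+1) i 0.
  by rewrite [LHS]mxE [RHS]mxE; apply: eq_bigr => h _; rewrite [columns _ _ _ _ _]mxE add0n.
rewrite gram_singular_vector; last by rewrite ltnS leq0n /= (leq_trans (ltn_ord j)).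
by rewrite !mxE add0n mulrC.
Qed.

Lemma gram_eigenbasis :
  eigenbasis (columns u 0 d) (\row_j sigma j.+1 ^+ 2) (A *m A^T).
Proof.
have [_ _ ou _] := svd; have UU := columns_gram ou; split=> //.
by rewrite -gram_columns// -mulmxA (orthC UU) mulmx1.
Qed.

Lemma gram_possemidef : possemidef (A *m A^T).
Proof.
split=> [|x]; first by rewrite trmx_mul trmxK.
by rewrite quadratic_form -mulmxA dotv_mulmxr dotvv_ge0.
Qed.

Lemma gram_bounded : bounded_by (sigma 1%N ^+ 2) (A *m A^T).
Proof.
move=> x; have b0 : 0 <= sigma 1%N ^+ 2 * enorm x by rewrite mulr_ge0 ?sqr_ge0 ?enorm_ge0.
rewrite enorm_le// [leRHS]exprMn enorm_sqr.
rewrite -!(sum_ecoord_sqr gram_eigenbasis) mulr_sumr; apply: ler_sum => i _.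
rewrite (ecoordM gram_eigenbasis) exprMn ler_wpM2r ?sqr_ge0// mxE.
have s0 : 0 <= sigma i.+1 by exact: singular_value_ge0.
have s1 : sigma i.+1 <= sigma 1%N by exact: singular_value_le.
by rewrite !lerXn2r ?nnegrE ?exprn_ge0// (le_trans s0).
Qed.

Let columns_shift k r : columns u k r = columns (fun i => u (k + i)%N) 0 r.
Proof. by apply/matrixP => i j; rewrite !mxE add0n addnS. Qed.

Lemma tail_columns_gram k : (k <= d)%N ->
  (columns u k (d - k))^T *m columns u k (d - k) = 1%:M.
Proof.
move=> kd; have [_ _ ou _] := svd; rewrite columns_shift; apply: columns_gram.
move=> i j /andP[i1 id] /andP[j1 jd]; rewrite ou ?eqn_add2l//.
  by rewrite addn_gt0 i1 orbT -(subnKC kd) leq_add2l.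
by rewrite addn_gt0 j1 orbT -(subnKC kd) leq_add2l.
Qed.

(** An eigenvalue above [sigma_{k+1}^2] has index at most [k], and the corresponding [u_i] is
    orthogonal to all later ones. *)
Lemma tail_low_vector k t y : (k <= d)%N -> sigma k.+1 ^+ 2 <= t ->
  low_vector (columns u 0 d) (\row_j sigma j.+1 ^+ 2) t (columns u k (d - k) *m y).
Proof.
move=> kd st i; have [_ _ ou _] := svd; rewrite mxE => tl.
have ik : (i < k)%N.
  rewrite ltnNge; apply/negP => ki; move: tl; rewrite ltNge => /negP; apply.
  apply: le_trans st; rewrite lerXn2r ?nnegrE ?singular_value_ge0//.
  exact: singular_value_le.
rewrite /ecoord columns_tr_mul dotv_mulmxr.
rewrite (_ : (columns u k (d - k))^T *m u i.+1 = 0) ?dotv0l//.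
apply/colP => j; rewrite columns_shift columns_tr_mul [RHS]mxE.
have jd : (1 <= k + j.+1 <= d)%N.
  by rewrite addn_gt0 orbT -leq_subRL ?ltn_ord.
rewrite /dotv ou//; last exact: (leq_trans ik).
by rewrite gtn_eqF// addnS ltnS; apply: leq_trans ik _; exact: leq_addr.
Qed.

End SingularSystem.

(** Used with [L = sigma_1^2] and [l = sigma_k^2]. Here [sqrt eta = eps^2 gap l / (4 k^2 L)], with
    1/4 the root of 1/16; the two terms contribute at most [eps^2 / 4] and exactly [eps^2 / 2]. *)
Lemma lazysvd_accuracy (R : realType) (k : nat) (eps gap L l eta : R) :
  (0 < k)%N -> 0 < eps <= 1 -> 0 < gap <= 1 -> 0 < l <= L ->
  eta = 16^-1 * (eps ^+ 4 * gap ^+ 2 / (k%:R ^+ 4 * (L / l) ^+ 2)) ->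
  k%:R * (Num.sqrt eta + Num.sqrt eta * L / (gap * l / (2 * k%:R))) <= eps.
Proof.
move=> k0 /andP[e0 e1] /andP[g0 g1] /andP[l0 lL] etaE.
have k1 : 1 <= k%:R :> R by rewrite ler1n.
have kk0 : 0 < k%:R :> R by rewrite ltr0n.
have L0 : 0 < L by exact: lt_le_trans lL.
have -> : Num.sqrt eta = eps ^+ 2 * gap * l / (4 * k%:R ^+ 2 * L).
  have -> : eta = (eps ^+ 2 * gap * l / (4 * k%:R ^+ 2 * L)) ^+ 2.
    by rewrite etaE; field; rewrite !gt_eqF.
  by rewrite sqrtr_sqr ger0_norm// !mulr_ge0 ?invr_ge0 ?mulr_ge0 ?exprn_ge0// ltW.
have -> : k%:R * (eps ^+ 2 * gap * l / (4 * k%:R ^+ 2 * L) +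
    eps ^+ 2 * gap * l / (4 * k%:R ^+ 2 * L) * L / (gap * l / (2 * k%:R))) =
    eps ^+ 2 * (4^-1 * (gap * (l / L) / k%:R) + 2^-1).
  by field; rewrite !gt_eqF.
have h1 : gap * (l / L) / k%:R <= 1.
  rewrite ler_pdivrMr// mul1r; apply: le_trans k1.
  by rewrite mulr_ile1 ?(ltW g0) ?divr_ge0 ?(ltW l0) ?(ltW L0)// ler_pdivrMr// mul1r.
have e2 : eps ^+ 2 <= eps by rewrite expr2 ler_piMl// ltW.
apply: le_trans (_ : eps ^+ 2 * 1 <= _); last by rewrite mulr1.
rewrite ler_wpM2l ?exprn_ge0 ?(ltW e0)//; lra.
Qed.

Lemma spectral_norm_le (R : realType) (m n : nat) (B : 'M[R]_(m, n)) (b : R) :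
  (forall x, enorm x <= 1 -> enorm (B *m x) <= b) -> spectral_norm B <= b.
Proof.
move=> h; rewrite /spectral_norm; apply: ge_sup => [|_ [x x1 <-]]; last exact: h.
exists (enorm (B *m 0)); exists 0 => //=.
by rewrite (_ : enorm 0 = 0) ?ler01//; apply/eqP; rewrite enorm_eq0.
Qed.

Lemma orthonormal_rank (R : realType) (m n : nat) (V : 'M[R]_(m, n)) :
  V^T *m V = 1%:M -> \rank V = n.
Proof.
move=> VV; apply/eqP; rewrite eqn_leq rank_leq_col/=.
by rewrite -{1}(mxrank1 R n) -VV mxrankM_maxr.
Qed.

(** * The run on a singular system *)

Section DeterministicRun.
Context {R : realType} {d n k : nat} (A : 'M[R]_(d, n)).
Context (sigma : nat -> R) (u : nat -> 'cV[R]_d) (eps p : R).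
Hypothesis svd : left_singular_system A sigma u.
Hypothesis sigma1_le1 : sigma 1%N <= 1.
Hypothesis k_bnd : (1 <= k <= d)%N.
Hypothesis eps_gt0 : 0 < eps.
Hypothesis p_bnd : 0 < p < 1.
Let gap := (sigma k - sigma k.+1) / sigma k.
Let eta := 16^-1 * (eps ^+ 4 * gap ^+ 2 / (k%:R ^+ 4 * (sigma 1%N / sigma k) ^+ 4)).
Hypothesis gap_bnd : 0 < gap < 1.
Hypothesis eta_bnd : 0 < eta < 1.

Let k_gt0 : (0 < k)%N. Proof. by case/andP: k_bnd. Qed.

Lemma gap_singular_value_gt0 : 0 < sigma k.
Proof.
rewrite lt_neqAle (singular_value_ge0 svd)// andbT eq_sym; apply/eqP => s0.
by have := gap_bnd; rewrite /gap s0 invr0 mulr0 ltxx.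
Qed.

Let sigmak_gt0 : 0 < sigma k. Proof. exact: gap_singular_value_gt0. Qed.

Let sigmak_le1 : sigma k <= 1.
Proof. by apply: le_trans sigma1_le1; apply: (singular_value_le svd). Qed.

Let sigma1_gt0 : 0 < sigma 1%N.
Proof. by apply: lt_le_trans sigmak_gt0 _; apply: (singular_value_le svd). Qed.

Let sigmakS : sigma k.+1 = (1 - gap) * sigma k.
Proof. by rewrite /gap; field; rewrite gt_eqF. Qed.

(** [gap < 1] means [sigma_{k+1}] is nonzero. This yields dimension at least 2, as anticoncentration
    requires, and [k <= n] for the stochastic cost. *)
Lemma rank_lt_min : (k < minn d n)%N.
Proof.
have [_ zero _ _] := svd; rewrite ltnNge; apply/negP => h.
have : sigma k.+1 = 0 by apply: zero; rewrite ltnS.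
rewrite sigmakS => /eqP; rewrite mulf_eq0 [sigma k == 0]gt_eqF// orbF subr_eq0.
by case/andP: gap_bnd => _ g1 /eqP g; rewrite -g ltxx in g1.
Qed.

Let kd : (k <= d)%N. Proof. by case/andP: k_bnd. Qed.

Context (inv : inversion_method R d) (w0 : nat -> 'cV[R]_d).
Hypothesis inv_correct : inversion_correct inv.
Let fuel := pass_bound gap (sigma k).
Hypothesis starts : forall s, (1 <= s <= k)%N -> enorm (w0 s) = 1 /\
  good_start (svd_mx inv (A *m A^T) k gap eta p fuel w0 s.-1) (w0 s)
    (start_mass d (p / k%:R)).

Lemma lazysvd_run : exists (V : 'M[R]_(d, k)) tr,
  [/\ lazysvd inv (A *m A^T) k gap eta p w0 V tr,
      [/\ \rank V = k, V^T *m V = 1%:M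
        & spectral_norm (V^T *m columns u k (d - k)) <= eps],
      all_calls (svd_call inv (A *m A^T) k gap eta p (sigma k ^+ 2) fuel w0) tr
    & (size tr <= k * round_calls (d := d) k eta p fuel)%N].
Proof.
have /andP[g0 g1] := gap_bnd.
have L_bnd : 0 < sigma 1%N ^+ 2 <= 1 by rewrite exprn_gt0//= exprn_ile1// ltW.
have [_ _ ou _] := svd.
have UU : (columns u 0 k)^T *m columns u 0 k = 1%:M.
  apply: columns_gram => i j /andP[i1 ik] /andP[j1 jk].
  by apply: ou; rewrite ?i1 ?j1 (leq_trans _ kd).
have mu_ge (i : 'I_k) : sigma k ^+ 2 <= (\row_j sigma j.+1 ^+ 2 : 'rV[R]_k) 0 i.
  have ki : sigma k <= sigma i.+1 by apply: (singular_value_le svd); rewrite /= ltn_ord.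
  by rewrite mxE lerXn2r ?nnegrE ?(ltW sigmak_gt0)// (le_trans (ltW sigmak_gt0)).
have sk_bnd : 0 < sigma k <= 1 by rewrite sigmak_gt0.
have fuel_ok := pass_bound_enough gap_bnd sk_bnd.
have [V [tr [run VV acc calls sz]]] := lazysvd_correct inv_correct (gram_possemidef A)
  (gram_bounded svd) L_bnd UU (gram_columns svd kd) mu_ge (exprn_gt0 2 sigmak_gt0)
  gap_bnd eta_bnd p_bnd k_bnd fuel_ok starts.
exists V, tr; split=> //; split=> //; first exact: orthonormal_rank.
apply: spectral_norm_le => y y1; rewrite -mulmxA.
set x := columns u k (d - k) *m y.
have xn : enorm x <= 1 by rewrite /x enorm_orth//; exact: (tail_columns_gram svd kd).
(* [eps_pca < 1] does not force [eps <= 1]; for larger [eps] the claim holds because [V^T] and [W]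
   do not increase norms. *)
have [e1|/ltW e1] := leP eps 1; last first.
  by apply: le_trans (enorm_tr_mul x VV) _; exact: le_trans e1.
(* [sigma_{k+1}^2 = (1 - gap)^2 sigma_k^2 <= (1 - gap) sigma_k^2], the lowest of the thresholds. *)
have low : low_vector (columns u 0 d) (\row_j sigma j.+1 ^+ 2)
    ((1 - gap) * sigma k ^+ 2) x.
  apply: (tail_low_vector svd _ kd); rewrite sigmakS exprMn ler_wpM2r ?sqr_ge0//.
  by rewrite expr2 ler_piMl// ?subr_ge0 ?gerBl ltW.
apply: le_trans (acc _ _ _ (gram_eigenbasis svd) low) _.
have etaE : eta = 16^-1 * (eps ^+ 4 * gap ^+ 2 /
    (k%:R ^+ 4 * (sigma 1%N ^+ 2 / sigma k ^+ 2) ^+ 2)).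
  by rewrite /eta -expr_div_n -exprM.
have sL : 0 < sigma k ^+ 2 <= sigma 1%N ^+ 2.
  rewrite exprn_gt0//= lerXn2r ?nnegrE ?(ltW sigmak_gt0) ?(ltW sigma1_gt0)//.
  exact: (singular_value_le svd).
have ge1 : 0 < gap <= 1 by rewrite g0 ltW.
have e01 : 0 < eps <= 1 by rewrite eps_gt0.
apply: le_trans (lazysvd_accuracy k_gt0 e01 ge1 sL etaE).
rewrite ler_piMr// mulr_ge0// addr_ge0 ?sqrtr_ge0//.
apply: divr_ge0; first by rewrite mulr_ge0 ?sqrtr_ge0 ?sqr_ge0.
by apply: divr_ge0; rewrite mulr_ge0 ?sqr_ge0 ?(ltW g0).
Qed.

End DeterministicRun.

Theorem corollary4p3 (R : realType) :
  exists2 c : R, 0 < c &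
  forall K : R, 0 < K ->
  exists (C : R) (q : nat), 0 < C /\
  forall (d n k : nat) (A : 'M[R]_(d, n)) (sigma : nat -> R)
    (u : nat -> 'cV[R]_d) (eps p : R),
  left_singular_system A sigma u ->
  sigma 1%N <= 1 ->
  (1 <= k <= d)%N ->
  0 < eps ->
  0 < p < 1 ->
  let gap := (sigma k - sigma k.+1) / sigma k in
  let eps_pca :=
    c * (eps ^+ 4 * gap ^+ 2 / (k%:R ^+ 4 * (sigma 1%N / sigma k) ^+ 4)) in
  0 < gap < 1 ->
  0 < eps_pca < 1 ->
  let W := columns u k (d - k) in
  let log_args := [:: gap^-1; eps^-1; p^-1; n%:R; d%:R; k%:R;
    (sigma 1%N)^-1; sigma 1%N / sigma k; sigma 1%N / sigma k.+1] in
  forall (dT dX : measure_display) (T : measurableType dT)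
    (X : measurableType dX) (P : probability T R)
    (xi : T -> X) (w0 : nat -> T -> 'cV[R]_d)
    (inv : X -> inversion_method R d),
  measurable_fun [set: T] xi ->
  (forall s, (1 <= s <= k)%N -> uniform_unit_vector P (w0 s)) ->
  independent_starts P k xi w0 ->
  inversion_measurable inv ->
  (forall x, inversion_correct (inv x)) ->
  let output (t : T) (V : 'M[R]_(d, k)) (tr : seq (call R d)) :=
    lazysvd (inv (xi t)) (A *m A^T) k gap eps_pca p (w0 ^~ t) V tr in
  let good (V : 'M[R]_(d, k)) :=
    [/\ \rank V = k, V^T *m V = 1%:M & spectral_norm (V^T *m W) <= eps] in
  [/\ with_probability P (1 - p)
        (fun t => exists V tr, output t V tr /\ good V),
      forall tau : X -> call R d -> R,
        (forall x, agd_time K A (tau x)) ->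
        with_probability P (1 - p)
          (fun t => exists V tr,
             [/\ output t V tr, good V
               & lazysvd_agd_time k K (tau (xi t)) tr <=
                 C * ((k%:R * (nnz A)%:R + k%:R ^+ 2 * d%:R) / Num.sqrt gap)
                   * polylog q log_args])
    & forall (a : 'I_n -> 'cV[R]_d) (tau : X -> call R d -> R),
        (forall i, enorm (a i) <= 1) ->
        A *m A^T = average_outer a ->
        (forall x, svrg_time n K (tau x)) ->
        with_probability P (1 - p)
          (fun t => exists V tr,
             [/\ output t V tr, good V
               & lazysvd_svrg_time n k K (tau (xi t)) tr <=
                 C * (k%:R * n%:R * d%:R
                      + k%:R * n%:R `^ (3 / 4) * d%:R
                        / (Num.sqrt (sigma k) * Num.sqrt gap))
                   * polylog q log_args])].

Proof.
exists 16^-1; first by rewrite invr_gt0 ltr0n.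
move=> K K0; exists (cost_const K), 4%N; split; first exact: cost_const_gt0.
case=> [|d] n k A sigma u eps p svd s1 k_bnd eps0 p_bnd gap eta gap_bnd eta_bnd
    W log_args dT dX T X P xi w0 inv m_xi w_unif indep m_inv i_corr output good.
  by case/andP: k_bnd => k1 k0; have := leq_trans k1 k0.
have kmin : (k < minn d.+1 n)%N := rank_lt_min svd k_bnd gap_bnd.
have k0 : (0 < k)%N by case/andP: k_bnd.
have d0 : (0 < d)%N.
  by rewrite -ltnS; apply: leq_ltn_trans k0 _; rewrite (leq_trans kmin) ?geq_minl.
have kn : (k <= n)%N by rewrite ltnW// (leq_trans kmin) ?geq_minr.
have sk0 : 0 < sigma k := gap_singular_value_gt0 svd k_bnd gap_bnd.
have s10 : 0 < sigma 1%N by apply: lt_le_trans sk0 _; apply: (singular_value_le svd).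
have sk_bnd : 0 < sigma k <= 1.
  by rewrite sk0; apply: le_trans s1; apply: (singular_value_le svd).
have [F mF [PF hF]] := starts_probability gap eta (pass_bound gap (sigma k))
  d0 m_xi w_unif indep m_inv (gram_possemidef A) p_bnd k0.
have run t : F t -> exists V tr, [/\ output t V tr, good V,
    all_calls (svd_call (inv (xi t)) (A *m A^T) k gap eta p (sigma k ^+ 2)
      (pass_bound gap (sigma k)) (w0 ^~ t)) tr
  & (size tr <= k * round_calls (d := d.+1) k eta p (pass_bound gap (sigma k)))%N].
  move=> Ft; exact: (lazysvd_run svd s1 k_bnd eps0 p_bnd gap_bnd eta_bnd
    (i_corr (xi t)) (hF t Ft)).
(* [polylog 1] of the list dominates every hidden logarithm, as all its factors are at least 1; it
   plays the role of [Lm], and its fourth power is [polylog 4]. *)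
have Lm x : x \in log_args -> ln x <= polylog 1 log_args by exact: polylog1_ge.
have Lm1 := polylog1_ge1 log_args.
split=> [|tau htau|a tau a1 AE htau].
- exists F => //; split=> // t Ft; have [V [tr [out gd _ _]]] := run t Ft.
  by exists V, tr.
- exists F => //; split=> // t Ft; have [V [tr [out gd calls sz]]] := run t Ft.
  exists V, tr; split=> //; rewrite polylogE.
  apply: (agd_cost K0 k_bnd gap_bnd eps0 p_bnd s10 sk_bnd Lm1 _ _ _ _ _ _ _
    eta_bnd (gram_possemidef A) calls sz (htau (xi t)));
    by apply: Lm; rewrite !inE eqxx ?orbT.
- exists F => //; split=> // t Ft; have [V [tr [out gd calls sz]]] := run t Ft.
  exists V, tr; split=> //; rewrite polylogE.
  apply: (svrg_cost K0 k_bnd gap_bnd eps0 p_bnd s10 sk_bnd Lm1 _ _ _ _ _ _ _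
    eta_bnd (gram_possemidef A) calls sz kn a1 AE (htau (xi t)));
    by apply: Lm; rewrite !inE eqxx ?orbT.
Qed.
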